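(* Let $\alpha<\beta$ be fixed real numbers and let $f$ be a fixed transcendental real-valued function on $[\alpha,\beta]$, analytic in a complex neighborhood of $[\alpha,\beta]$. For $d\in\mathbb N$ put $N=(d+1)(d+2)/2$. Then, for $u,v\to\infty$ (positive integers), $d\to\infty$, and $\gamma\in[3,N]$, the problem ''determine all integers $X$ with $\alpha\le X/u\le\beta$ for which there exists $Y\in\mathbb Z$ with $|f(X/u)-Y/v|<1/w$'' can heuristically be solved (in the sense made precise in the context) for some $$w = 2^{O(\sqrt{\gamma N})}\,(uv)^{\frac{d}{3\psi(N/\gamma)}(1+O(1/d))}$$ over $[\alpha,\beta]$, using $$(\beta-\alpha)\,2^{O(\sqrt{N/\gamma})}\,(uv)^{\frac{d}{3\psi(N/\gamma)\gamma}(1+O(1/d))}$$ calls to Algorithm 2 (described in the context) with parameter $d$.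
   Context: **The function $\psi$.** Let $\varphi:[1,\infty)\to[1,\infty)$, $\varphi(x)=(1+\lfloor x\rfloor)(x-\lfloor x\rfloor/2)$, which is a bijection, and for $\lambda\ge 1$ $$\psi(\lambda)=\frac{1+\lfloor\varphi^{-1}(\lambda)\rfloor}{12\lambda}\left(6\varphi^{-1}(\lambda)^2-\lfloor\varphi^{-1}(\lambda)\rfloor-2\lfloor\varphi^{-1}(\lambda)\rfloor^2\right).$$ **Notation.** $T_n$ is the $n$-th Chebyshev polynomial of the first kind, $T_{n,[a,b]}(x)=T_n\left(\frac{2x-b-a}{b-a}\right)$. The $n$ Chebyshev nodes of $[a,b]$ are the zeros of $T_{n,[a,b]}$. For $\rho>1$, $E_{\rho,a,b}\subset\mathbb C$ is the compact region bounded by the ellipse $\left\{\frac{b-a}{2}\cdot\frac{\rho e^{i\theta}+\rho^{-1}e^{-i\theta}}{2}+\frac{a+b}{2}:\theta\in[0,2\pi]\right\}$. **Algorithm 2.** Input: reals $a_1<b_1$, $a_2<b_2$; $f$ analytic in a neighborhood of $E_{\rho_1,a_1,b_1}$; positive integers $d,N_1,N_2,u,v$; reals $\rho_1,\rho_2\ge2$; with $N_1,N_2\ge 2$, $N_1N_2\ge N=(d+1)(d+2)/2$ and $64(\rho_1^{-N_1}+\rho_2^{-N_2})\,v\max_{z_1\in E_{\rho_1,a_1,b_1},z_2\in E_{\rho_2,a_2,b_2}}|f(z_1)+z_2|<1$. 1. Let $(f_i)_{0\le i\le N-1}$ be the list of the functions $(ux)^k(v(f(x)+t))^\ell$, $0\le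 k+\ell\le d$. For each $i=(k,\ell)$, compute the coefficients, in the basis $T_{k_1,[a_1,b_1]}(x)T_{k_2,[a_2,b_2]}(t)$, $0\le k_1<N_1$, $0\le k_2<N_2$, of the polynomial of degree $<N_1$ in $x$ and $<N_2$ in $t$ interpolating $f_i$ at all pairs (Chebyshev node of order $N_1$ of $[a_1,b_1]$, Chebyshev node of order $N_2$ of $[a_2,b_2]$). They form row $i$ of an $N\times N_1N_2$ matrix $A_1$. Let $A_2$ be the $N\times N$ diagonal matrix with entries $R_i=64\,u^kv^\ell\big(\max_{z\in E_{\rho_1,a_1,b_1}}|z|\big)^k\big(\max_{z_1\in E_{\rho_1,a_1,b_1},z_2\in E_{\rho_2,a_2,b_2}}|f(z_1)+z_2|\big)^\ell(\rho_1^{-N_1}+\rho_2^{-N_2})$. Let $\mathsf{tprec}=\lceil-\log_2(\min_iR_i)+\log_2N\rceil+2$, and let $M$ be the integer $N\times(N_1N_2+N)$ matrix obtained from $2^{\mathsf{tprec}}(A_1|A_2)$ by rounding every entry toward $0$. 2. Apply the LLL algorithm to the rows of $M$, obtaining $UM$ with $U$ unimodular. If the first two rows of $UM$ do not both have Euclidean norm at most $2^{\mathsf{tprec}}/(N+N_1N_2)$, return FAIL. 3. Otherwise let $P_0,P_1\in\mathbb Z[X_1,X_2]$ be the polynomials $\sum_{i=(k,\ell)}U[r,i]X_1^kX_2^\ell$, $r=0,1$. Let $R(X_1)=\mathrm{Res}_{X_2}(P_0,P_1)$. If $R\ne 0$ return $\mathcal L=\{t\in\mathbb Z:R(t)=0\}$;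 otherwise return FAIL. **''Heuristically solved''.** For the given $w$, $[\alpha,\beta]$ is covered by subintervals $[a_1,b_1]$, one for each call of Algorithm 2, with $[a_2,b_2]=[-1/w,1/w]$ and suitable auxiliary parameters $N_1,N_2,\rho_1,\rho_2$. Each call passes the test of step 2 and produces $P_0,P_1$ with $|P_r(ux,v(f(x)+t))|<1$ for all $x\in[a_1,b_1]$, $t\in[a_2,b_2]$, $r=0,1$. The only heuristic assumption is that, in each call, $P_0$ and $P_1$ have no nonconstant common factor; under it, the returned lists together contain all the sought integers $X$. *)

(* Defs.v *)
From HB Require Import structures.
From mathcomp Require Import all_boot all_order all_algebra.
From mathcomp Require Import all_classical all_reals all_analysis.
From mathcomp Require Import complex.

Set Implicit Arguments.
Unset Strict Implicit.
Unset Printing Implicit Defensive.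

Import Order.TTheory GRing.Theory Num.Theory.
Import numFieldNormedType.Exports.

Local Open Scope classical_set_scope.
Local Open Scope complex_scope.
Local Open Scope ring_scope.

Definition phi (R : realType) (x : R) : R :=
  (1 + (Num.floor x)%:~R) * (x - (Num.floor x)%:~R / 2).

(* [phi] is a bijection of [1, +oo[, so for 1 <= l this is the only x >= 1
   such that phi x = l (junk value 1 if l < 1). *)
Definition phi_inv (R : realType) (l : R) : R :=
  xget 1 [set x : R | 1 <= x /\ phi x = l].

Definition psi (R : realType) (l : R) : R :=
  let x := phi_inv l in
  let n : R := (Num.floor x)%:~R in
  (1 + n) / (12 * l) * (6 * x ^+ 2 - n - 2 * n ^+ 2).

Fixpoint cheb_pair (R : nzRingType) (n : nat) : {poly R} * {poly R} :=
  if n is m.+1 then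
    let: (p, q) := cheb_pair R m in (q, 2 *: ('X * q) - p)
  else (1, 'X).

Definition cheb (R : nzRingType) (n : nat) : {poly R} := (cheb_pair R n).1.

Definition cheb_on (R : fieldType) (n : nat) (a b : R) : {poly R} :=
  cheb R n \Po ((2 / (b - a)) *: 'X - ((b + a) / (b - a))%:P).

Definition expi (R : realType) (theta : R) : R[i] := cos theta +i* sin theta.

Definition ellipse_pt (R : realType) (rho a b theta : R) : R[i] :=
  ((b - a) / 2)%:C *
    ((rho%:C * expi theta + (rho^-1)%:C * expi (- theta)) / 2)
  + ((a + b) / 2)%:C.

(* The region bounded by an ellipse is the union of the segments joining its
   centre to its points. *)
Definition ellipse_region (R : realType) (rho a b : R) : set R[i] :=
  [set z | exists theta r : R,
     [/\ 0 <= theta <= 2 * pi, 0 <= r <= 1 &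
         z = ((a + b) / 2)%:C
             + r%:C * (ellipse_pt rho a b theta - ((a + b) / 2)%:C)]].

(* [R[i]^o] is [R[i]] with its usual topology, given by the modulus. *)
Definition analytic_at (R : realType) (f : R[i] -> R[i]) (z0 : R[i]^o) : Prop :=
  exists c : nat -> R[i]^o,
    \forall z \near z0,
      series (fun n => c n * (z - z0) ^+ n) @ \oo --> (f z : R[i]^o).

Definition analytic_near (R : realType) (f : R[i] -> R[i]) (K : set R[i]) :
    Prop :=
  exists D : set R[i]^o,
    [/\ open D, K `<=` D & forall z, D z -> analytic_at f z].

Definition real_segment (R : realType) (a b : R) : set R[i] :=
  [set x%:C | x in [set x : R | a <= x <= b]].

Definition real_part (R : realType) (f : R[i] -> R[i]) (x : R) : R :=
  complex.Re (f x%:C).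

Definition transcendental_on (R : realType) (a b : R) (g : R -> R) : Prop :=
  ~ exists P : {poly {poly R}},
      P != 0 /\ forall x, a <= x <= b -> P.[(g x)%:P].[x] = 0.

Definition sqnorm (R : pzRingType) (n : nat) (x : 'rV[R]_n) : R :=
  \sum_j x 0 j ^+ 2.

(* The rows of [B] are LLL-reduced (with the usual parameter 3/4): [Bs] is the
   Gram-Schmidt orthogonalization of the rows of [B], [mu] the matrix of
   Gram-Schmidt coefficients. *)
Definition LLL_reduced (R : realType) (n m : nat) (B : 'M[int]_(n, m)) : Prop :=
  exists (Bs : 'M[R]_(n, m)) (mu : 'M[R]_n),
    [/\ map_mx intr B = mu *m Bs,
        is_diag_mx (Bs *m Bs^T),
        is_trig_mx mu /\ (forall i, mu i i = 1),
        (forall i j : 'I_n, (j < i)%N -> `|mu i j| <= 1 / 2) &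
        (forall i j : 'I_n, j = i.+1 :> nat ->
           (3 / 4 - mu j i ^+ 2) * sqnorm (row i Bs) <= sqnorm (row j Bs))].

Definition numN (d : nat) : nat := ((d.+1 * d.+2) %/ 2)%N.

(* The pairs (k, l) with k + l <= d, listed by increasing k + l; there are
   [numN d] of them. *)
Definition exponents (d : nat) : seq (nat * nat) :=
  [seq ((s - l)%N, l) | s <- iota 0 d.+1, l <- iota 0 s.+1].

Definition expo (d i : nat) : nat * nat := nth (0, 0)%N (exponents d) i.

Definition log2 (R : realType) (x : R) : R := ln x / ln 2.

Definition round0 (R : realType) (x : R) : int :=
  if 0 <= x then Num.floor x else Num.ceil x.

(* Row number [r] of a matrix, with a default value when [n <= r]. *)
Definition nth_row (R : nmodType) (n m : nat) (A : 'M[R]_(n, m)) (r : nat) :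
    'rV[R]_m :=
  if insub r is Some i then row i A else 0.

Record input (R : realType) := Input {
  in_f : R[i] -> R[i];
  in_a1 : R; in_b1 : R; in_a2 : R; in_b2 : R;
  in_rho1 : R; in_rho2 : R;
  in_d : nat; in_N1 : nat; in_N2 : nat; in_u : nat; in_v : nat }.

Section Algorithm2.
Variables (R : realType) (I : input R).

Local Notation f := (in_f I).
Local Notation a1 := (in_a1 I).
Local Notation b1 := (in_b1 I).
Local Notation a2 := (in_a2 I).
Local Notation b2 := (in_b2 I).
Local Notation rho1 := (in_rho1 I).
Local Notation rho2 := (in_rho2 I).
Local Notation d := (in_d I).
Local Notation N1 := (in_N1 I).
Local Notation N2 := (in_N2 I).
Local Notation u := ((in_u I)%:R : R).
Local Notation v := ((in_v I)%:R : R).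
Local Notation N := (numN d).
Local Notation E1 := (ellipse_region rho1 a1 b1).
Local Notation E2 := (ellipse_region rho2 a2 b2).

Definition max_z : R := sup [set Normc.normc z | z in E1].

Definition max_fz : R := sup [set Normc.normc (f z.1 + z.2) | z in E1 `*` E2].

Definition valid_input : Prop :=
  [/\ a1 < b1 /\ a2 < b2,
      analytic_near f E1,
      [&& (0 < d)%N, (0 < in_u I)%N & (0 < in_v I)%N],
      (2 <= rho1 /\ 2 <= rho2) /\ [&& (1 < N1)%N, (1 < N2)%N & (N <= N1 * N2)%N] &
      64 * (rho1 ^- N1 + rho2 ^- N2) * v * max_fz < 1].

Definition basis_fun (k l : nat) (x t : R) : R :=
  (u * x) ^+ k * (v * (real_part f x + t)) ^+ l.

(* Coordinates, in the Chebyshev basis, of the polynomial interpolating [g] at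
   the pairs of Chebyshev nodes. *)
Definition interpolates (g : R -> R -> R) (c : 'M[R]_(N1, N2)) : Prop :=
  forall x t, root (cheb_on N1 a1 b1) x -> root (cheb_on N2 a2 b2) t ->
    \sum_(k1 < N1) \sum_(k2 < N2)
      c k1 k2 * (cheb_on k1 a1 b1).[x] * (cheb_on k2 a2 b2).[t] = g x t.

Definition interp_coefs (g : R -> R -> R) : 'M[R]_(N1, N2) :=
  xget 0 [set c | interpolates g c].

Definition alg2_A1 : 'M[R]_(N, N1 * N2) :=
  \matrix_(i < N)
    mxvec (interp_coefs (basis_fun (expo d i).1 (expo d i).2)).

Definition alg2_R (i : nat) : R :=
  64 * u ^+ (expo d i).1 * v ^+ (expo d i).2 *
  max_z ^+ (expo d i).1 * max_fz ^+ (expo d i).2 *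
  (rho1 ^- N1 + rho2 ^- N2).

Definition alg2_A2 : 'M[R]_N := diag_mx (\row_i alg2_R i).

Definition tprec : int :=
  Num.ceil (- log2 (\big[Num.min/alg2_R 0]_(i < N) alg2_R i) + log2 (N%:R : R))
  + 2.

Definition alg2_M : 'M[int]_(N, N1 * N2 + N) :=
  map_mx (@round0 R) ((2 : R) ^ tprec *: row_mx alg2_A1 alg2_A2).

(* [U] describes an output [U *m alg2_M] of LLL on the rows of [alg2_M]. *)
Definition LLL_output (U : 'M[int]_N) : Prop :=
  U \in unitmx /\ LLL_reduced R (U *m alg2_M).

Definition passes (U : 'M[int]_N) : bool :=
  [forall r : 'I_2,
     Num.sqrt (sqnorm (map_mx intr (nth_row (U *m alg2_M) r) : 'rV[R]_(N1 * N2 + N)))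
       <= (2 : R) ^ tprec / (N + N1 * N2)%:R].

(* Elements of Z[X1, X2] are polynomials in X2 (the outer variable) over
   Z[X1]. *)
Definition alg2_P (U : 'M[int]_N) (r : nat) : {poly {poly int}} :=
  \sum_(i < N)
    (nth_row U r 0 i *: 'X^((expo d i).1))%:P * 'X^((expo d i).2).

Definition alg2_res (U : 'M[int]_N) : {poly int} :=
  resultant (alg2_P U 0) (alg2_P U 1).

(* [None] stands for FAIL. *)
Definition alg2_result (U : 'M[int]_N) : option (set int) :=
  if passes U && (alg2_res U != 0)
  then Some [set t : int | root (alg2_res U) t] else None.

End Algorithm2.

Definition eval2 (R : realType) (P : {poly {poly int}}) (x y : R) : R :=
  (map_poly (fun q : {poly int} => (map_poly intr q).[x]) P).[y].

Definition no_common_factor (P Q : {poly {poly int}}) : Prop :=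
  forall G P' Q' : {poly {poly int}},
    P = P' * G -> Q = Q' * G -> exists c : int, G = c%:P%:P.

(* The part of the input that changes from one call to another: the
   subinterval [a1, b1] and the auxiliary parameters. *)
Record call (R : realType) := Call {
  call_a1 : R; call_b1 : R; call_rho1 : R; call_rho2 : R;
  call_N1 : nat; call_N2 : nat }.

Definition call_input (R : realType) (f : R[i] -> R[i]) (w : R) (d u v : nat)
    (c : call R) : input R :=
  Input f (call_a1 c) (call_b1 c) (- w^-1) w^-1
    (call_rho1 c) (call_rho2 c) d (call_N1 c) (call_N2 c) u v.

Definition sought (R : realType) (alpha beta : R) (g : R -> R) (u v : nat)
    (w : R) (X : int) : Prop :=
  alpha <= X%:~R / u%:R <= beta /\
  exists Y : int, `|g (X%:~R / u%:R) - Y%:~R / v%:R| < 1 / w.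

(* The problem is heuristically solved with [K] calls with parameter [d].  The
   output of LLL is only known to be some LLL-reduced basis, whence the
   quantification over all the possible outputs. *)
Definition heuristically_solved (R : realType) (alpha beta : R)
    (f : R[i] -> R[i]) (u v d : nat) (w : R) (K : nat) : Prop :=
  exists c : 'I_K -> call R,
  let I j := call_input f w d u v (c j) in
  [/\ (forall j, alpha <= call_a1 (c j) /\ call_b1 (c j) <= beta),
      (forall x, alpha <= x <= beta ->
         exists j, call_a1 (c j) <= x <= call_b1 (c j)),
      (forall j, valid_input (I j) /\ exists U, LLL_output (I := I j) U),
      (forall j U, LLL_output (I := I j) U ->
         passes U /\
         forall (r : 'I_2) (x t : R),
           call_a1 (c j) <= x <= call_b1 (c j) -> - w^-1 <= t <= w^-1 ->
           `|eval2 (alg2_P U r) (u%:R * x) (v%:R * (real_part f x + t))| < 1) &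
      (forall U : (forall j, 'M[int]_(numN (in_d (I j)))),
         (forall j, LLL_output (U j)) ->
         (forall j, no_common_factor (alg2_P (U j) 0) (alg2_P (U j) 1)) ->
         exists L : 'I_K -> set int,
           (forall j, alg2_result (U j) = Some (L j)) /\
           forall X, sought alpha beta (real_part f) u v w X -> exists j, L j X)].

(* Main.v *)
Require Import Defs.
From HB Require Import structures.
From mathcomp Require Import all_boot all_order all_algebra.
From mathcomp Require Import all_classical all_reals all_analysis.
From mathcomp Require Import complex.
From mathcomp Require Import fingroup perm ring lra zify.

(** The size of [K] comes from one comparison of logarithms. The exponents [k] and [l] average
    [d / 3], so the determinant condition reads, up to a factor exponential in [N ^ 2], [(uv) ^ (N d
    / 3) <= K ^ (N (gamma psi - 2))], with [psi] taken at [N / gamma]. One unit of the loss 2 is the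
    boundary term of a lattice sum, the other comes from bounding the second LLL vector with
    exponent [N - 1] instead of [N]. Since [psi l >= sqrt l / 12], [gamma psi] is at least
    [sqrt (gamma N) / 12], hence at least [d / 12]. So the loss costs only [1 + 48 / d], and a
    factor [2 ^ (A sqrt (N / gamma))] in [K] already produces a power exponential in [N ^ 2]. The
    ellipses are smaller by a constant factor [theta] than the regions on which [f] is controlled.
    This raises the entries of [A2] by [theta ^ N] above the true interpolation error, at a cost
    that is only exponential in [N] for each row. Being solved includes the existence of an LLL
    output, so termination of the exchange process has to be proved as well. *)

(* Every [x] of the segment is covered by a disc on which [f] has a Taylor
   expansion with a uniform radius and a uniform weighted l1-bound.  Cut the
   segment into [K] equal pieces and put [w = K ^ gamma], [N1 = N2 = N].  Then
   the coefficient of [T_k1 T_k2] in row [(k, l)] of [A1] is at most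
   [u ^ k v ^ l K ^ - (k1 + gamma k2)] up to factors exponential in [N], because
   [T_k] is orthogonal, at the Chebyshev nodes, to the monomials of degree less
   than [k], and [A2] has entries of order [u ^ k v ^ l K ^ - N].  The Leibniz
   formula bounds the Gram determinant of [M] by the [N] columns of smallest
   weight [k1 + gamma k2]; their average weight is about [gamma psi (N / gamma)].
   LLL turns this bound into short vectors, and the block [A2] converts the
   shortness of a vector into the smallness of the corresponding polynomial on
   the whole rectangle, not just at the nodes.  At a solution [X] the integer
   [P_r (X, Y)] has absolute value less than 1, hence vanishes, so [X] is a root of the
   resultant, which is nonzero by Gauss's lemma in Z[X1][X2]. *)

Set Implicit Arguments.
Unset Strict Implicit.
Unset Printing Implicit Defensive.

Import Order.TTheory GRing.Theory Num.Theory.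
Import numFieldNormedType.Exports.

Local Open Scope classical_set_scope.
Local Open Scope complex_scope.
Local Open Scope ring_scope.

(** * Gram-Schmidt orthogonalization *)

Section GramSchmidt.
Variables (R : realFieldType) (m : nat).
Implicit Types (b bs : nat -> 'rV[R]_m) (mu : nat -> nat -> R).

Definition dotv (x y : 'rV[R]_m) : R := \sum_j x 0 j * y 0 j.

Lemma dotvC x y : dotv x y = dotv y x.
Proof. by apply: eq_bigr => j _; rewrite mulrC. Qed.

Lemma dotvDl x y z : dotv (x + y) z = dotv x z + dotv y z.
Proof. by rewrite -big_split; apply: eq_bigr => j _; rewrite mxE mulrDl. Qed.

Lemma dotvZl a x z : dotv (a *: x) z = a * dotv x z.
Proof. by rewrite mulr_sumr; apply: eq_bigr => j _; rewrite mxE mulrA. Qed.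

Lemma dotv_suml (I : Type) (r : seq I) (P : pred I) (F : I -> 'rV[R]_m) z :
  dotv (\sum_(i <- r | P i) F i) z = \sum_(i <- r | P i) dotv (F i) z.
Proof.
elim/big_rec2: _ => [|i a s _ <-]; last by rewrite dotvDl.
by apply: big1 => j _; rewrite mxE mul0r.
Qed.

Lemma dotvDr x y z : dotv x (y + z) = dotv x y + dotv x z.
Proof. by rewrite dotvC dotvDl !(dotvC x). Qed.

Lemma dotvZr a x z : dotv x (a *: z) = a * dotv x z.
Proof. by rewrite dotvC dotvZl dotvC. Qed.

Lemma dotv_sumr (I : Type) (r : seq I) (P : pred I) (F : I -> 'rV[R]_m) z :
  dotv z (\sum_(i <- r | P i) F i) = \sum_(i <- r | P i) dotv z (F i).
Proof. by rewrite dotvC dotv_suml; apply: eq_bigr => i _; rewrite dotvC. Qed.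

Lemma dotv_ge0 x : 0 <= dotv x x.
Proof. by apply: sumr_ge0 => j _; rewrite -expr2 sqr_ge0. Qed.

Lemma dotv_eq0 x : (dotv x x == 0) = (x == 0).
Proof.
apply/idP/eqP => [|->]; last first.
  by rewrite /dotv big1 // => j _; rewrite mxE mulr0.
rewrite psumr_eq0; last by move=> j _; rewrite -expr2 sqr_ge0.
move=> /allP h; apply/rowP => j; rewrite mxE; apply/eqP.
by have := h j (mem_index_enum _); rewrite /= -expr2 sqrf_eq0.
Qed.

(* [bs] and [mu] form the Gram-Schmidt orthogonalization of the first [n]
   vectors of [b]; the coefficients [mu i l] matter only for [l < i < n]. *)
Definition gram_schmidt_of n b bs mu : Prop :=
  (forall i, (i < n)%N -> b i = bs i + \sum_(l < i) mu i l *: bs l) /\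
  (forall i j, (i < n)%N -> (j < n)%N -> i != j -> dotv (bs i) (bs j) = 0).

(** The vectors may be dependent: where [bs l] is zero, division by zero makes [c l] zero, and
    orthogonality to [bs l] is trivial. *)
Lemma gram_schmidt_exists n b : exists bs mu, gram_schmidt_of n b bs mu.
Proof.
elim: n => [|n [bs [mu [hb ho]]]]; first by exists (fun=> 0), (fun=> fun=> 0).
pose c l := dotv (b n) (bs l) / dotv (bs l) (bs l).
pose bn := b n - \sum_(l < n) c l *: bs l.
have hn j : (j < n)%N -> dotv bn (bs j) = 0.
  move=> jn; rewrite /bn dotvDl -scaleN1r dotvZl dotv_suml.
  rewrite (bigD1 (Ordinal jn)) //= big1 ?addr0 => [|l lj]; last first.
    by rewrite dotvZl ho ?mulr0 //; apply: contra lj => /eqP e; apply/eqP/val_inj.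
  rewrite dotvZl /c; have [e|ne] := eqVneq (dotv (bs j) (bs j)) 0.
    have -> : bs j = 0 by apply/eqP; rewrite -dotv_eq0 e.
    suff -> : dotv (b n) 0 = 0 by rewrite mul0r !mul0r mulr0 addr0.
    by apply: big1 => k _; rewrite mxE mulr0.
  by rewrite divfK // mulN1r subrr.
exists (fun i => if i == n then bn else bs i).
exists (fun i l => if i == n then c l else mu i l); split=> [i|i j].
  rewrite ltnS leq_eqVlt => /predU1P[->|lin]; rewrite ?eqxx.
    rewrite /bn -addrA [X in _ + X](_ : _ = 0) ?addr0 // addrC.
    apply/eqP; rewrite subr_eq0; apply/eqP; apply: eq_bigr => l _.
    by rewrite (ltn_eqF (ltn_ord l)).
  rewrite (ltn_eqF lin) hb //; congr (_ + _); apply: eq_bigr => l _.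
  by rewrite (ltn_eqF (ltn_trans (ltn_ord l) lin)).
rewrite !ltnS (leq_eqVlt i) (leq_eqVlt j) => /predU1P[->|lin] /predU1P[->|ljn] nij.
- by rewrite eqxx in nij.
- by rewrite eqxx (ltn_eqF ljn) hn.
- by rewrite eqxx (ltn_eqF lin) dotvC hn.
- by rewrite (ltn_eqF ljn) (ltn_eqF lin) ho.
Qed.

Definition gram_det n b : R := \det (\matrix_(i < n, j < n) dotv (b i) (b j)).

(** The Gram matrix factors as [T *m D *m T^T] with [T] unitriangular and [D] diagonal. *)
Lemma gram_detE n b bs mu : gram_schmidt_of n b bs mu ->
  gram_det n b = \prod_(i < n) dotv (bs i) (bs i).
Proof.
move=> [hb ho].
pose T := \matrix_(i < n, l < n)
  (if (l < i)%N then mu i l else (i == l :> nat)%:R).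
pose D := diag_mx (\row_(i < n) dotv (bs i) (bs i)).
have hT (i : 'I_n) : b i = \sum_(l < n) T i l *: bs l.
  rewrite hb // (bigD1 i) //= mxE ltnn eqxx scale1r; congr (_ + _).
  rewrite (big_ord_widen n (fun l => mu i l *: bs l)) ?(ltnW (ltn_ord i)) //.
  rewrite [RHS](bigID (fun l : 'I_n => (l < i)%N)) /=.
  rewrite [X in _ = _ + X]big1 ?addr0 => [|l /andP[li nli]]; last first.
    rewrite mxE (negbTE nli) (_ : (i == l :> nat) = false) ?scale0r //.
    by apply/negbTE; apply: contra li => /eqP e; apply/eqP/val_inj.
  apply: eq_big => [l|l li]; last by rewrite mxE li.
  rewrite andb_idl // => li; apply/eqP => e; by rewrite e ltnn in li.
rewrite /gram_det; have -> : \matrix_(i < n, j < n) dotv (b i) (b j) = T *m D *m T^T.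
  apply/matrixP => i j; rewrite !mxE hT dotv_suml; apply: eq_bigr => l _.
  rewrite dotvZl hT dotv_sumr (bigD1 l) //= big1 ?addr0 => [|k kl]; last first.
    by rewrite dotvZr ho ?mulr0 // eq_sym.
  rewrite dotvZr mul_mx_diag !mxE -mulrA; congr (_ * _).
  by rewrite mulrC.
have dT : \det T = 1.
  rewrite det_trig; last first.
    apply/is_trig_mxP => i j ij; rewrite mxE ltnNge (ltnW ij) /=.
    by rewrite (ltn_eqF ij).
  by apply: big1 => i _; rewrite mxE ltnn eqxx.
rewrite !det_mulmx det_tr dT mul1r mulr1 det_diag.
by apply: eq_bigr => i _; rewrite mxE.
Qed.

End GramSchmidt.

(** * Effect of an LLL exchange on Gram determinants *)

Section Swap.
Variables (R : realFieldType) (m : nat).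
Implicit Types (b bs : nat -> 'rV[R]_m) (mu : nat -> nat -> R).

Lemma eq_gram_det n b b' : (forall i, (i < n)%N -> b i = b' i) ->
  gram_det n b = gram_det n b'.
Proof.
by move=> h; congr (\det _); apply/matrixP => i j; rewrite !mxE !h.
Qed.

Definition swap_fam i b : nat -> 'rV[R]_m :=
  fun k => if k == i then b i.+1 else if k == i.+1 then b i else b k.

Lemma gram_det_swap_ge n i b : (i.+1 < n)%N ->
  gram_det n (swap_fam i b) = gram_det n b.
Proof.
move=> lin; pose i0 : 'I_n := Ordinal (ltnW lin); pose i1 : 'I_n := Ordinal lin.
pose G := \matrix_(k < n, l < n) dotv (b k) (b l).
have hs (k : 'I_n) : swap_fam i b k = b (tperm i0 i1 k).
  rewrite /swap_fam; case: tpermP => [->|->|/eqP n0 /eqP n1] /=.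
  - by rewrite eqxx.
  - by rewrite eqxx (gtn_eqF (ltnSn i)).
  - have -> : (k == i :> nat) = false by apply/negbTE.
    by have -> : (k == i.+1 :> nat) = false by apply/negbTE.
rewrite /gram_det -/G.
have -> : \matrix_(k < n, l < n) dotv (swap_fam i b k) (swap_fam i b l) =
    col_perm (tperm i0 i1) (row_perm (tperm i0 i1) G).
  by apply/matrixP => k l; rewrite !mxE !hs.
rewrite col_permE row_permE !det_mulmx !det_perm odd_permV mulrC mulrA.
by rewrite -signr_addb addbb mul1r.
Qed.

(** After the exchange, orthogonalized vector [i] becomes [bs i.+1 + mu i.+1 i *: bs i] and the
    earlier ones are unchanged. Restricting to the first [i.+1] vectors avoids the new coefficients
    at [i.+1], which would involve a division. *)
Lemma gram_det_swap n i b bs mu : (i.+1 < n)%N -> gram_schmidt_of n b bs mu ->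
  gram_det i.+1 (swap_fam i b) * dotv (bs i) (bs i) =
  gram_det i.+1 b *
    (dotv (bs i.+1) (bs i.+1) + mu i.+1 i ^+ 2 * dotv (bs i) (bs i)).
Proof.
move=> lin [hb ho].
have hi : gram_schmidt_of i.+1 b bs mu.
  split=> [k ki|k l ki li]; first by rewrite hb // (leq_trans ki) // ltnW.
  by apply: ho; rewrite (leq_trans _ (ltnW lin)).
pose bs' k := if k == i then bs i.+1 + mu i.+1 i *: bs i else bs k.
pose mu' k := if k == i then mu i.+1 else mu k.
have hs : gram_schmidt_of i.+1 (swap_fam i b) bs' mu'.
  have lt_n k : (k < i.+1)%N -> (k < n)%N by move=> ki; lia.
  split=> [k ki|k l ki li nkl]; rewrite /swap_fam /bs' /mu'; last first.
    case: eqP => ki'; case: eqP => li'; rewrite ?dotvDl ?dotvDr ?dotvZl ?dotvZr.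
    - by move: nkl; rewrite ki' li' eqxx.
    - by rewrite !ho ?mulr0 ?addr0 //; lia.
    - by rewrite !ho ?mulr0 ?addr0 //; lia.
    - by rewrite ho ?lt_n.
  case: eqP => [->|/eqP nki].
    rewrite hb // big_ord_recr /= (addrC (\sum_(_ < _) _)) addrA; congr (_ + _).
    apply: eq_bigr => l _; by rewrite (ltn_eqF (ltn_ord l)).
  rewrite (ltn_eqF ki) hb ?lt_n //; congr (_ + _); apply: eq_bigr => l _.
  by have -> : (l == i :> nat) = false by apply/negbTE; have := ltn_ord l; lia.
rewrite (gram_detE hs) (gram_detE hi) !big_ord_recr /= /bs' eqxx.
have -> : \prod_(k < i) dotv (if (k == i :> nat) then bs i.+1 + mu i.+1 i *: bs i
    else bs k) (if (k == i :> nat) then bs i.+1 + mu i.+1 i *: bs i else bs k) =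
    \prod_(k < i) dotv (bs k) (bs k).
  by apply: eq_bigr => k _; rewrite (ltn_eqF (ltn_ord k)).
rewrite !dotvDl !dotvDr !dotvZl !dotvZr.
rewrite (ho i.+1 i) ?(ho i i.+1) //; try lia.
ring.
Qed.

End Swap.

(** * Size reduction by integer row operations *)

Section SizeReduction.
Variable R : realType.

Lemma floor_half_dist (x : R) : `|x - (Num.floor (x + 1 / 2))%:~R| <= 1 / 2.
Proof.
have := Num.Theory.floor_le (x + 1 / 2); have := floorD1_gt (x + 1 / 2).
rewrite intrD => h1 h2; rewrite ler_norml; lra.
Qed.

(** The columns are treated from right to left: as the diagonal is 1, the choice of [v j] brings
    column [j] into range, and the columns to its right, whose sums start after [j], do not see that
    choice. *)
Lemma size_reduce_row (n : nat) (T : nat -> nat -> R) (r : nat -> R) :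
  (forall l, T l l = 1) ->
  exists v : nat -> int, forall j, (j < n)%N ->
    `|r j + \sum_(l < n | (j <= l)%N) (v l)%:~R * T l j| <= 1 / 2.
Proof.
move=> T1.
suff IH k : (k <= n)%N -> exists v : nat -> int, forall j, (n - k <= j < n)%N ->
    `|r j + \sum_(l < n | (j <= l)%N) (v l)%:~R * T l j| <= 1 / 2.
  by have [v hv] := IH n (leqnn n); exists v => j jn; apply: hv; rewrite subnn.
elim: k => [|k IH] kn; first by exists (fun=> 0) => j; lia.
have [v hv] := IH (ltnW kn).
pose j0 := (n - k.+1)%N.
pose y := r j0 + \sum_(l < n | (j0 < l)%N) (v l)%:~R * T l j0.
exists (fun l => if l == j0 then - Num.floor (y + 1 / 2) else v l).
move=> j /andP[j0j jn]; have [ej|nj] := eqVneq j j0; last first.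
  have := hv j; rewrite jn andbT (_ : (n - k <= j)%N); last by lia.
  move=> /(_ isT); congr (`|_ + _| <= _); apply: eq_bigr => l jl.
  by have -> : (l == j0 :> nat) = false by apply/negbTE; lia.
have lt_n : (j0 < n)%N by lia.
rewrite ej (bigD1 (Ordinal lt_n)) //= eqxx T1 mulr1.
rewrite [X in _ + (_ + X)](_ : _ = y - r j0); last first.
  have -> : y - r j0 = \sum_(l < n | (j0 < l)%N) (v l)%:~R * T l j0.
    by rewrite /y addrAC subrr add0r.
  apply: eq_big => [l|l /andP[_ nl]].
    rewrite ltn_neqAle andbC; congr (_ && _); rewrite eq_sym; congr (~~ _).
  have -> : (l == j0 :> nat) = false; last by [].
  by apply/negbTE; apply: contra nl => /eqP e; apply/eqP/val_inj.
rewrite mulrNz [X in `|X|](_ : _ = y - (Num.floor (y + 1 / 2))%:~R);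
  last by ring.
exact: floor_half_dist.
Qed.

Lemma size_reduce (n : nat) (T : 'M[R]_n) :
  is_trig_mx T -> (forall i, T i i = 1) ->
  exists V : 'M[int]_n,
    [/\ is_trig_mx V, forall i, V i i = 1 &
        forall i j : 'I_n, (j < i)%N -> `|(map_mx intr V *m T) i j| <= 1 / 2].
Proof.
move=> /is_trig_mxP Tt T1.
(* Extension of [T] to all naturals, with 1 on the whole diagonal as [size_reduce_row] requires. *)
pose T' (l j : nat) : R :=
  if l == j then 1 else
  if insub l is Some l' then if insub j is Some j' then T l' j' else 0 else 0.
have T'E (l j : 'I_n) : T' l j = T l j.
  rewrite /T' !valK; case: eqP => // e.
  by rewrite (val_inj e) T1.
have /choice[v hv] : forall i : 'I_n, exists v : nat -> int, forall j, (j < i)%N ->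
    `|T' i j + \sum_(l < i | (j <= l)%N) (v l)%:~R * T' l j| <= 1 / 2.
  by move=> i; apply: (@size_reduce_row i T' (T' i)) => l; rewrite /T' eqxx.
pose V := \matrix_(i < n, l < n) if (l < i)%N then v i l else (i == l)%:R.
exists V; split=> [|i|i j ji].
- apply/is_trig_mxP => i j ij; rewrite mxE ltnNge (ltnW ij) /=.
  by case: eqP => // e; move: ij; rewrite e ltnn.
- by rewrite mxE ltnn eqxx.
have := hv i j ji; congr (`|_| <= _); rewrite mxE (bigD1 i) //= !mxE ltnn eqxx mul1r.
rewrite T'E; congr (_ + _).
rewrite (big_ord_widen_cond n (fun l => (j <= l)%N) (fun l => (v i l)%:~R * T' l j)).
  2: exact/ltnW/ltn_ord.
rewrite [RHS](bigID (fun l : 'I_n => (j <= l)%N && (l < i)%N)) /=.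
rewrite [X in _ = _ + X]big1 ?addr0 => [|l /andP[li]].
  apply: eq_big => [l|l /andP[_ li]]; last by rewrite !mxE li T'E.
  by rewrite [RHS]andb_idl // => /andP[_ li]; apply/eqP => e; move: li; rewrite e ltnn.
rewrite negb_and => /orP[lj|il]; first by rewrite Tt ?mulr0 // ltnNge.
rewrite !mxE (negbTE il) (_ : (i == l) = false) ?mul0r //.
by rewrite eq_sym; apply/negbTE.
Qed.

End SizeReduction.

(** * LLL-reduced bases *)

Section GramSchmidtMatrix.
Variables (R : realFieldType) (n m : nat).
Implicit Types (A Bs : 'M[R]_(n, m)) (T : 'M[R]_n).

Lemma nth_row_ord (S : nmodType) (p q : nat) (A : 'M[S]_(p, q)) (i : 'I_p) :
  nth_row A i = row i A.
Proof. by rewrite /nth_row valK. Qed.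

Definition entry T (i l : nat) : R :=
  if insub i is Some i' then nth_row T^T l 0 i' else 0.

Lemma entryE T (i l : 'I_n) : entry T i l = T i l.
Proof. by rewrite /entry valK nth_row_ord !mxE. Qed.

Definition gs_mx A Bs T : Prop :=
  [/\ A = T *m Bs, is_diag_mx (Bs *m Bs^T), is_trig_mx T & forall i, T i i = 1].

Lemma mulmx_trE A (i j : 'I_n) : (A *m A^T) i j = dotv (row i A) (row j A).
Proof. by rewrite mxE; apply: eq_bigr => k _; rewrite !mxE. Qed.

Lemma gs_mx_row A Bs T : gs_mx A Bs T ->
  gram_schmidt_of n (nth_row A) (nth_row Bs) (entry T).
Proof.
move=> [-> /is_diag_mxP hd /is_trig_mxP ht T1]; split=> [i lin|i j lin ljn nij].
  rewrite (nth_row_ord _ (Ordinal lin)) (nth_row_ord Bs (Ordinal lin)).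
  apply/rowP => k; rewrite !mxE summxE (bigD1 (Ordinal lin)) //= T1 mul1r.
  congr (_ + _); rewrite (big_ord_widen n
    (fun l => (entry T i l *: nth_row Bs l) 0 k)) ?(ltnW lin) //.
  rewrite (bigID (fun l : 'I_n => (l < i)%N)) /= [X in _ + X]big1 ?addr0.
    apply: eq_big => [l|l /andP[_ li]].
      by rewrite andb_idl // => li; apply/eqP => e; move: li; rewrite e ltnn.
    by rewrite nth_row_ord !mxE (entryE T (Ordinal lin) l).
  move=> l /andP[nl li]; rewrite ht ?mul0r // ltn_neqAle leqNgt li andbT.
  by apply: contra nl => /eqP e; apply/eqP/val_inj.
rewrite (nth_row_ord _ (Ordinal lin)) (nth_row_ord Bs (Ordinal ljn)).
by rewrite -mulmx_trE hd.
Qed.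

Lemma gs_mx_exists A : exists Bs T, gs_mx A Bs T.
Proof.
have [bs [mu [hb ho]]] := gram_schmidt_exists n (nth_row A).
pose T := \matrix_(i < n, l < n)
  (if (l < i)%N then mu i l else (i == l :> nat)%:R).
exists (\matrix_(i < n) bs i), T; split.
- apply/row_matrixP => i; rewrite -nth_row_ord hb // row_mul.
  apply/rowP => k; rewrite !mxE (bigD1 i) //= !mxE ltnn eqxx mul1r summxE.
  congr (_ + _); rewrite (big_ord_widen n
    (fun l => (mu i l *: bs l) 0 k)) ?(ltnW (ltn_ord i)) //.
  rewrite [RHS](bigID (fun l : 'I_n => (l < i)%N)) /= [X in _ = _ + X]big1 ?addr0.
    apply: eq_big => [l|l li]; last by rewrite !mxE li.
    by rewrite andb_idl // => li; apply/eqP => e; move: li; rewrite e ltnn.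
  move=> l /andP[nl li]; rewrite !mxE (negbTE li).
  have -> : (i == l :> nat) = false; last by rewrite mul0r.
  by apply/negbTE; apply: contra nl => /eqP e; apply/eqP/val_inj.
- by apply/is_diag_mxP => i j nij; rewrite mulmx_trE !rowK ho.
- apply/is_trig_mxP => i j ij; rewrite mxE ltnNge (ltnW ij) /=.
  by rewrite (ltn_eqF ij).
- by move=> i; rewrite mxE ltnn eqxx.
Qed.

Lemma gs_mx_gt0 A Bs T (i : 'I_n) : gs_mx A Bs T -> row_free A ->
  0 < dotv (row i Bs) (row i Bs).
Proof.
move=> [eA _ _ _] Af; rewrite lt_neqAle dotv_ge0 andbT eq_sym dotv_eq0.
have Bf : row_free Bs.
  rewrite /row_free eqn_leq rank_leq_row /=; move: Af; rewrite /row_free eA.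
  by move=> /eqP e; rewrite -[X in (X <= _)%N]e mxrankM_maxr.
apply/eqP => h; have /eqP : delta_mx 0 i *m Bs = 0 :> 'rV_m by rewrite -rowE.
rewrite -(mul0mx _ Bs) => /eqP /(row_free_inj Bf) /rowP /(_ i).
by rewrite !mxE !eqxx => /eqP; rewrite oner_eq0.
Qed.

End GramSchmidtMatrix.

Lemma gram_schmidt_le (R : realFieldType) m n k (b bs : nat -> 'rV[R]_m) mu :
  (k <= n)%N -> gram_schmidt_of n b bs mu -> gram_schmidt_of k b bs mu.
Proof.
move=> kn [hb ho]; split=> [i ik|i j ik jk]; first by rewrite hb ?(leq_trans ik).
by apply: ho; rewrite (leq_trans _ kn).
Qed.

(** * Termination of LLL *)

Section LLLExists.
Variable R : realType.

Lemma nth_row_map (S S' : nmodType) (f : {additive S -> S'}) (p q : nat)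
    (A : 'M[S]_(p, q)) i : nth_row (map_mx f A) i = map_mx f (nth_row A i).
Proof.
rewrite /nth_row; case: insub => [k|]; first by rewrite map_row.
by apply/rowP => j; rewrite !mxE raddf0.
Qed.

(** Gram determinants over [int], so that the termination measure built from them is an integer. *)
Definition intmx_gram n m (B : 'M[int]_(n, m)) k : int :=
  \det (\matrix_(i < k, j < k) \sum_l nth_row B i 0 l * nth_row B j 0 l).

(* Decreases under every exchange step of LLL, which terminates for this
   reason. *)
Definition potential n m (B : 'M[int]_(n, m)) : int :=
  \prod_(k < n) intmx_gram B k.+1.

Lemma intmx_gramE n m (B : 'M[int]_(n, m)) k :
  (intmx_gram B k)%:~R = gram_det k (nth_row (map_mx intr B : 'M[R]_(n, m))).
Proof.
rewrite /intmx_gram -det_map_mx; congr (\det _); apply/matrixP => i j.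
rewrite !mxE rmorph_sum; apply: eq_bigr => l _.
by rewrite !nth_row_map !mxE rmorphM.
Qed.

(** Induction on the absolute value of the potential. Size reduction by the unitriangular [V] keeps
    [Bs]; if the exchange condition then holds, the basis is reduced. Otherwise rows [i] and [i.+1]
    are exchanged, which lowers one Gram determinant and keeps the others. *)
Lemma LLL_exists n m (B : 'M[int]_(n, m)) :
  row_free (map_mx intr B : 'M[R]_(n, m)) ->
  exists U : 'M[int]_n, U \in unitmx /\ LLL_reduced R (U *m B).
Proof.
have [k] := ubnP `|potential B|%N; elim: k B => // k IH B hk Bf.
pose A : 'M[R]_(n, m) := map_mx intr B.
have [Bs [T gs]] := gs_mx_exists A.
have qpos i : 0 < dotv (row i Bs) (row i Bs) by apply: gs_mx_gt0 gs Bf.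
have [eA hd ht T1] := gs.
have [V [Vt V1 hV]] := size_reduce ht T1.
have /is_trig_mxP Vt' := Vt; have /is_trig_mxP ht' := ht.
have Vu : V \in unitmx.
  by rewrite unitmxE det_trig // big1 // unitr1.
pose T' : 'M[R]_n := map_mx intr V *m T.
have gs' : gs_mx (map_mx intr (V *m B)) Bs T'.
  have T't : is_trig_mx T'.
    apply/is_trig_mxP => i j ij; rewrite mxE big1 // => l _.
    have [li|il] := ltnP i l; first by rewrite mxE Vt' // mul0r.
    by rewrite ht' ?mulr0 // (leq_ltn_trans il).
  split=> //; first by rewrite map_mxM -/A eA mulmxA.
  move=> i; rewrite mxE (bigD1 i) //= mxE V1 T1 mulr1 big1 ?addr0 // => l nl.
  have [li|il] := ltnP i l; first by rewrite mxE Vt' // mul0r.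
  rewrite ht' ?mulr0 // ltn_neqAle il andbT.
  by apply: contra nl => /eqP e; apply/eqP/val_inj.
have [eA' _ T't T'1] := gs'.
have [lov|nlov] := pselect (forall i j : 'I_n, j = i.+1 :> nat ->
    (3 / 4 - T' j i ^+ 2) * sqnorm (row i Bs) <= sqnorm (row j Bs)).
  by exists V; split=> //; exists Bs, T'.
have sqE (i : 'I_n) : sqnorm (row i Bs) = dotv (row i Bs) (row i Bs).
  by apply: eq_bigr => l _; rewrite expr2.
move: nlov => /existsNP[i /existsNP[j /not_implyP[ej /negP]]].
rewrite -ltNge !sqE => hlt.
pose W := tperm_mx i j : 'M[int]_n.
have Wu : W \in unitmx by rewrite unitmx_perm.
pose B2 := W *m (V *m B).
have B2f : row_free (map_mx intr B2 : 'M[R]_(n, m)).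
  rewrite /row_free /B2 !map_mxM mulmxA eqmxMfull //.
  rewrite -map_mxM row_full_unit unitmxE det_map_mx rmorph_unit //.
  by rewrite -unitmxE unitmx_mul Wu Vu.
suff lt_pot : (`|potential B2| < k)%N.
  have [U [Uu hU]] := IH _ lt_pot B2f.
  by exists (U *m W *m V); rewrite !unitmx_mul Uu Wu Vu -!mulmxA.
have gram_eq l : (l <= n)%N ->
    gram_det l (nth_row A) = gram_det l (nth_row (map_mx intr (V *m B) : 'M[R]_(n, m))).
  move=> ln; rewrite (gram_detE (gram_schmidt_le ln (gs_mx_row gs))).
  by rewrite (gram_detE (gram_schmidt_le ln (gs_mx_row gs'))).
have gram_gt0 l : (l <= n)%N -> 0 < gram_det l (nth_row A).
  move=> ln; rewrite (gram_detE (gram_schmidt_le ln (gs_mx_row gs))).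
  apply: prodr_gt0 => i0 _; have lt_n := leq_trans (ltn_ord i0) ln.
  by rewrite (nth_row_ord Bs (Ordinal lt_n)).
pose a' := nth_row (map_mx intr (V *m B) : 'M[R]_(n, m)).
have lin : (i.+1 < n)%N by rewrite -ej.
have a2E l : (l < n)%N -> nth_row (map_mx intr B2 : 'M[R]_(n, m)) l = swap_fam i a' l.
  move=> ln; rewrite /swap_fam -[l]/(val (Ordinal ln)); set l' := Ordinal ln.
  rewrite nth_row_ord /a' -ej !nth_row_ord /B2 /W -xrowE.
  apply/rowP => c; rewrite !mxE.
  case: tpermP => [->|->|/eqP n0 /eqP n1] /=.
  - by rewrite eqxx !mxE.
  - by rewrite ej (gtn_eqF (ltnSn i)) eqxx !mxE.
  - rewrite -(inj_eq val_inj) /= in n0; rewrite -(inj_eq val_inj) /= in n1.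
    by rewrite (negbTE n0) (negbTE n1) !mxE.
(* For [l <= i] the first [l] vectors are untouched; for [l > i.+1] they are only permuted. *)
have gram2E l : (l <= n)%N -> l != i.+1 ->
    gram_det l (nth_row (map_mx intr B2 : 'M[R]_(n, m))) = gram_det l (nth_row A).
  move=> ln nl; rewrite gram_eq // -/a' (@eq_gram_det _ _ l _ (swap_fam i a')).
    have [il|li] := ltnP i.+1 l; first by rewrite gram_det_swap_ge.
    apply: eq_gram_det => k0 k0l; rewrite /swap_fam.
    have k0i : (k0 < i)%N by rewrite (leq_trans k0l) // -ltnS ltn_neqAle nl.
    by rewrite (ltn_eqF k0i) (ltn_eqF (leqW k0i)).
  by move=> k0 k0l; rewrite a2E // (leq_trans k0l).
(* With [q] the squared norms of the rows of [Bs], the failed condition says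
   [q_j + mu ^ 2 * q_i < 3 / 4 * q_i]; the left side is the factor appearing in [gram_det_swap]. *)
have gram2_lt : gram_det i.+1 (nth_row (map_mx intr B2 : 'M[R]_(n, m))) <
    gram_det i.+1 (nth_row A).
  rewrite gram_eq ?(ltnW lin) // -/a' (@eq_gram_det _ _ _ _ (swap_fam i a')).
    2: by move=> k0 k0l; rewrite a2E // (leq_trans k0l) // ltnW.
  rewrite -(ltr_pM2r (qpos i)).
  have := gram_det_swap lin (gs_mx_row gs'); rewrite -ej !nth_row_ord -/a' entryE ej.
  move=> ->; rewrite ltr_pM2l; last by rewrite /a' -gram_eq ?gram_gt0 // ltnW.
  have := qpos i; lra.
have pot_lt : (potential B2)%:~R < (potential B)%:~R :> R.
  rewrite /potential !rmorph_prod /=.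
  under eq_bigr do rewrite intmx_gramE.
  under [X in _ < X]eq_bigr do rewrite intmx_gramE.
  rewrite (bigD1 i) //= [X in _ < X](bigD1 i) //=.
  rewrite (eq_bigr (fun l : 'I_n => gram_det l.+1 (nth_row A))); last first.
    by move=> l nl; rewrite gram2E.
  by rewrite ltr_pM2r // prodr_gt0 // => l _; rewrite gram_gt0.
(* Positivity turns the comparison of integers into one of absolute values, the induction
   measure. *)
have pot_ge0 : 0 < (potential B2)%:~R :> R.
  rewrite rmorph_prod /=; apply: prodr_gt0 => l _; rewrite intmx_gramE.
  have [e|ne] := eqVneq (l : nat) i; last by rewrite gram2E ?gram_gt0.
  rewrite e (@eq_gram_det _ _ _ _ (swap_fam i a')).
    2: by move=> k0 k0l; rewrite a2E // (leq_trans k0l) // ltnW.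
  rewrite -(pmulr_lgt0 _ (qpos i)).
  have := gram_det_swap lin (gs_mx_row gs'); rewrite -ej !nth_row_ord -/a' entryE ej.
  move=> ->; rewrite pmulr_rgt0; last by rewrite /a' -gram_eq ?gram_gt0 // ltnW.
  by rewrite ltr_pwDl ?qpos // mulr_ge0 ?sqr_ge0 // ltW.
move: hk pot_lt pot_ge0; rewrite ltr_int ltr0z.
move: (potential B) (potential B2) => p1 p2; clear=> ? ? ?; lia.
Qed.
End LLLExists.

(** * The first two vectors of a reduced basis *)

Section LLLBound.
Variable R : realType.

Lemma sqnorm_dotv m (x : 'rV[R]_m) : sqnorm x = dotv x x.
Proof. by apply: eq_bigr => l _; rewrite expr2. Qed.

Lemma LLL_bound n m (B : 'M[int]_(n, m)) (r : nat) :
  let A : 'M[R]_(n, m) := map_mx intr B in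
  (1 < n)%N -> row_free A -> LLL_reduced R B -> (r < 2)%N ->
  sqnorm (map_mx intr (nth_row B r) : 'rV[R]_m) ^+ n.-1 <=
    2 ^+ (n.+1 * n.-1) * \det (A *m A^T).
Proof.
move=> A n1 Af [Bs [mu [eA hd [ht T1] hmu lov]]] r2.
have gs : gs_mx A Bs mu by [].
pose q i := dotv (nth_row Bs i) (nth_row Bs i).
have [hb ho] := gs_mx_row gs.
have qgt0 i : (i < n)%N -> 0 < q i.
  by move=> ln; rewrite /q (nth_row_ord Bs (Ordinal ln)) (gs_mx_gt0 _ gs Af).
have detE : \det (A *m A^T) = \prod_(i < n) q i.
  rewrite -(gram_detE (gs_mx_row gs)); congr (\det _); apply/matrixP => i j.
  by rewrite mulmx_trE !mxE !nth_row_ord.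
have qS i : (i.+1 < n)%N -> q i <= 2 * q i.+1.
  move=> lin; have := lov (Ordinal (ltnW lin)) (Ordinal lin) erefl.
  rewrite !sqnorm_dotv -!nth_row_ord -!/(q _) /=.
  set c := mu _ _ => h.
  have c2 : c ^+ 2 <= 1 / 4.
    have /ler_normlP[] : `|c| <= 1 / 2 by apply: hmu.
    move=> ? ?; nra.
  have := qgt0 _ (ltnW lin); move: h; move: (q i) (q i.+1) => a b; nra.
have q1 k : (k.+1 < n)%N -> q 1%N <= 2 ^+ k * q k.+1.
  elim: k => [|k IH] lk; first by rewrite expr0 mul1r.
  apply: le_trans (IH (ltnW lk)) _; rewrite exprSr -mulrA ler_pM2l ?exprn_gt0 //.
  exact: qS.
have b0 : nth_row A 0 = nth_row Bs 0.
  by rewrite hb ?(ltnW n1) // big_ord0 addr0.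
have q0_ge1 : 1 <= q 0%N.
  rewrite /q -b0 nth_row_map /dotv.
  rewrite (eq_bigr (fun j => (nth_row B 0 0 j * nth_row B 0 0 j)%:~R)); last first.
    by move=> j _; rewrite !mxE rmorphM.
  rewrite -rmorph_sum /= -[1]/(1%:~R) ler_int -gtz0_ge1.
  rewrite -(ltr0z R) rmorph_sum /=.
  have := qgt0 0%N (ltnW n1); rewrite /q -b0 nth_row_map /dotv.
  congr (_ < _); apply: eq_bigr => j _; by rewrite !mxE rmorphM.
have q01 := qS 0%N n1.
(* For [r = 1] the squared norm is at most [q 1 + q 0 / 4], and [q 0 <= 2 * q 1]. *)
have br : sqnorm (map_mx intr (nth_row B r) : 'rV[R]_m) <= 2 * q 1%N.
  rewrite sqnorm_dotv -nth_row_map -/A.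
  case: r r2 => [_|[_|//]]; first by rewrite b0.
  rewrite hb // big_ord_recr /= big_ord0 add0r.
  rewrite !dotvDl !dotvDr !dotvZl !dotvZr -!/(q _).
  rewrite (ho 1%N 0%N) // ?(ho 0%N 1%N) //; try exact: ltnW.
  rewrite !mulr0 !addr0 ?add0r -[0%N]/(val (Ordinal (ltnW n1))).
  rewrite -[1%N]/(val (Ordinal n1)) entryE.
  have /ler_normlP[] := hmu (Ordinal n1) (Ordinal (ltnW n1)) (ltnSn 0).
  set c := mu _ _ => h1 h2; have c2 : c * c <= 1 / 4 by nra.
  rewrite /=; have := qgt0 _ n1; move: q01 q0_ge1.
  move: (q 0%N) (q 1%N) => a b *; nra.
have le1 : q 1%N ^+ n.-1 <= 2 ^+ (n * n.-1) * \prod_(i < n) q i.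
  have -> : \prod_(i < n) q i = q 0%N * \prod_(i < n.-1) q i.+1.
    rewrite -(big_mkord xpredT q) -(big_mkord xpredT (fun i => q i.+1)).
    by rewrite -{1}(ltn_predK n1) big_nat_recl.
  have -> : q 1%N ^+ n.-1 = \prod_(i < n.-1) q 1%N by rewrite prodr_const card_ord.
  have lt_n (i : 'I_n.-1) : (i.+1 < n)%N by have := ltn_ord i; lia.
  apply: (@le_trans _ _ (\prod_(i < n.-1) (2 ^+ n * q i.+1))).
    apply: ler_prod => i _; rewrite (ltW (qgt0 _ n1)) /=.
    apply: le_trans (q1 _ (lt_n i)) _; rewrite ler_pM2r ?qgt0 //.
    by rewrite ler_eXn2l ?ltr1n // ltnW // ltnW.
  rewrite big_split /= prodr_const card_ord -exprM ler_pM2l ?exprn_gt0 //.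
  rewrite ler_peMl // prodr_ge0 // => i _; exact/ltW/qgt0.
have p0 : 0 <= \prod_(i < n) q i by apply: prodr_ge0 => i _; exact/ltW/qgt0.
rewrite detE; apply: (@le_trans _ _ ((2 * q 1%N) ^+ n.-1)).
  by apply: lerXn2r => //; rewrite nnegrE ?sqnorm_dotv ?dotv_ge0 // mulr_ge0 // ltW ?qgt0.
by rewrite exprMn mulSn exprD -mulrA ler_pM2l // exprn_gt0.
Qed.
End LLLBound.

(** * Upper bound for Gram determinants *)

Section GramUpper.
Variables (R : realFieldType) (n m : nat).

(** The Cauchy-Binet expansion before grouping by column sets: [J] runs over all functions, not only
    the increasing ones. *)
Lemma det_gram_expand (M : 'M[R]_(n, m)) :
  \det (M *m M^T) = \sum_(J : {ffun 'I_n -> 'I_m})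
    (\prod_i M i (J i)) * \det (\matrix_(i < n, k < n) M k (J i)).
Proof.
rewrite /determinant.
transitivity (\sum_(s : 'S_n) \sum_(J : {ffun 'I_n -> 'I_m})
    (-1) ^+ s * \prod_i (M i (J i) * M (s i) (J i))).
  apply: eq_bigr => s _; rewrite -mulr_sumr; congr (_ * _).
  rewrite -(bigA_distr_bigA (fun i j => M i j * M (s i) j)).
  by apply: eq_bigr => i _; rewrite mxE; apply: eq_bigr => j _; rewrite !mxE.
rewrite exchange_big; apply: eq_bigr => J _; rewrite mulr_sumr.
apply: eq_bigr => s _; rewrite big_split /= mulrCA; congr (_ * (_ * _)).
by apply: eq_bigr => i _; rewrite mxE.
Qed.

(** In the expansion, a non-injective [J] gives a determinant with two equal rows. Every other term
    is a product controlled by [X] times a determinant whose [n] factorial products are controlled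
    by [X] too. *)
Lemma det_gram_le (M : 'M[R]_(n, m)) (r : 'I_n -> R) (c : 'I_m -> R) (X : R) :
  (forall i, 0 <= r i) -> (forall j, 0 <= c j) ->
  (forall i j, `|M i j| <= r i * c j) -> 0 <= X ->
  (forall J : 'I_n -> 'I_m, injective J -> \prod_i c (J i) <= X) ->
  \det (M *m M^T) <= n`!%:R * m%:R ^+ n * (\prod_i r i) ^+ 2 * X ^+ 2.
Proof.
move=> r0 c0 hM X0 hX; rewrite det_gram_expand.
have P0 : 0 <= \prod_i r i by apply: prodr_ge0.
apply: (@le_trans _ _ (\sum_(J : {ffun 'I_n -> 'I_m})
    n`!%:R * (\prod_i r i) ^+ 2 * X ^+ 2)); last first.
  rewrite sumr_const card_ffun !card_ord -[X in X <= _]mulr_natr natrX.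
  by rewrite le_eqVlt; apply/orP; left; apply/eqP; ring.
apply: ler_sum => J _.
have [/injectiveP Ji|/injectivePn[i1 [i2 ni e]]] := boolP (injectiveb J); last first.
  rewrite (determinant_alternate ni) ?mulr0 ?mulr_ge0 ?exprn_ge0 ?ler0n //.
  by move=> k; rewrite !mxE e.
have c0J : 0 <= \prod_i c (J i) by apply: prodr_ge0.
have h1 : `|\prod_i M i (J i)| <= (\prod_i r i) * X.
  rewrite normr_prod; apply: (@le_trans _ _ (\prod_i (r i * c (J i)))).
    by apply: ler_prod => i _; rewrite normr_ge0 hM.
  by rewrite big_split /= ler_wpM2l // hX.
have h2 : `|\det (\matrix_(i < n, k < n) M k (J i))| <= n`!%:R * ((\prod_i r i) * X).
  apply: le_trans (ler_norm_sum _ _ _) _.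
  apply: (@le_trans _ _ (\sum_(s : 'S_n) (\prod_i r i) * X)); last first.
    by rewrite sumr_const card_Sn -[X in X <= _]mulr_natl.
  apply: ler_sum => s _; rewrite normrM normrX normrN1 expr1n mul1r normr_prod.
  apply: (@le_trans _ _ (\prod_i (r (s i) * c (J i)))).
    by apply: ler_prod => i _; rewrite normr_ge0 mxE hM.
  rewrite big_split /=.
  have -> : \prod_i r (s i) = \prod_i r i.
    by rewrite [RHS](reindex_inj (@perm_inj _ s)).
  by rewrite ler_wpM2l // hX.
apply: le_trans (ler_norm _) _; rewrite normrM.
have -> : n`!%:R * (\prod_i r i) ^+ 2 * X ^+ 2 =
  (\prod_i r i) * X * (n`!%:R * ((\prod_i r i) * X)) by ring.
by apply: ler_pM.
Qed.

End GramUpper.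

(** * Chebyshev interpolation *)

Section Cheb.
Variable R : realType.
Implicit Types (t x y : R) (n k : nat).

Lemma cheb0 : cheb R 0 = 1. Proof. by []. Qed.
Lemma cheb1 : cheb R 1 = 'X. Proof. by []. Qed.

Lemma cheb_pairE n : cheb_pair R n = (cheb R n, cheb R n.+1).
Proof. by rewrite /cheb /=; case: (cheb_pair R n). Qed.

Lemma chebSS n : cheb R n.+2 = 2 *: ('X * cheb R n.+1) - cheb R n.
Proof. by rewrite {1}/cheb /= cheb_pairE. Qed.

Lemma cheb_cos n t : (cheb R n).[cos t] = cos (n%:R * t).
Proof.
elim/ltn_ind: n => -[|[|n]] IH; first by rewrite cheb0 hornerE mul0r cos0.
  by rewrite cheb1 hornerX mul1r.
rewrite chebSS !hornerE /= !IH //.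
have -> : n.+2%:R * t = n.+1%:R * t + t by rewrite -[n.+2%:R]natr1; ring.
have -> : n%:R * t = n.+1%:R * t - t by rewrite -[n.+1%:R]natr1; ring.
by rewrite cosB cosD; ring.
Qed.

Lemma cheb_size n : (size (cheb R n) <= n.+1)%N.
Proof.
elim/ltn_ind: n => -[|[|n]] IH; first by rewrite cheb0 size_poly1.
  by rewrite cheb1 size_polyX.
rewrite chebSS (leq_trans (size_polyD _ _)) // geq_max size_polyN.
apply/andP; split; last by rewrite (leq_trans (IH n _)) // ltnW.
rewrite (leq_trans (size_scale_leq _ _)) // mulrC.
by rewrite (leq_trans (size_polyMleq _ _)) // size_polyX addn2 /= ltnS IH.
Qed.

Lemma cheb_neq0 n : cheb R n != 0.
Proof.
apply/eqP => /(congr1 (fun p => p.[cos 0])); rewrite cheb_cos mulr0 cos0 horner0.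
by move/eqP; rewrite oner_eq0.
Qed.

Lemma cheb_le1 n y : -1 <= y <= 1 -> `|(cheb R n).[y]| <= 1.
Proof. by move=> hy; rewrite -(acosK hy) cheb_cos; exact: cos_max. Qed.

(* [y * T_(k+1) = (T_(k+2) + T_k) / 2], so the coordinates of a monomial in the
   Chebyshev basis are nonnegative and add up to 1. *)
Lemma monomial_cheb n : exists c : nat -> R, forall y,
  y ^+ n = \sum_(k < n.+1) c k * (cheb R k).[y].
Proof.
elim: n => [|n [c hc]].
  by exists (fun=> 1) => y; rewrite big_ord1 cheb0 hornerC mulr1 expr0.
pose e k : nat -> R := if k is k'.+1
  then fun j => ((j == k'.+2)%:R + (j == k')%:R) / 2 else fun j => (j == 1%N)%:R.
have he k y : (k < n.+1)%N ->
    y * (cheb R k).[y] = \sum_(j < n.+2) e k j * (cheb R j).[y].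
  have pick i : (i < n.+2)%N ->
      \sum_(j < n.+2) (j == i :> nat)%:R * (cheb R j).[y] = (cheb R i).[y].
    move=> lin; rewrite (bigD1 (Ordinal lin)) //= eqxx mul1r big1 ?addr0 // => j nj.
    have -> : (j == i :> nat) = false; last by rewrite mul0r.
    by apply/negbTE; apply: contra nj => /eqP ej; apply/eqP/val_inj.
  case: k => [|k] kn; first by rewrite pick // cheb0 cheb1 !hornerE.
  rewrite /e; under eq_bigr do rewrite mulrAC mulrDl.
  rewrite -mulr_suml big_split /= !pick ?ltnS // 1?ltnW // 1?ltnW //.
  by rewrite chebSS !hornerE /=; field.
exists (fun j => \sum_(k < n.+1) c k * e k j) => y.
under [RHS]eq_bigr do rewrite mulr_suml.
rewrite exchange_big /= exprS hc mulr_sumr; apply: eq_bigr => k _.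
rewrite mulrCA he // mulr_sumr; apply: eq_bigr => j _.
by rewrite mulrA.
Qed.

Definition cheb_angle n (i : nat) : R := (2 * i%:R + 1) * pi / (2 * n%:R).
Definition cheb_node n (i : nat) : R := cos (cheb_angle n i).

(** With [d = m * pi / (2 * n)] the angles are odd multiples of [d], so multiplying by [sin d],
    nonzero as [0 < d < pi], makes the sum telescope to a multiple of [sin (m * pi)]. *)
Lemma sum_cos_angle n m : (0 < m < 2 * n)%N ->
  \sum_(i < n) cos (m%:R * cheb_angle n i) = 0.
Proof.
move=> /andP[m0 mn]; have n0 : (0 < n)%N by lia.
have nR : 0 < n%:R :> R by rewrite ltr0n.
pose d : R := m%:R * pi / (2 * n%:R).
have d0 : 0 < d by rewrite divr_gt0 ?mulr_gt0 ?ltr0n ?pi_gt0.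
have dpi : d < pi.
  rewrite /d ltr_pdivrMr ?mulr_gt0 // mulrC ltr_pM2l ?pi_gt0 //.
  by rewrite -natrM ltr_nat.
have sd : sin d != 0 by rewrite lt0r_neq0 // sin_gt0_pi // d0.
apply: (mulIf sd); rewrite mul0r mulr_suml.
have -> : \sum_(i < n) cos (m%:R * cheb_angle n i) * sin d =
    \sum_(i < n) (sin (2 * i.+1%:R * d) / 2 - sin (2 * i%:R * d) / 2).
  apply: eq_bigr => i _; rewrite /cheb_angle.
  have -> : m%:R * ((2 * i%:R + 1) * pi / (2 * n%:R)) = 2 * i%:R * d + d.
    by rewrite /d; field; rewrite lt0r_neq0.
  have -> : 2 * i.+1%:R * d = 2 * i%:R * d + d + d by rewrite -natr1; ring.
  have {3}-> : 2 * i%:R * d = 2 * i%:R * d + d - d by ring.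
  by rewrite (sinB _ d) (sinD _ d); field.
rewrite -(big_mkord xpredT (fun i => sin (2 * i.+1%:R * d) / 2 - sin (2 * i%:R * d) / 2)).
rewrite (telescope_sumr (fun i => sin (2 * i%:R * d) / 2)) // mulr0 mul0r sin0 mul0r subr0.
have -> : 2 * n%:R * d = pi *+ m.
  by rewrite /d -[RHS]mulr_natl; field; rewrite lt0r_neq0.
suff -> : sin (pi *+ m) = 0 :> R by rewrite mul0r.
clear; elim: m => [|m IH]; first by rewrite mulr0n sin0.
by rewrite mulrS sinD sinpi cospi IH mul0r mulr0 addr0.
Qed.

(** Product-to-sum reduces this to cosine sums at [a + b] and at the difference, both below
    [2 * n]. *)
Lemma cheb_orth n a b : (a < n)%N -> (b < n)%N ->
  \sum_(i < n) (cheb R a).[cheb_node n i] * (cheb R b).[cheb_node n i] =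
  if a == b then if a == 0%N then n%:R else n%:R / 2 else 0.
Proof.
move=> an bn.
have hs m : (m < 2 * n)%N -> \sum_(i < n) cos (m%:R * cheb_angle n i) =
    if m == 0%N then n%:R else 0.
  move=> mn; case: eqP => [->|/eqP m0]; last by rewrite sum_cos_angle // lt0n m0.
  under eq_bigr do rewrite mul0r cos0.
  by rewrite sumr_const card_ord.
have key c d : (d <= c)%N -> (c < n)%N -> (d < n)%N ->
    \sum_(i < n) (cheb R c).[cheb_node n i] * (cheb R d).[cheb_node n i] =
    ((if (c + d == 0)%N then n%:R else 0) + (if (c - d == 0)%N then n%:R else 0)) / 2.
  move=> dc cn dn.
  have s1 : (c + d < 2 * n)%N by lia.
  have s2 : (c - d < 2 * n)%N by lia.
  rewrite -(hs _ s1) -(hs _ s2).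
  rewrite -big_split /= mulr_suml; apply: eq_bigr => i _.
  by rewrite !cheb_cos natrD natrB // [(_ + _) * cheb_angle _ _]mulrDl mulrBl cosB cosD; field.
have [ab|ba|eab] := ltngtP a b.
- under eq_bigr do rewrite mulrC.
  rewrite key ?(ltnW ab) //.
  have -> : (b + a == 0)%N = false by apply/negbTE; lia.
  have -> : (b - a == 0)%N = false by apply/negbTE; lia.
  by rewrite addr0 mul0r.
- rewrite key ?(ltnW ba) //.
  have -> : (a + b == 0)%N = false by apply/negbTE; lia.
  have -> : (a - b == 0)%N = false by apply/negbTE; lia.
  by rewrite addr0 mul0r.
- subst b; rewrite key // subnn eqxx addn_eq0 andbb; by case: ifP => _; field.
Qed.

Lemma cheb_node_inj n (i j : 'I_n) : cheb_node n i = cheb_node n j -> i = j.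
Proof.
have n0 : (0 < n)%N by case: i => i; exact: leq_ltn_trans.
have nR : 0 < n%:R :> R by rewrite ltr0n.
have ang (k : 'I_n) : 0 <= cheb_angle n k <= pi.
  have kn : k%:R + 1 <= n%:R :> R by rewrite natr1 ler_nat.
  have k0 : 0 <= k%:R :> R by rewrite ler0n.
  rewrite /cheb_angle; apply/andP; split.
    rewrite divr_ge0 // ?mulr_ge0 ?pi_ge0 ?ltW //; lra.
  rewrite ler_pdivrMr ?mulr_gt0 // mulrC ler_pM2l ?pi_gt0 //; lra.
move=> /(cos_inj) h; have := h (ang i) (ang j); rewrite /cheb_angle => {}h.
apply/val_inj/eqP; rewrite -(eqr_nat R); apply/eqP.
have p0 := pi_gt0 R; have : 2 * n%:R != 0 :> R by rewrite mulf_neq0 ?lt0r_neq0.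
move=> nz; have := congr1 (fun z => z * (2 * n%:R) / pi) h.
rewrite /= !divfK // !mulfK ?lt0r_neq0 //; lra.
Qed.

Lemma root_cheb_node n (i : 'I_n) : root (cheb R n) (cheb_node n i).
Proof.
have n0 : (0 < n)%N by case: i => i; exact: leq_ltn_trans.
have nR : 0 < n%:R :> R by rewrite ltr0n.
apply/eqP; rewrite cheb_cos /cheb_angle.
have -> : n%:R * ((2 * i%:R + 1) * pi / (2 * n%:R)) = pi *+ i + pi / 2 :> R.
  by rewrite -[pi *+ i]mulr_natl; field; rewrite lt0r_neq0.
rewrite cosD cos_pihalf mulr0 sub0r.
suff -> : sin (pi *+ i) = 0 :> R by rewrite mul0r oppr0.
elim: (nat_of_ord i) => [|m IH]; first by rewrite mulr0n sin0.
by rewrite mulrS sinD sinpi cospi IH mul0r mulr0 addr0.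
Qed.

Lemma root_cheb n x : root (cheb R n) x -> exists i : 'I_n, x = cheb_node n i.
Proof.
move=> rx; apply: contrapT => h.
pose rs := x :: [seq cheb_node n i | i : 'I_n].
have us : uniq rs.
  rewrite /= map_inj_uniq ?enum_uniq; last by move=> i j; apply: cheb_node_inj.
  by rewrite andbT; apply/negP => /mapP[i _ e]; apply: h; exists i.
have rr : all (root (cheb R n)) rs.
  by rewrite /= rx /=; apply/allP => _ /mapP[i _ ->]; exact: root_cheb_node.
have := max_poly_roots (cheb_neq0 n) rr us.
by rewrite /= size_map size_enum_ord => /leq_trans /(_ (cheb_size n)); rewrite ltnn.
Qed.

End Cheb.

(** * Discrete Chebyshev coefficients in one and two variables *)

Section ChebCoef.
Variable R : realType.
Implicit Types (x y : R) (n k : nat).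

(** Normalization of discrete orthogonality: over the nodes, the squares of [T_0] add up to [n],
    those of the other polynomials to [n / 2]. *)
Definition cheb_wt n k : R := (if k == 0%N then 1 else 2) / n%:R.

(** For [k < n], the coordinate on [T_k] of the polynomial of degree less than [n] interpolating [g]
    at the nodes, obtained by discrete projection. *)
Definition cheb_coef n (g : R -> R) k : R :=
  cheb_wt n k * \sum_(i < n) g (cheb_node R n i) * (cheb R k).[cheb_node R n i].

Lemma cheb_wt_le n k : (0 < n)%N -> 0 <= cheb_wt n k <= 2 / n%:R.
Proof.
move=> n0; have nR : 0 < n%:R :> R by rewrite ltr0n.
rewrite /cheb_wt ler_pM2r ?invr_gt0 // pmulr_lge0 ?invr_gt0 //.
by case: ifP => _; apply/andP; split; lra.
Qed.

Lemma cheb_wt_orth n a b : (a < n)%N -> (b < n)%N ->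
  cheb_wt n b *
    \sum_(i < n) (cheb R a).[cheb_node R n i] * (cheb R b).[cheb_node R n i] =
  (a == b)%:R.
Proof.
move=> an bn; rewrite cheb_orth //; case: eqP => [->|_]; last by rewrite mulr0.
have nR : n%:R != 0 :> R by rewrite pnatr_eq0; lia.
by rewrite /cheb_wt; case: b {bn} => [|b] /=; field.
Qed.

(** Orthogonality says [A *m B = 1] for square matrices; this is [B *m A = 1]. *)
Lemma cheb_dual_orth n (i j : 'I_n) :
  \sum_(k < n) cheb_wt n k *
    (cheb R k).[cheb_node R n i] * (cheb R k).[cheb_node R n j] = (i == j)%:R.
Proof.
pose A : 'M[R]_n := \matrix_(k < n, l < n) (cheb_wt n k * (cheb R k).[cheb_node R n l]).
pose B : 'M[R]_n := \matrix_(l < n, k < n) (cheb R k).[cheb_node R n l].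
have AB : A *m B = 1%:M.
  apply/matrixP => k l; rewrite !mxE eq_sym -[RHS](@cheb_wt_orth n l k) // mulr_sumr.
  by apply: eq_bigr => p _; rewrite !mxE -mulrA; congr (_ * _); rewrite mulrC.
have /matrixP /(_ i j) := mulmx1C AB; rewrite !mxE => <-.
by apply: eq_bigr => k _; rewrite !mxE; ring.
Qed.

Lemma cheb_coef_sum n (c : nat -> R) m k : (m <= n)%N -> (k < n)%N ->
  cheb_coef n (fun y => \sum_(a < m) c a * (cheb R a).[y]) k =
  if (k < m)%N then c k else 0.
Proof.
move=> mn kn; rewrite /cheb_coef.
under eq_bigr do rewrite mulr_suml.
rewrite exchange_big /= mulr_sumr.
rewrite (eq_bigr (fun a : 'I_m => c a * (a == k :> nat)%:R)); last first.
  move=> a _; rewrite -(@cheb_wt_orth n a k) // ?(leq_trans (ltn_ord a)) //.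
  rewrite mulrCA; congr (_ * _); rewrite mulr_sumr; apply: eq_bigr => i _.
  by rewrite mulrA.
have [km|mk] := ltnP k m.
  rewrite (bigD1 (Ordinal km)) //= eqxx mulr1 big1 ?addr0 // => a na.
  have -> : (a == k :> nat) = false; last by rewrite mulr0.
  by apply/negbTE; apply: contra na => /eqP e; apply/eqP/val_inj.
by rewrite big1 // => a _; rewrite (ltn_eqF (leq_trans (ltn_ord a) mk)) mulr0.
Qed.

Lemma eq_cheb_coef n (g h : R -> R) k : g =1 h -> cheb_coef n g k = cheb_coef n h k.
Proof. by move=> e; rewrite /cheb_coef; under eq_bigr do rewrite e. Qed.

Lemma cheb_coef_monomial0 n a k : (a < k < n)%N ->
  cheb_coef n (fun y => y ^+ a) k = 0.
Proof.
move=> /andP[ak kn]; have [c hc] := monomial_cheb R a.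
rewrite (eq_cheb_coef _ _ hc) cheb_coef_sum //; last exact: ltn_trans kn.
by rewrite ltnNge ak.
Qed.

Lemma cheb_coef_monomial n a y : (a < n)%N ->
  \sum_(k < n) cheb_coef n (fun y => y ^+ a) k * (cheb R k).[y] = y ^+ a.
Proof.
move=> an; have [c hc] := monomial_cheb R a.
rewrite hc (big_ord_widen n (fun k => c k * (cheb R k).[y]) an) [RHS]big_mkcond /=.
apply: eq_bigr => k _; rewrite (eq_cheb_coef _ _ hc) cheb_coef_sum //.
by case: ifP => _; rewrite ?mul0r.
Qed.

Lemma cheb_node_itv n i : -1 <= cheb_node R n i <= 1.
Proof. by rewrite /cheb_node cos_geN1 cos_le1. Qed.

Lemma cheb_coef_le n (g : R -> R) k e : (k < n)%N ->
  (forall y, -1 <= y <= 1 -> `|g y| <= e) -> `|cheb_coef n g k| <= 2 * e.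
Proof.
move=> kn hg; have n0 : (0 < n)%N by lia.
have nR : 0 < n%:R :> R by rewrite ltr0n.
have /andP[w0 w2] := cheb_wt_le k n0.
have e0 : 0 <= e by apply: le_trans (hg 0 _); rewrite ?normr_ge0 //; lra.
rewrite /cheb_coef normrM (ger0_norm w0).
apply: (@le_trans _ _ (2 / n%:R * (n%:R * e))); last first.
  by rewrite mulrA divfK // lt0r_neq0.
apply: ler_pM => //; apply: le_trans (ler_norm_sum _ _ _) _.
apply: (@le_trans _ _ (\sum_(i < n) e)).
  apply: ler_sum => i _; rewrite normrM -[e]mulr1.
  by rewrite ler_pM ?hg ?cheb_le1 ?cheb_node_itv.
by rewrite sumr_const card_ord -[leLHS]mulr_natl.
Qed.

Definition cheb_coef2 n1 n2 (h : R -> R -> R) k1 k2 : R :=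
  cheb_coef n1 (fun y => cheb_coef n2 (h y) k2) k1.

Lemma cheb_coef2_le n1 n2 (h : R -> R -> R) k1 k2 e : (k1 < n1)%N -> (k2 < n2)%N ->
  (forall y t, -1 <= y <= 1 -> -1 <= t <= 1 -> `|h y t| <= e) ->
  `|cheb_coef2 n1 n2 h k1 k2| <= 4 * e.
Proof.
move=> kn1 kn2 he; rewrite (_ : 4 * e = 2 * (2 * e)); last by ring.
rewrite /cheb_coef2; apply: cheb_coef_le => // y hy; apply: cheb_coef_le => // t ht; exact: he.
Qed.

Lemma cheb_coef2E n1 n2 (h : R -> R -> R) k1 k2 :
  cheb_coef2 n1 n2 h k1 k2 = \sum_(i < n1) \sum_(j < n2)
    cheb_wt n1 k1 * cheb_wt n2 k2 * h (cheb_node R n1 i) (cheb_node R n2 j) *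
    (cheb R k1).[cheb_node R n1 i] * (cheb R k2).[cheb_node R n2 j].
Proof.
rewrite /cheb_coef2 /cheb_coef mulr_sumr; apply: eq_bigr => i _.
by rewrite mulr_sumr mulr_suml mulr_sumr; apply: eq_bigr => j _; ring.
Qed.

Lemma cheb_coef2C n1 n2 (h : R -> R -> R) k1 k2 :
  cheb_coef2 n1 n2 h k1 k2 = cheb_coef n2 (fun t => cheb_coef n1 (h^~ t) k1) k2.
Proof.
rewrite -/(cheb_coef2 n2 n1 (fun t y => h y t) k2 k1) !cheb_coef2E exchange_big /=.
by apply: eq_bigr => j _; apply: eq_bigr => i _; ring.
Qed.

Lemma cheb_coef2_sum (T : Type) (s : seq T) n1 n2 (w : T -> R)
    (h : T -> R -> R -> R) k1 k2 :
  cheb_coef2 n1 n2 (fun y t => \sum_(p <- s) w p * h p y t) k1 k2 =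
  \sum_(p <- s) w p * cheb_coef2 n1 n2 (h p) k1 k2.
Proof.
under [RHS]eq_bigr do rewrite cheb_coef2E mulr_sumr.
rewrite cheb_coef2E [RHS]exchange_big /=; apply: eq_bigr => i _.
under [RHS]eq_bigr do rewrite mulr_sumr.
rewrite [RHS]exchange_big /=; apply: eq_bigr => j _.
rewrite mulr_sumr !mulr_suml; apply: eq_bigr => p _; ring.
Qed.

Lemma cheb_coef2B n1 n2 (g h : R -> R -> R) k1 k2 :
  cheb_coef2 n1 n2 (fun y t => g y t - h y t) k1 k2 =
  cheb_coef2 n1 n2 g k1 k2 - cheb_coef2 n1 n2 h k1 k2.
Proof.
rewrite !cheb_coef2E -sumrB; apply: eq_bigr => i _.
by rewrite -sumrB; apply: eq_bigr => j _; ring.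
Qed.

Lemma cheb_coef2_prod n1 n2 (g h : R -> R) k1 k2 :
  cheb_coef2 n1 n2 (fun y t => g y * h t) k1 k2 =
  cheb_coef n1 g k1 * cheb_coef n2 h k2.
Proof.
rewrite cheb_coef2E /cheb_coef [RHS]mulrACA mulr_suml mulr_sumr; apply: eq_bigr => i _.
by rewrite !mulr_sumr; apply: eq_bigr => j _; ring.
Qed.

Lemma cheb_coef2_interp n1 n2 (h : R -> R -> R) (i : 'I_n1) (j : 'I_n2) :
  \sum_(k1 < n1) \sum_(k2 < n2) cheb_coef2 n1 n2 h k1 k2 *
    (cheb R k1).[cheb_node R n1 i] * (cheb R k2).[cheb_node R n2 j] =
  h (cheb_node R n1 i) (cheb_node R n2 j).
Proof.
have one n (g : R -> R) (l : 'I_n) :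
    \sum_(k < n) cheb_coef n g k * (cheb R k).[cheb_node R n l] = g (cheb_node R n l).
  rewrite /cheb_coef.
  under eq_bigr do rewrite mulr_sumr mulr_suml.
  rewrite exchange_big /= (bigD1 l) //= [X in _ + X]big1 ?addr0 => [|p pl].
    rewrite -[RHS]mulr1 -[X in _ = _ * X](_ : (l == l)%:R = 1); last by rewrite eqxx.
    rewrite -cheb_dual_orth mulr_sumr; apply: eq_bigr => k _; ring.
  transitivity (g (cheb_node R n p) * (p == l)%:R); last by rewrite (negbTE pl) mulr0.
  rewrite -cheb_dual_orth mulr_sumr; apply: eq_bigr => k _; ring.
rewrite -[RHS](one n1 (fun y => h y (cheb_node R n2 j))); apply: eq_bigr => k1 _.
transitivity (\sum_(k2 < n2) cheb_coef n2 (fun t => cheb_coef n1 (h^~ t) k1) k2 *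
    (cheb R k2).[cheb_node R n2 j] * (cheb R k1).[cheb_node R n1 i]).
  by apply: eq_bigr => k2 _; rewrite mulrAC cheb_coef2C.
by rewrite -mulr_suml (one n2 (fun t => cheb_coef n1 (h^~ t) k1)).
Qed.

End ChebCoef.

Section Interp.
Variable R : realType.
Implicit Types (x y : R) (n k : nat).

Lemma eq_cheb_coef2 n1 n2 (g h : R -> R -> R) k1 k2 :
  (forall (i : 'I_n1) (j : 'I_n2),
     g (cheb_node R n1 i) (cheb_node R n2 j) = h (cheb_node R n1 i) (cheb_node R n2 j)) ->
  cheb_coef2 n1 n2 g k1 k2 = cheb_coef2 n1 n2 h k1 k2.
Proof.
by move=> e; rewrite !cheb_coef2E; apply: eq_bigr => i _; apply: eq_bigr => j _; rewrite e.
Qed.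

Definition aff (a b y : R) : R := (b - a) / 2 * y + (a + b) / 2.

Lemma cheb_onE n a b y : a < b -> (cheb_on n a b).[aff a b y] = (cheb R n).[y].
Proof.
move=> ab; rewrite /cheb_on horner_comp !hornerE /aff /=; congr (_.[_]).
by field; rewrite subr_eq0 gt_eqF.
Qed.

Lemma aff_surj a b x : a < b -> exists y, x = aff a b y.
Proof.
move=> ab; exists ((2 * x - (a + b)) / (b - a)); rewrite /aff.
by field; rewrite subr_eq0 gt_eqF.
Qed.

Lemma aff_itv a b x : a < b -> a <= x <= b ->
  exists2 y, -1 <= y <= 1 & x = aff a b y.
Proof.
move=> ab hx; have [y ey] := aff_surj x ab; exists y => //.
move: hx; rewrite ey /aff => /andP[h1 h2]; apply/andP; split; nra.
Qed.

(** The definition picks some interpolating matrix. The discrete coefficients show that one exists,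
    so the chosen matrix does interpolate; orthogonality then recovers its entries from the values
    at the nodes. *)
Lemma interp_coefsE (I : input R) (g : R -> R -> R) :
  in_a1 I < in_b1 I -> in_a2 I < in_b2 I ->
  interp_coefs I g = \matrix_(k1, k2) cheb_coef2 (in_N1 I) (in_N2 I)
     (fun y t => g (aff (in_a1 I) (in_b1 I) y) (aff (in_a2 I) (in_b2 I) t)) k1 k2.
Proof.
set N1 := in_N1 I; set N2 := in_N2 I => ab1 ab2; set c0 := (X in _ = X).
have ex : interpolates (I := I) g c0.
  move=> x t rx rt.
  have [y ey] := aff_surj x ab1; have [s es] := aff_surj t ab2.
  move: rx rt; rewrite ey es !rootE !cheb_onE // => rx rt.
  have [i ei] := root_cheb rx; have [j ej] := root_cheb rt.
  rewrite ei ej -(cheb_coef2_interp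
    (fun y t => g (aff (in_a1 I) (in_b1 I) y) (aff (in_a2 I) (in_b2 I) t)) i j).
  by apply: eq_bigr => k1 _; apply: eq_bigr => k2 _; rewrite !cheb_onE // mxE.
have : interpolates (I := I) g (interp_coefs I g).
  by apply: (@xgetPex _ 0 [set c | interpolates (I := I) g c]); exists c0.
move: (interp_coefs I g) => c hc.
apply/matrixP => k1 k2; rewrite mxE.
rewrite (@eq_cheb_coef2 _ _ _ (fun y t => \sum_(p <- index_enum ('I_N1 * 'I_N2)%type)
    c p.1 p.2 * ((cheb R p.1).[y] * (cheb R p.2).[t]))); last first.
  move=> i j; rewrite -hc ?rootE ?cheb_onE //; try exact: root_cheb_node.
  rewrite pair_bigA; apply: eq_bigr => -[p q] _ /=.
  by rewrite !cheb_onE // mulrA.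
rewrite [RHS](@cheb_coef2_sum R _ _ _ _ (fun p : 'I_N1 * 'I_N2 => c p.1 p.2)
  (fun p y t => (cheb R p.1).[y] * (cheb R p.2).[t])).
rewrite (bigD1 (k1, k2)) //= cheb_coef2_prod /cheb_coef.
rewrite !cheb_wt_orth // !eqxx !mulr1 big1 ?addr0 // => -[p q] /= npq.
rewrite cheb_coef2_prod /cheb_coef !cheb_wt_orth //.
move: npq; rewrite xpair_eqE negb_and -!(inj_eq val_inj) /=.
by case/orP => /negbTE ->; rewrite ?mulr0 ?mul0r ?mulr0.
Qed.

End Interp.

(** * Interpolation error for power series *)

Section Apx.
Variables (R : realType) (s1 s2 : R).
Hypotheses (s1_ge1 : 1 <= s1) (s2_ge1 : 1 <= s2).
Implicit Types (h g : R -> R -> R) (s : seq (R * (nat * nat))).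

Definition bipoly s (y t : R) : R := \sum_(p <- s) p.1 * (y ^+ p.2.1 * t ^+ p.2.2).
Definition binorm s : R := \sum_(p <- s) `|p.1| * (s1 ^+ p.2.1 * s2 ^+ p.2.2).

(* A substitute for "analytic on the bidisc of radii [s1], [s2] with Taylor
   coefficients of weighted l1-norm at most [B]", closed under products. *)
Definition apx (B : R) h : Prop :=
  forall e, 0 < e -> exists s, binorm s <= B /\
    forall y t, -1 <= y <= 1 -> -1 <= t <= 1 -> `|h y t - bipoly s y t| <= e.

Let pow_ge1 a b : 1 <= s1 ^+ a * s2 ^+ b.
Proof. by rewrite mulr_ege1 ?exprn_ege1. Qed.

Lemma monomial_le1 (y t : R) a b : -1 <= y <= 1 -> -1 <= t <= 1 ->
  `|y ^+ a * t ^+ b| <= 1.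
Proof.
move=> hy ht; rewrite normrM !normrX mulr_ile1 ?exprn_ge0 //;
  by rewrite exprn_ile1 // ler_norml.
Qed.

Lemma binorm_ge0 s : 0 <= binorm s.
Proof.
by apply: sumr_ge0 => p _; rewrite mulr_ge0 // (le_trans ler01).
Qed.

Lemma bipoly_le s y t : -1 <= y <= 1 -> -1 <= t <= 1 -> `|bipoly s y t| <= binorm s.
Proof.
move=> hy ht; apply: le_trans (ler_norm_sum _ _ _) _; apply: ler_sum => p _.
rewrite normrM ler_wpM2l // (le_trans (monomial_le1 _ _ hy ht)) //.
Qed.

Lemma apx_ge0 B h : apx B h -> 0 <= B.
Proof. by move=> /(_ 1 ltr01)[s [hs _]]; exact: le_trans (binorm_ge0 s) hs. Qed.

Lemma apx_le B B' h : B <= B' -> apx B h -> apx B' h.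
Proof.
by move=> BB H e /H[s [hs he]]; exists s; split=> //; exact: le_trans BB.
Qed.

Lemma apx_sup B h y t : apx B h -> -1 <= y <= 1 -> -1 <= t <= 1 -> `|h y t| <= B.
Proof.
move=> H hy ht; apply/ler_addgt0Pr => e /H[s [hs he]].
rewrite -[h y t](subrK (bipoly s y t)) (le_trans (ler_normD _ _)) // addrC lerD //.
  exact: le_trans (bipoly_le _ hy ht) hs.
exact: he.
Qed.

Lemma eq_apx B g h : (forall y t, -1 <= y <= 1 -> -1 <= t <= 1 -> g y t = h y t) ->
  apx B g -> apx B h.
Proof.
move=> gh H e /H[s [hs he]]; exists s; split=> // y t hy ht.
by rewrite -gh // he.
Qed.

Lemma apx_term c a b : apx (`|c| * (s1 ^+ a * s2 ^+ b)) (fun y t => c * (y ^+ a * t ^+ b)).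
Proof.
move=> e e0; exists [:: (c, (a, b))]; rewrite /binorm /bipoly big_seq1; split=> //=.
by move=> y t _ _; rewrite big_seq1 subrr normr0 ltW.
Qed.

Lemma apx_cst c : apx `|c| (fun _ _ => c).
Proof.
have := apx_term c 0%N 0%N; rewrite !expr0 !mulr1; exact: eq_apx.
Qed.

Lemma apx_add B B' g h : apx B g -> apx B' h -> apx (B + B') (fun y t => g y t + h y t).
Proof.
move=> Hg Hh e e0; have e20 : 0 < e / 2 by rewrite divr_gt0.
have [s [ns hs]] := Hg _ e20; have [s' [ns' hs']] := Hh _ e20.
exists (s ++ s'); split; first by rewrite /binorm big_cat lerD.
move=> y t hy ht; rewrite /bipoly big_cat /= -!/(bipoly _ _ _) opprD addrACA.
rewrite (le_trans (ler_normD _ _)) // [e]splitr lerD ?hs ?hs' //.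
Qed.

Lemma apx_mul B B' g h : apx B g -> apx B' h -> apx (B * B') (fun y t => g y t * h y t).
Proof.
move=> Hg Hh e e0; have B0 := apx_ge0 Hg; have B0' := apx_ge0 Hh.
(* An error [e'] in each factor gives [e' * B' + B * e'] in the product: the exact second factor is
   at most [B'], the approximation of the first at most [B]. *)
pose e' := e / (B + B' + 1).
have p0 : 0 < B + B' + 1 by lra.
have e'0 : 0 < e' by rewrite divr_gt0.
have [s [ns hs]] := Hg _ e'0; have [s' [ns' hs']] := Hh _ e'0.
pose m (p q : R * (nat * nat)) := (p.1 * q.1, ((p.2.1 + q.2.1)%N, (p.2.2 + q.2.2)%N)).
exists [seq m p q | p <- s, q <- s']; split.
  have -> : binorm [seq m p q | p <- s, q <- s'] = binorm s * binorm s'.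
    rewrite /binorm big_allpairs_dep mulr_suml; apply: eq_bigr => p _.
    rewrite mulr_sumr; apply: eq_bigr => q _ /=.
    by rewrite normrM !exprD; ring.
  by rewrite ler_pM ?binorm_ge0.
move=> y t hy ht.
have -> : bipoly [seq m p q | p <- s, q <- s'] y t = bipoly s y t * bipoly s' y t.
  rewrite /bipoly big_allpairs_dep mulr_suml; apply: eq_bigr => p _.
  rewrite mulr_sumr; apply: eq_bigr => q _ /=.
  by rewrite !exprD; ring.
have -> : g y t * h y t - bipoly s y t * bipoly s' y t =
  (g y t - bipoly s y t) * h y t + bipoly s y t * (h y t - bipoly s' y t) by ring.
rewrite (le_trans (ler_normD _ _)) // !normrM.
have h1 := hs _ _ hy ht; have h2 := hs' _ _ hy ht.
have h3 := apx_sup Hh hy ht; have h4 := le_trans (bipoly_le s hy ht) ns.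
apply: (@le_trans _ _ (e' * B' + B * e')); first by rewrite lerD // ler_pM.
have -> : e' * B' + B * e' = e' * (B + B') by ring.
rewrite /e' mulrAC ler_pdivrMr // ler_pM2l //; lra.
Qed.

Lemma apx_exp B h n : apx B h -> apx (B ^+ n) (fun y t => h y t ^+ n).
Proof.
move=> H; elim: n => [|n IH].
  by have := apx_cst 1; rewrite normr1 expr0; apply: eq_apx => y t _ _; rewrite expr0.
have := apx_mul H IH; rewrite -exprS; apply: eq_apx => y t _ _.
by rewrite exprS.
Qed.

Variables (n1 n2 : nat).

Definition cheb_interp h (y t : R) : R :=
  \sum_(k1 < n1) \sum_(k2 < n2)
    cheb_coef2 n1 n2 h k1 k2 * (cheb R k1).[y] * (cheb R k2).[t].

(** A monomial contributes only if its degrees are at least [k1] and [k2]; its weight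
    [s1 ^+ a * s2 ^+ b] is then at least the denominator, while its coefficient is at most 4. *)
Lemma apx_coef B h k1 k2 : (k1 < n1)%N -> (k2 < n2)%N -> apx B h ->
  `|cheb_coef2 n1 n2 h k1 k2| <= 4 * (B / (s1 ^+ k1 * s2 ^+ k2)).
Proof.
move=> kn1 kn2 H; apply/ler_addgt0Pr => e e0.
have e40 : 0 < e / 4 by rewrite divr_gt0.
have [s [ns hs]] := H _ e40.
have -> : cheb_coef2 n1 n2 h k1 k2 =
  cheb_coef2 n1 n2 (fun y t => h y t - bipoly s y t) k1 k2 +
  cheb_coef2 n1 n2 (bipoly s) k1 k2 by rewrite cheb_coef2B subrK.
rewrite (le_trans (ler_normD _ _)) // addrC lerD //; last first.
  apply: le_trans (cheb_coef2_le kn1 kn2 hs) _; lra.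
rewrite cheb_coef2_sum (le_trans (ler_norm_sum _ _ _)) //.
have q0 : 0 < s1 ^+ k1 * s2 ^+ k2 by apply: lt_le_trans ltr01 _.
apply: (@le_trans _ _ (4 * (binorm s / (s1 ^+ k1 * s2 ^+ k2)))); last first.
  by rewrite ler_pM2l // ler_pM2r ?invr_gt0.
rewrite /binorm mulr_suml mulr_sumr; apply: ler_sum => p _.
rewrite normrM -mulrA mulrCA ler_wpM2l //.
set a := p.2.1; set b := p.2.2.
have [ak|ka] := ltnP a k1.
  rewrite (cheb_coef2_prod _ _ (fun y => y ^+ _) (fun t => t ^+ _)) cheb_coef_monomial0 ?ak // mul0r normr0.
  by rewrite mulr_ge0 // divr_ge0 // ?(le_trans ler01) // ltW.
have [bk|kb] := ltnP b k2.
  rewrite (cheb_coef2_prod _ _ (fun y => y ^+ _) (fun t => t ^+ _)) [X in _ * X]cheb_coef_monomial0 ?bk // mulr0 normr0.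
  by rewrite mulr_ge0 // divr_ge0 // ?(le_trans ler01) // ltW.
apply: (@le_trans _ _ (4 * 1)).
  by apply: cheb_coef2_le => // y t hy ht; apply: monomial_le1.
rewrite ler_pM2l // ler_pdivlMr // mul1r -(subnK ka) -(subnK kb) !exprD mulrACA.
by rewrite ler_peMl // ltW.
Qed.

Lemma cheb_interp_le h e y t :
  (forall y t, -1 <= y <= 1 -> -1 <= t <= 1 -> `|h y t| <= e) ->
  -1 <= y <= 1 -> -1 <= t <= 1 -> `|cheb_interp h y t| <= n1%:R * (n2%:R * (4 * e)).
Proof.
move=> he hy ht; have e0 : 0 <= e by apply: le_trans (he _ _ hy ht).
have : `|cheb_interp h y t| <= \sum_(k1 < n1) \sum_(k2 < n2) 4 * e.
  apply: le_trans (ler_norm_sum _ _ _) _; apply: ler_sum => k1 _.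
  apply: le_trans (ler_norm_sum _ _ _) _; apply: ler_sum => k2 _.
  rewrite 2!normrM -[4 * e]mulr1 ler_pM ?mulr_ge0 ?cheb_le1 //.
  rewrite -[4 * e]mulr1 ler_pM ?mulr_ge0 ?cheb_le1 //.
  exact: cheb_coef2_le.
by rewrite !sumr_const !card_ord -!(mulr_natl (4 * e)) -[X in _ <= X -> _]mulr_natl.
Qed.

(** A monomial of low degrees is reproduced exactly. For the others the second factor of the bound
    is at least 1, and the crude norm of the interpolation operator suffices. *)
Lemma cheb_interp_err_monomial a b y t : -1 <= y <= 1 -> -1 <= t <= 1 ->
  `|y ^+ a * t ^+ b - cheb_interp (fun y t => y ^+ a * t ^+ b) y t| <=
  (1 + 4 * (n1 * n2)%:R) * (s1 ^+ a * s2 ^+ b * (s1 ^- n1 + s2 ^- n2)).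
Proof.
move=> hy ht.
have s10 : 0 < s1 := lt_le_trans ltr01 s1_ge1.
have s20 : 0 < s2 := lt_le_trans ltr01 s2_ge1.
have c0 : 0 <= (1 + 4 * (n1 * n2)%:R) :> R by rewrite addr_ge0 // mulr_ge0.
have q0 : 0 <= s1 ^- n1 + s2 ^- n2.
  by rewrite addr_ge0 // invr_ge0 exprn_ge0 // ltW.
have [/andP[an bn]|] := boolP ((a < n1)%N && (b < n2)%N).
  rewrite [X in _ - X](_ : _ = y ^+ a * t ^+ b).
    by rewrite subrr normr0 mulr_ge0 // mulr_ge0 // (le_trans ler01).
  rewrite /cheb_interp -(cheb_coef_monomial y an) -(cheb_coef_monomial t bn).
  rewrite mulr_suml; apply: eq_bigr => k1 _; rewrite mulr_sumr; apply: eq_bigr => k2 _.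
  by rewrite (cheb_coef2_prod _ _ (fun y => y ^+ _) (fun t => t ^+ _)); ring.
move=> hab.
have h1 : 1 <= s1 ^+ a * s2 ^+ b * (s1 ^- n1 + s2 ^- n2).
  have q1 : 0 <= s1 ^+ a * s2 ^+ b := le_trans ler01 (pow_ge1 a b).
  have e1 m : 0 < s1 ^- m by rewrite invr_gt0 exprn_gt0.
  have e2 m : 0 < s2 ^- m by rewrite invr_gt0 exprn_gt0.
  move: hab; rewrite negb_and -!leqNgt => /orP[na|nb].
    rewrite mulrDr -[1]addr0 lerD //; last first.
      by rewrite mulr_ge0 ?(ltW (e2 _)).
    rewrite ler_pdivlMr ?exprn_gt0 // mul1r -(subnK na) exprD mulrAC.
    by rewrite ler_peMl ?exprn_ge0 // ltW.
  rewrite mulrDr -[1]add0r lerD //; first by rewrite mulr_ge0 ?(ltW (e1 _)).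
  rewrite ler_pdivlMr ?exprn_gt0 // mul1r -(subnK nb) exprD mulrA.
  by rewrite ler_peMl ?exprn_ge0 // ltW.
apply: (@le_trans _ _ (1 + 4 * (n1 * n2)%:R)); last by rewrite ler_peMr.
rewrite (le_trans (ler_normB _ _)) // lerD ?monomial_le1 //.
apply: le_trans (@cheb_interp_le _ 1 _ _ _ hy ht) _ => [y' t'|]; first exact: monomial_le1.
by rewrite natrM mulr1; lra.
Qed.

Lemma apx_interp B h y t : apx B h -> -1 <= y <= 1 -> -1 <= t <= 1 ->
  `|h y t - cheb_interp h y t| <=
  (1 + 4 * (n1 * n2)%:R) * (B * (s1 ^- n1 + s2 ^- n2)).
Proof.
move=> H hy ht; set D := 1 + 4 * _; apply/ler_addgt0Pr => e e0.
have D0 : 0 < D by rewrite ltr_pwDl // mulr_ge0.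
have eD : 0 < e / D by rewrite divr_gt0.
have [s [ns hs]] := H _ eD.
have Esum : cheb_interp h y t = cheb_interp (fun y t => h y t - bipoly s y t) y t +
    \sum_(p <- s) p.1 * cheb_interp (fun y t => y ^+ p.2.1 * t ^+ p.2.2) y t.
  under [X in _ = _ + X]eq_bigr do rewrite mulr_sumr.
  rewrite [X in _ = _ + X]exchange_big /= -big_split; apply: eq_bigr => k1 _ /=.
  under [X in _ = _ + X]eq_bigr do rewrite mulr_sumr.
  rewrite [X in _ = _ + X]exchange_big /= -big_split; apply: eq_bigr => k2 _ /=.
  rewrite cheb_coef2B cheb_coef2_sum !mulrBl addrAC -addrA.
  rewrite [X in _ = _ + X](_ : _ = 0) ?addr0 //.
  apply/eqP; rewrite subr_eq0 !mulr_suml; apply/eqP; apply: eq_bigr => p _; ring.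
have -> : h y t - cheb_interp h y t =
    ((h y t - bipoly s y t) - cheb_interp (fun y t => h y t - bipoly s y t) y t) +
    \sum_(p <- s) p.1 * (y ^+ p.2.1 * t ^+ p.2.2 -
       cheb_interp (fun y t => y ^+ p.2.1 * t ^+ p.2.2) y t).
  rewrite Esum; under [X in _ = _ + X]eq_bigr do rewrite mulrBr.
  rewrite sumrB -/(bipoly s y t); ring.
rewrite (le_trans (ler_normD _ _)) // addrC lerD //.
  apply: le_trans (ler_norm_sum _ _ _) _.
  apply: (@le_trans _ _ (D * (binorm s * (s1 ^- n1 + s2 ^- n2)))); last first.
    rewrite ler_pM2l // ler_wpM2r // addr_ge0 // invr_ge0 exprn_ge0 // (le_trans ler01) //.
  rewrite /binorm mulr_suml mulr_sumr; apply: ler_sum => p _.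
  rewrite normrM -mulrA mulrCA ler_wpM2l //.
  exact: cheb_interp_err_monomial.
rewrite (le_trans (ler_normB _ _)) //.
apply: (@le_trans _ _ (e / D + n1%:R * (n2%:R * (4 * (e / D))))).
  by rewrite lerD ?hs // cheb_interp_le.
rewrite le_eqVlt; apply/orP; left; apply/eqP.
have -> : e / D + n1%:R * (n2%:R * (4 * (e / D))) = e / D * (1 + 4 * (n1 * n2)%:R).
  by rewrite natrM; ring.
by rewrite -/D divfK // lt0r_neq0.
Qed.

End Apx.

(** * Local Taylor expansions with uniform bounds *)

Section LocalExpansion.
Variable R : realType.
Local Notation nc := (@Normc.normc R).
Implicit Types (z : R[i]).

Lemma ncE z : `|z| = (nc z)%:C.
Proof. by rewrite normc_def; case: z. Qed.

Lemma nc_ge0 z : 0 <= nc z.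
Proof. by case: z => a b; rewrite /Normc.normc sqrtr_ge0. Qed.

Lemma nc_real (x : R) : nc x%:C = `|x|.
Proof. by rewrite /Normc.normc /= expr0n addr0 sqrtr_sqr. Qed.

Lemma nc_Re z : `|complex.Re z| <= nc z.
Proof. by rewrite -lecR -ncE normc_ge_Re. Qed.

Lemma ncX z n : nc (z ^+ n) = nc z ^+ n.
Proof.
elim: n => [|n IH]; first by rewrite !expr0 Normc.normc1.
by rewrite !exprS Normc.normcM IH.
Qed.

Lemma nc_sum (I : Type) (s : seq I) (F : I -> R[i]) :
  nc (\sum_(i <- s) F i) <= \sum_(i <- s) nc (F i).
Proof.
elim/big_rec2: _ => [|i a b _ h]; first by rewrite Normc.normc0.
by apply: le_trans (le_normcD _ _) _; rewrite lerD2l.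
Qed.

Lemma ncB z1 z2 : nc (z1 - z2) = nc (z2 - z1).
Proof. by rewrite -normcN opprB. Qed.

Lemma nbhs_nc (z0 : R[i]^o) (P : set R[i]^o) : nbhs z0 P ->
  exists2 d : R, 0 < d & forall z : R[i], nc (z - z0) < d -> P z.
Proof.
move=> /nbhs_normP[e /= e0 he].
(* A positive element of [R[i]] is real, so the complex radius [e] yields a real one. *)
have [eR eI] : 0 < complex.Re e /\ e = (complex.Re e)%:C.
  move: e0; rewrite ltcE /= => /andP[/eqP e1 e2]; split=> //.
  by rewrite [LHS]complexE e1 mulr0 addr0.
exists (complex.Re e) => // z hz; apply: he => /=.
by rewrite ncE [X in _ < X]eI ltcR ncB.
Qed.

Lemma cvg_nc (u : nat -> R[i]^o) (l : R[i]^o) : u @ \oo --> l ->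
  forall e : R, 0 < e -> exists N, forall n, (N <= n)%N -> nc (l - u n) <= e.
Proof.
move=> /cvgrPdist_le h e e0.
have e0' : 0 < e%:C :> R[i] by rewrite ltcR.
have [N _ hN] := h _ e0'; exists N => n Nn.
by have := hN n Nn; rewrite /= ncE lecR.
Qed.

Lemma geom_half_le (m n : nat) :
  \sum_(m <= k < n) (2^-1 : R) ^+ k <= 2 * 2^-1 ^+ m.
Proof.
have [nm|mn] := leqP n m.
  by rewrite big_geq // mulr_ge0 // exprn_ge0.
suff : \sum_(m <= k < n) (2^-1 : R) ^+ k = 2 * 2^-1 ^+ m - 2 * 2^-1 ^+ n.
  by move=> ->; rewrite gerBl mulr_ge0 // exprn_ge0.
elim: n mn => // n IH; rewrite ltnS leq_eqVlt => /predU1P[->|mn].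
  by rewrite big_nat1 exprS; field.
by rewrite big_nat_recr 1?ltnW //= IH // exprS; field.
Qed.

(* The real numbers [c j], bounded in a weighted l1-norm, replace the Taylor
   coefficients of the real part of [f] at [m]. *)
Definition expansion (f : R[i] -> R[i]) (m r B : R) : Prop :=
  (forall z, nc (z - m%:C) <= r -> analytic_at f z /\ nc (f z) <= B) /\
  (forall e, 0 < e -> exists n (c : nat -> R), \sum_(j < n) `|c j| * r ^+ j <= B /\
     forall x, `|x - m| <= r ->
       `|real_part f x - \sum_(j < n) c j * (x - m) ^+ j| <= e).

(** Convergence at [m + p] bounds the terms [c k * p ^ k] by some [M]. On the disc of half that
    radius the series is dominated by a geometric one of sum [2 * M], which bounds [f], the tails
    and the weighted l1-norm. *)
Lemma analytic_expansion (f : R[i] -> R[i]) (D : set R[i]^o) (m : R) :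
  open D -> (forall z, D z -> analytic_at f z) -> D m%:C ->
  exists r B, [/\ 0 < r, 0 <= B & expansion f m r B].
Proof.
move=> oD hD Dm.
have [d1 d10 hd1] : exists2 d : R, 0 < d & forall z : R[i], nc (z - m%:C) < d -> D z.
  by apply: nbhs_nc; apply: open_nbhs_nbhs.
have [c hc] := hD _ Dm; have [d2 d20 hd2] := nbhs_nc hc.
pose d := Num.min d1 d2; have d0 : 0 < d by rewrite lt_min d10.
pose p := d / 2; have p0 : 0 < p by rewrite divr_gt0.
have pd : p < d by rewrite /p; lra.
have dd1 : d <= d1 by rewrite ge_min lexx.
have dd2 : d <= d2 by rewrite ge_min lexx orbT.
pose S n (z : R[i]) : R[i] := \sum_(k < n) c k * (z - m%:C) ^+ k.
have hcv z : nc (z - m%:C) <= p -> forall e : R, 0 < e ->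
    exists N, forall n, (N <= n)%N -> nc (f z - S n z) <= e.
  move=> hz e e0.
  have hz2 : nc (z - m%:C) < d2 by rewrite (le_lt_trans hz) // (lt_le_trans pd).
  have [N hN] := cvg_nc (hd2 z hz2) e0; exists N => n /hN.
  by rewrite /series /= big_mkord.
have [M M0 hM] : exists2 M : R, 0 <= M & forall k, nc (c k) * p ^+ k <= M.
  have zp : nc ((m + p)%:C - m%:C) <= p.
    by rewrite -rmorphB addrAC subrr add0r nc_real ger0_norm // ltW.
  have [N hN] := hcv _ zp 1 ltr01.
  exists (2 + \sum_(k < N) nc (c k) * p ^+ k).
    by rewrite addr_ge0 // sumr_ge0 // => k _; rewrite mulr_ge0 ?nc_ge0 // exprn_ge0 // ltW.
  move=> k; have [kN|Nk] := ltnP k N.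
    rewrite (bigD1 (Ordinal kN)) //= addrCA lerDl addr_ge0 // sumr_ge0 // => i _.
    by rewrite mulr_ge0 ?nc_ge0 // exprn_ge0 // ltW.
  have s0 : 0 <= \sum_(k < N) nc (c k) * p ^+ k.
    by rewrite sumr_ge0 // => i _; rewrite mulr_ge0 ?nc_ge0 // exprn_ge0 // ltW.
  have := hN _ Nk; have := hN _ (leqW Nk).
  set z := (m + p)%:C => h1 h2.
  have e1 : c k * (z - m%:C) ^+ k = (f z - S k z) - (f z - S k.+1 z).
    by rewrite /S big_ord_recr /=; ring.
  have e2 : z - m%:C = p%:C by rewrite /z -rmorphB addrAC subrr add0r.
  have : nc (c k * (z - m%:C) ^+ k) <= 1 + 1.
    by rewrite e1 (le_trans (le_normcD _ _)) // normcN lerD.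
  rewrite Normc.normcM ncX e2 nc_real (ger0_norm (ltW p0)) => h; lra.
pose r := p / 2; have r0 : 0 < r by rewrite divr_gt0.
have rp : r <= p by rewrite /r; lra.
have cr k : nc (c k) * r ^+ k <= M * 2^-1 ^+ k.
  by rewrite /r exprMn mulrA ler_wpM2r ?hM // exprn_ge0.
have trunc z n : nc (z - m%:C) <= r -> nc (f z - S n z) <= 2 * M * 2^-1 ^+ n.
  move=> hz; apply/ler_addgt0Pr => e e0.
  have [N hN] := hcv z (le_trans hz rp) e e0.
  have := hN (maxn N n) (leq_maxl _ _); set n' := maxn N n => hn'.
  have -> : f z - S n z = (S n' z - S n z) + (f z - S n' z) by ring.
  rewrite (le_trans (le_normcD _ _)) // lerD //.
  have -> : S n' z - S n z = \sum_(n <= k < n') c k * (z - m%:C) ^+ k.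
    rewrite /S -!(big_mkord xpredT (fun k => c k * (z - m%:C) ^+ k)).
    by rewrite (@big_cat_nat _ _ _ n 0 n') ?leq_maxr //= addrAC subrr add0r.
  apply: le_trans (nc_sum _ _) _.
  apply: (@le_trans _ _ (\sum_(n <= k < n') M * 2^-1 ^+ k)).
    apply: ler_sum => k _; rewrite Normc.normcM ncX (le_trans _ (cr k)) //.
    by rewrite ler_wpM2l ?nc_ge0 // lerXn2r // nnegrE ?nc_ge0 // ltW.
  rewrite -mulr_sumr (mulrC 2) -mulrA ler_wpM2l //; exact: geom_half_le.
exists r, (2 * M); split=> //; first by rewrite mulr_ge0.
split=> [z hz|e e0].
  split; first by apply/hD/hd1; rewrite (le_lt_trans hz) // (le_lt_trans rp) // (lt_le_trans pd).
  by have := trunc z 0%N hz; rewrite expr0 mulr1 /S big_ord0 subr0.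
have [n hn] : exists n, 2 * M * 2^-1 ^+ n <= e.
  have [n hn] : exists n : nat, 2 * M / e < n%:R.
    by exists (Num.trunc (2 * M / e)).+1; exact: truncnS_gt.
  exists n; have n2 : n%:R <= (2 ^+ n : R).
    by rewrite -natrX ler_nat ltnW // ltn_expl.
  rewrite exprVn ler_pdivrMr ?exprn_gt0 // [leRHS]mulrC -ler_pdivrMr //.
  by rewrite ltW // (lt_le_trans hn).
(* At real points, the real part of a partial sum is the polynomial with coefficients [Re (c k)]. *)
exists n, (fun k => complex.Re (c k)); split.
  apply: (@le_trans _ _ (\sum_(0 <= k < n) M * 2^-1 ^+ k)).
    rewrite big_mkord; apply: ler_sum => k _; apply: le_trans (cr k).
    by rewrite ler_wpM2r ?nc_Re // exprn_ge0 // ltW.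
  rewrite -mulr_sumr (mulrC 2) ler_wpM2l // (le_trans (geom_half_le _ _)) //.
  by rewrite expr0 mulr1.
move=> x hx; apply: le_trans hn.
have hz : nc (x%:C - m%:C) <= r by rewrite -rmorphB nc_real.
apply: le_trans (trunc _ n hz); apply: le_trans (nc_Re _).
have -> : \sum_(j < n) complex.Re (c j) * (x - m) ^+ j = complex.Re (S n x%:C).
  rewrite [RHS]raddf_sum; apply: eq_bigr => k _ /=.
  rewrite -rmorphB -rmorphXn /=; case: (c k) => a b /=.
  by rewrite mulr0 subr0.
by rewrite raddfB.
Qed.

(** A single integer [n] encodes both the bound [n + 1] and the margin [1 / (n + 1)], so compactness
    along the filter at infinity yields both uniformly. The margin keeps the disc of radius [s]
    about [m] inside the disc of expansion about [m0]. *)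
Lemma uniform_expansion (f : R[i] -> R[i]) (alpha beta : R) :
  analytic_near f (real_segment alpha beta) ->
  exists s B, [/\ 0 < s, 1 <= B & forall m, alpha <= m <= beta ->
    exists m0 r, `|m - m0| + s <= r /\ expansion f m0 r B].
Proof.
move=> [D [oD KD hD]].
pose P (n : nat) (m : R) := exists m0 r B,
  [/\ `|m - m0| + n.+1%:R^-1 <= r, B <= n.+1%:R & expansion f m0 r B].
have /compact_near_coveringP cov : compact `[alpha, beta] by exact: segment_compact.
have [|n _ hn] := cov nat \oo (fun n m => P n m).
  move=> m hm.
  have Dm : D m%:C by apply: KD; exists m => //; move: hm; rewrite /= in_itv.
  have [r [B [r0 B0 hB]]] := analytic_expansion oD hD Dm.
  have r20 : 0 < r / 2 by rewrite divr_gt0.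
  pose N0 := Num.trunc (2 / r + B).
  exists ([set m' | `|m - m'| < r / 2], [set n | (N0 <= n)%N]); first split=> /=.
  - by apply/nbhs_normP; exists (r / 2).
  - by exists N0.
  - move=> [m' n] /= [hm' hn].
    have h1 : 2 / r + B <= n.+1%:R.
      by rewrite ltW // (lt_le_trans (truncnS_gt _)) // ler_nat ltnS.
    have q0 : 0 < 2 / r by rewrite divr_gt0.
    exists m, r, B; split=> //; last by lra.
    rewrite [leRHS]splitr lerD //; first by rewrite distrC ltW.
    rewrite -[r / 2]invrK invf_div lef_pV2 ?posrE //; lra.
exists (n.+1%:R^-1), n.+1%:R; split.
- by rewrite invr_gt0.
- by rewrite ler1n.
move=> m hm; have [|m0 [r [B [h1 h2 [h3 h4]]]]] := hn n (leqnn n) m.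
  by rewrite /= in_itv.
exists m0, r; split=> //; split=> [z /h3[? /le_trans]|e /h4[k [c [h5 h6]]]].
  by move=> /(_ _ h2).
by exists k, c; split=> //; exact: le_trans h2.
Qed.

End LocalExpansion.

(** * The function psi *)

Section PhiPsi.
Variable R : realType.
Implicit Types l x g m : R.

Lemma phi_surj l : 1 <= l -> exists x, 1 <= x /\ phi x = l.
Proof.
move=> l1.
(* For [n >= 1], [phi] is affine on [[n, n + 1[] and runs there from [tri n] to [tri n.+1]; the
   piece containing [l] is located first. *)
pose tri (n : nat) : R := n%:R * (n%:R + 1) / 2.
have [n [n1 hn1 hn2]] : exists n : nat, [/\ (0 < n)%N, tri n <= l & l < tri n.+1].
  have ex : exists n, l < tri n.+1.
    exists (Num.trunc l); have := truncnS_gt l; rewrite /tri -[X in _ < X]natr1 => h.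
    rewrite -natr1; set t : R := _%:R in h *; have t0 : 0 <= t by rewrite ler0n.
    nra.
  exists (ex_minn ex); case: ex_minnP => n hn minn; split=> //.
    by case: n hn minn => // + _; rewrite /tri; lra.
  case: n hn minn => [|n] hn minn; first by rewrite /tri mul0r mul0r; lra.
  by rewrite leNgt; apply/negP => /minn; rewrite ltnn.
exists (l / (n%:R + 1) + n%:R / 2).
have p0 : 0 < n%:R + 1 :> R by rewrite natr1 ltr0n.
have fl : Num.floor (l / (n%:R + 1) + n%:R / 2) = n%:Z.
  apply/eqP; rewrite Num.Theory.floor_eq; apply/andP; split.
    rewrite -lerBlDr ler_pdivlMr //; move: hn1; rewrite /tri /=; nra.
  rewrite intrD -ltrBrDr ltr_pdivrMr //; move: hn2; rewrite /tri -natr1 /=; nra.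
split; last by rewrite /phi fl /=; field; rewrite lt0r_neq0.
have := Num.Theory.floor_le (l / (n%:R + 1) + n%:R / 2); rewrite fl; apply: le_trans.
by rewrite -[1]/(1%:~R) ler_int.
Qed.

Lemma phi_invP l : 1 <= l -> 1 <= phi_inv l /\ phi (phi_inv l) = l.
Proof. by move=> l1; apply: (@xgetPex _ _ [set x | 1 <= x /\ phi x = l]); exact: phi_surj. Qed.

Variant psi_spec l : Prop :=
  PsiSpec n of (0 < n)%N & n%:R <= phi_inv l & phi_inv l < n%:R + 1 &
    l = (1 + n%:R) * (phi_inv l - n%:R / 2) &
    psi l * (12 * l) =
      (1 + n%:R) * (6 * phi_inv l ^+ 2 - n%:R - 2 * n%:R ^+ 2).

Lemma psiP l : 1 <= l -> psi_spec l.
Proof.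
move=> l1; have [x1 hx] := phi_invP l1.
have f1 : (1 <= Num.floor (phi_inv l))%R by rewrite Num.Theory.floor_ge_int.
have fE : Num.floor (phi_inv l) = `|Num.floor (phi_inv l)|%N%:Z.
  by rewrite gez0_abs // (le_trans _ f1).
have f := Num.Theory.floor_le (phi_inv l); have f' := floorD1_gt (phi_inv l).
move: hx f f'; rewrite /phi intrD fE => hx f f'.
apply: (PsiSpec (n := `|Num.floor (phi_inv l)|%N)) => //.
- by lia.
- rewrite /psi fE /=; set n : R := _%:~R; field.
  by rewrite lt0r_neq0 // (lt_le_trans _ l1).
Qed.

Lemma phi_inv_le l : 1 <= l -> phi_inv l <= l.
Proof.
move=> l1; have [x1 _] := phi_invP l1.
case: (psiP l1) => n n0 h1 h2 h3 _; rewrite [leRHS]h3.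
have n1 : 1 <= n%:R :> R by rewrite ler1n.
move: (phi_inv l) x1 h1 h2 => x x1 h1 h2.
have : 0 <= n%:R * (x - (n%:R + 1) / 2) by apply: mulr_ge0 => //; lra.
nra.
Qed.

Lemma psi_le l : 1 <= l -> psi l <= phi_inv l.
Proof.
move=> l1; have [x1 _] := phi_invP l1.
case: (psiP l1) => n n0 h1 h2 h3 h4; have l0 : 0 < 12 * l by lra.
rewrite -(ler_pM2r l0) h4.
have n1 : 1 <= n%:R :> R by rewrite ler1n.
move: (phi_inv l) x1 h1 h2 h3 {h4} => x x1 h1 h2 ->.
have : 0 <= 6 * x ^+ 2 - 6 * n%:R * x + n%:R + 2 * n%:R ^+ 2 by nra.
move=> h; nra.
Qed.

(** Makes [g * psi (N / g)] at least [sqrt (g * N) / 12], the growth on which both error terms of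
    the theorem rest. *)
Lemma psi_ge l : 1 <= l -> Num.sqrt l / 12 <= psi l.
Proof.
move=> l1; have [x1 _] := phi_invP l1.
case: (psiP l1) => n n0 h1 h2 h3 h4; have l0 : 0 < 12 * l by lra.
have n1 : 1 <= n%:R :> R by rewrite ler1n.
apply: (@le_trans _ _ (phi_inv l / 8)).
  have : Num.sqrt l <= 3 / 2 * phi_inv l.
    have p0 : 0 <= 3 / 2 * phi_inv l by lra.
    rewrite -[leRHS](ger0_norm p0) -sqrtr_sqr.
    rewrite ler_sqrt ?sqr_ge0 //.
    by move: (phi_inv l) x1 h1 h2 h3 {h4} => x x1 h1 h2 ->; nra.
  by lra.
rewrite -(ler_pM2r l0) h4.
move: (phi_inv l) x1 h1 h2 h3 {h4} => x x1 h1 h2 ->.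
have : 0 <= (6 * x ^+ 2 - n%:R - 2 * n%:R ^+ 2) * 8 - 12 * x * (x - n%:R / 2) by nra.
move=> h; nra.
Qed.

Definition posp m : R := if 0 <= m then m else 0.

Lemma posp_ge0 m : 0 <= posp m. Proof. by rewrite /posp; case: ifP. Qed.

Lemma posp_ge m : m <= posp m.
Proof. by rewrite /posp; case: ifPn => //; rewrite -ltNge => /ltW. Qed.

Lemma sum_posp p m :
  \sum_(k < p) posp (m - k%:R) <= posp m ^+ 2 / 2 + posp m.
Proof.
elim: p m => [|p IH] m.
  by rewrite big_ord0; have := posp_ge0 m; nra.
rewrite big_ord_recl subr0.
have -> : \sum_(i < p) posp (m - (bump 0 i)%:R) = \sum_(i < p) posp (m - 1 - i%:R).
  by apply: eq_bigr => i _; congr posp; rewrite /bump add1n -natr1; ring.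
have := IH (m - 1); rewrite /posp; case: ifP => h1; case: ifP => h2; nra.
Qed.

Lemma sum_ord_stable (F : nat -> R) p q : (forall k, 0 <= F k) ->
  (forall k, (q <= k)%N -> F k = 0) -> \sum_(k < p) F k <= \sum_(k < q) F k.
Proof.
move=> F0 Fq; have [pq|/ltnW qp] := leqP p q.
  rewrite (big_ord_widen q F pq) [leRHS](bigID (fun k : 'I_q => (k < p)%N)) /=.
  by rewrite lerDl sumr_ge0.
rewrite [leRHS](big_ord_widen p F qp) [leLHS](bigID (fun k : 'I_p => (k < q)%N)) /=.
by rewrite [X in _ + X <= _]big1 ?addr0 // => k; rewrite -leqNgt => /Fq.
Qed.

(** Origin of [phi] and [psi]. With [x = phi_inv l] and [n] its floor, the numbers [x - k2],
    [k2 <= n], add up to [phi x = l], and their half squares to [l * (x - psi l)]. The sum over [k1]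
    turns a positive part [m] into at most [m ^ 2 / 2 + m]. *)
Lemma sum_posp2 l g p q : 1 <= l -> 0 < g ->
  \sum_(k1 < p) \sum_(k2 < q) posp (g * (phi_inv l - k2%:R) - k1%:R) <=
  g * l * (g * (phi_inv l - psi l) + 1).
Proof.
move=> l1 g0; rewrite exchange_big /=.
pose G k2 : R := posp (g * (phi_inv l - k2%:R)) ^+ 2 / 2
                 + posp (g * (phi_inv l - k2%:R)).
apply: (@le_trans _ _ (\sum_(k2 < q) G k2)).
  by apply: ler_sum => k2 _; exact: sum_posp.
have [x1 _] := phi_invP l1.
case: (psiP l1) => n n0 h1 h2 h3 h4; have l0 : 0 < l by lra.
apply: (@le_trans _ _ (\sum_(k2 < n.+1) G k2)).
  apply: sum_ord_stable => k.
    by rewrite /G addr_ge0 ?divr_ge0 ?exprn_ge0 ?posp_ge0.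
  rewrite -(ler_nat R) -natr1 => nk; rewrite /G /posp ifF ?expr0n ?mul0r ?addr0 //.
  by apply/negbTE; rewrite -ltNge pmulr_rlt0 //; lra.
rewrite (eq_bigr (fun k : 'I_n.+1 =>
    (g * (phi_inv l - k%:R)) ^+ 2 / 2 + g * (phi_inv l - k%:R))); last first.
  move=> k _; rewrite /G /posp ifT // pmulr_rge0 // subr_ge0 (le_trans _ h1) //.
  by rewrite ler_nat -ltnS.
have -> : \sum_(k < n.+1) ((g * (phi_inv l - k%:R)) ^+ 2 / 2 + g * (phi_inv l - k%:R))
  = g ^+ 2 / 2 * ((n%:R + 1) * phi_inv l ^+ 2 - phi_inv l * n%:R * (n%:R + 1)
       + n%:R * (n%:R + 1) * (2 * n%:R + 1) / 6)
    + g * ((n%:R + 1) * phi_inv l - n%:R * (n%:R + 1) / 2).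
  move: (phi_inv l) => x; clear; elim: n => [|n IH].
    by rewrite big_ord_recl big_ord0 /=; field.
  by rewrite big_ord_recr IH /= -natr1; field.
rewrite le_eqVlt; apply/orP; left; apply/eqP.
have -> : g * l * (g * (phi_inv l - psi l) + 1) =
  g * (g * (l * phi_inv l - psi l * (12 * l) / 12) + l) by field.
by rewrite h4; move: (phi_inv l) h3 => x ->; field.
Qed.

Lemma sum_inj_le (I C : finType) (J : I -> C) (h : C -> R) :
  injective J -> (forall c, 0 <= h c) -> \sum_i h (J i) <= \sum_c h c.
Proof.
move=> Ji h0; rewrite -(big_imset h (in2W Ji)) /=.
rewrite [leRHS](bigID (fun c => c \in [set J x | x : I]%SET)) /=.
by rewrite lerDl sumr_ge0.
Qed.

End PhiPsi.

(** * Gauss's lemma and resultants *)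

Section PrimeElements.
Variable A : idomainType.
Implicit Types (x y p : A) (F G : {poly A}).

(** Exact divisibility, whereas [%|] on polynomials over a domain is divisibility up to a nonzero
    scalar. *)
Definition mdiv x y : Prop := exists z, y = x * z.

Lemma mdiv0 x : mdiv x 0. Proof. by exists 0; rewrite mulr0. Qed.

Lemma mdivMr x y z : mdiv x y -> mdiv x (y * z).
Proof. by move=> [t ->]; exists (t * z); rewrite mulrA. Qed.

Lemma mdivMl x y z : mdiv x y -> mdiv x (z * y).
Proof. by rewrite mulrC; exact: mdivMr. Qed.

Lemma mdivB x y z : mdiv x y -> mdiv x z -> mdiv x (y - z).
Proof. by move=> [t ->] [s ->]; exists (t - s); rewrite mulrBr. Qed.

Lemma mdiv_sum (I : Type) (r : seq I) (P : pred I) (F : I -> A) x :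
  (forall i, P i -> mdiv x (F i)) -> mdiv x (\sum_(i <- r | P i) F i).
Proof.
move=> h; elim/big_ind: _ => //; first exact: mdiv0.
by move=> a b [s ->] [t ->]; exists (s + t); rewrite mulrDr.
Qed.

Definition prime_el p : Prop :=
  [/\ p != 0, p \isn't a GRing.unit &
      forall x y, mdiv p (x * y) -> mdiv p x \/ mdiv p y].

Definition cdiv p F : Prop := forall i, mdiv p F`_i.

Lemma cdivP p F : cdiv p F <-> exists G, F = p *: G.
Proof.
split=> [h|[G ->] i]; last by exists G`_i; rewrite coefZ.
have /choice[g hg] : forall i, exists z, F`_i = p * z by exact: h.
exists (\poly_(i < size F) g i); apply/polyP => i; rewrite coefZ coef_poly.
by case: ltnP => [_|hi]; [exact: hg | rewrite mulr0 nth_default].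
Qed.

Lemma least_ncdiv p F : ~ cdiv p F ->
  exists i, ~ mdiv p F`_i /\ forall j, (j < i)%N -> mdiv p F`_j.
Proof.
move=> nF; have ex : exists i, `[< ~ mdiv p F`_i >].
  by have /existsNP[i hi] := nF; exists i; apply/asboolP.
case: (ex_minnP ex) => i /asboolP hi mini; exists i; split=> // j ji.
by apply: contrapT => hj; have := mini j (introT (asboolP _) hj); rewrite leqNgt ji.
Qed.

(** Gauss's argument: if [i] and [j] are the least indices of coefficients not divisible by [p],
    coefficient [i + j] of the product is [F_i * G_j] plus multiples of [p]. *)
Lemma prime_el_poly p F G : prime_el p -> cdiv p (F * G) -> cdiv p F \/ cdiv p G.
Proof.
move=> [p0 pu pp] h; apply: contrapT => /not_orP[nF nG].
have [i [hi mi]] := least_ncdiv nF; have [j [hj mj]] := least_ncdiv nG.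
suff /pp[] : mdiv p (F`_i * G`_j) by [].
have lti : (i < (i + j).+1)%N by rewrite ltnS leq_addr.
have := h (i + j)%N; rewrite coefM (bigD1 (Ordinal lti)) //= addKn => hs.
set S := \sum_(_ < _ | _) _ in hs.
have -> : F`_i * G`_j = F`_i * G`_j + S - S by rewrite addrK.
apply: mdivB => //; apply: mdiv_sum => k nk.
have [ki|ik] := ltnP k i; first exact/mdivMr/mi.
apply/mdivMl/mj; have : k != i :> nat by apply: contra nk => /eqP e; apply/eqP/val_inj.
have := ltn_ord k; lia.
Qed.

End PrimeElements.

Section GaussInt2.
Implicit Types (c : {poly int}) (F G P Q : {poly {poly int}}).

Lemma int_unitE (x : int) : (x \is a GRing.unit) = (`|x| == 1)%N.
Proof.
have -> : (x \is a GRing.unit) = (x == 1) || (x == -1) by [].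
lia.
Qed.

Lemma prime_el_int (p : nat) : prime p -> prime_el (p%:Z).
Proof.
move=> pp; have p1 := prime_gt1 pp; split.
- by lia.
- by rewrite int_unitE; lia.
- move=> x y [z e].
  have : (p %| `|x| * `|y|)%N.
    by rewrite -abszM e abszM dvdn_mulr.
  rewrite Euclid_dvdM // => /orP[] h; [left|right].
    have /dvdzP[t ->] : (p%:Z %| x)%Z by rewrite /dvdz /=.
    by exists t; rewrite mulrC.
  have /dvdzP[t ->] : (p%:Z %| y)%Z by rewrite /dvdz /=.
  by exists t; rewrite mulrC.
Qed.

Lemma prime_el_polyC (p : nat) : prime p -> prime_el ((p%:Z)%:P).
Proof.
move=> pp; have pe := prime_el_int pp; have [p0 pu ppp] := pe; split.
- by rewrite polyC_eq0.
- by rewrite poly_unitE size_polyC p0 coefC /=.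
- have e c : mdiv (p%:Z)%:P c <-> cdiv p%:Z c.
    rewrite cdivP; split=> -[G ->]; exists G; by rewrite mul_polyC.
  by move=> x y; rewrite !e; exact: prime_el_poly.
Qed.

(** Drops strictly when a nonunit factor is removed, since that factor has positive degree or a
    leading coefficient of absolute value at least 2. *)
Definition pmeasure c : nat := (`|lead_coef c| + size c)%N.

Lemma pmeasure_lt x c : x != 0 -> x \isn't a GRing.unit -> c != 0 ->
  (pmeasure c < pmeasure (x * c))%N.
Proof.
move=> x0 xu c0; rewrite /pmeasure lead_coefM abszM size_mul //.
have lx : (0 < `|lead_coef x|)%N by rewrite absz_gt0 lead_coef_eq0.
have lc : (0 < `|lead_coef c|)%N by rewrite absz_gt0 lead_coef_eq0.
have sx : (0 < size x)%N by rewrite size_poly_gt0.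
have [sx1|sx2] := leqP (size x) 1; last first.
  have : (1 * `|lead_coef c| <= `|lead_coef x| * `|lead_coef c|)%N by rewrite leq_mul2r lx orbT.
  by move: `|lead_coef x|%N `|lead_coef c|%N (size x) (size c) sx2 => a b p q; nia.
have sxe : size x = 1%N by lia.
have : (1 < `|lead_coef x|)%N.
  rewrite ltn_neqAle lx andbT; apply: contra xu => /eqP e.
  by rewrite poly_unitE sxe eqxx int_unitE e lead_coefE sxe eqxx.
rewrite sxe; move: `|lead_coef x|%N `|lead_coef c|%N (size c) lc => a b s *; nia.
Qed.

(** A rational prime dividing the content, if the content is not a unit; otherwise a nonconstant
    factor of least degree, which has unit content and is irreducible over the rationals, hence
    prime in [Z[X]]. *)
Lemma prime_el_divisor c : c != 0 -> c \isn't a GRing.unit ->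
  exists p d, prime_el p /\ c = p * d.
Proof.
move=> c0 cu.
have [z1|z1] := eqVneq `|zcontents c|%N 1%N; last first.
  have z0 : (0 < `|zcontents c|)%N by rewrite absz_gt0 zcontents_eq0.
  set p := pdiv `|zcontents c|; have pr : prime p by apply: pdiv_prime; lia.
  exists (p%:Z)%:P; have /dvdzP[t et] : (p%:Z %| zcontents c)%Z.
    by rewrite /dvdz /=; exact: pdiv_dvd.
  exists (t *: zprimitive c); split; first exact: prime_el_polyC.
  by rewrite mul_polyC scalerA mulrC -et -zpolyEprim.
have sc : (1 < size c)%N.
  rewrite ltnNge; apply: contra cu => sc; have sce : size c = 1%N.
    by have := c0; rewrite -size_poly_gt0; lia.
  have ec : c = (lead_coef c)%:P by rewrite [LHS]size1_polyC // lead_coefE sce.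
  rewrite poly_unitE sce eqxx int_unitE /=; move: z1; rewrite {1}ec -[_%:P]mulr1 mul_polyC.
  rewrite zcontentsZ zcontents_monic ?monic1 // mulr1 lead_coefE sce => ->.
  by [].
have ex : exists n, `[< exists p d, [/\ c = p * d, size p = n & (1 < n)%N] >].
  by exists (size c); apply/asboolP; exists c, 1; rewrite mulr1.
case: (ex_minnP ex) => n /asboolP[p [d [ec sp n1]]] minn.
have p0 : p != 0 by apply: contraNneq c0 => e; rewrite ec e mul0r.
have d0 : d != 0 by apply: contraNneq c0 => e; rewrite ec e mulr0.
have zp : `|zcontents p|%N = 1%N.
  by move: z1; rewrite ec zcontentsM abszM => /eqP; rewrite muln_eq1 => /andP[/eqP].
have zprim (y : {poly int}) : p %| y -> mdiv p y.
  move=> /dvdpP_int[r ->].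
  have e : p = zcontents p *: zprimitive p := zpolyEprim p.
  exists (zcontents p *: r); rewrite -scalerAr [X in _ = _ *: (X * _)]e -scalerAl scalerA.
  have -> : zcontents p * zcontents p = 1; last by rewrite scale1r.
  by move: zp; move: (zcontents p) => z ?; nia.
have minp g : g %| p -> (1 < size g)%N -> (size p <= size g)%N.
  move=> /dvdpP_int[r er] sg; rewrite sp; apply: minn; apply/asboolP.
  exists (zprimitive g), (r * d); split; rewrite ?size_zprimitive //.
  by rewrite mulrA -er.
exists p, d; split=> //; split=> //; first by rewrite poly_unitE sp; lia.
move=> x y [t et].
have dxy : p %| x * y by rewrite et dvdp_mulr.
have [cop|ncop] := boolP (coprimep p x).
  by right; apply: zprim; move: dxy; rewrite mulrC Gauss_dvdpl.
left; apply: zprim; have g1 : (1 < size (gcdp p x))%N.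
  rewrite ltn_neqAle eq_sym -coprimep_def ncop size_poly_gt0 gcdp_eq0 negb_and p0 //.
have : gcdp p x %= p.
  rewrite -dvdp_size_eqp ?dvdp_gcdl // eqn_leq minp ?dvdp_gcdl // andbT.
  by rewrite dvdp_leq ?dvdp_gcdl.
by move=> /eqp_dvdl <-; exact: dvdp_gcdr.
Qed.

Definition primitive_poly G : Prop := forall p, prime_el p -> ~ cdiv p G.

Lemma primitive_part G : G != 0 ->
  exists g H, [/\ g != 0, G = g *: H & primitive_poly H].
Proof.
have [n] := ubnP (pmeasure (lead_coef G)); elim: n G => // n IH G hn G0.
have [h|] := pselect (primitive_poly G).
  by exists 1, G; rewrite scale1r oner_eq0.
move=> /existsNP[p /not_implyP[pp /contrapT /cdivP[H eG]]].
have [p0 pu _] := pp.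
have H0 : H != 0 by apply: contraNneq G0 => e; rewrite eG e scaler0.
have [|//|g [K [g0 eH pK]]] := IH H.
  apply: leq_trans (_ : pmeasure (lead_coef G) <= _)%N; last by rewrite -ltnS.
  by rewrite eG lead_coefZ pmeasure_lt // lead_coef_eq0.
by exists (p * g), K; rewrite mulf_neq0 // -scalerA -eH.
Qed.

(** The prime factors of [c] are cancelled one at a time: each divides [F * G], hence [F], because
    [G] is primitive. *)
Lemma primitive_dvd c P F G : c != 0 -> primitive_poly G ->
  c *: P = F * G -> exists F', P = F' * G.
Proof.
have [n] := ubnP (pmeasure c); elim: n c F => // n IH c F hn c0 pG e.
have [cu|cu] := boolP (c \is a GRing.unit).
  by exists (c^-1 *: F); rewrite -scalerAl -e scalerA mulVr // scale1r.
have [p [d [pp ec]]] := prime_el_divisor c0 cu; have [p0 pu _] := pp.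
have d0 : d != 0 by apply: contraNneq c0 => e'; rewrite ec e' mulr0.
have : cdiv p (F * G) by apply/cdivP; exists (d *: P); rewrite scalerA -ec.
move=> /(prime_el_poly pp)[/cdivP[F' eF]|h]; last by case: (pG p pp h).
apply: (IH d F') => //; first by rewrite -ltnS (leq_trans _ hn) // ltnS ec pmeasure_lt.
have pc0 : p%:P != 0 :> {poly {poly int}} by rewrite polyC_eq0.
by apply: (mulfI pc0); rewrite !mul_polyC scalerA -ec e eF scalerAl.
Qed.

(** A zero resultant makes [gcdp P Q] nonconstant in the outer variable. This gcd divides only up to
    scalars, but its primitive part divides both polynomials exactly and is the forbidden common
    factor. *)
Lemma resultant_neq0 P Q : P != 0 -> Q != 0 -> no_common_factor P Q ->
  resultant P Q != 0.
Proof.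
move=> P0 Q0 ncf; rewrite resultant_eq0 -leqNgt leqNgt; apply/negP => sg.
have g0 : gcdp P Q != 0 by rewrite gcdp_eq0 negb_and P0.
have [g [H [gn0 eH pH]]] := primitive_part g0.
have dvH (S : {poly {poly int}}) : gcdp P Q %| S -> exists S', S = S' * H.
  move=> /Pdiv.WeakIdomain.dvdpP[[a q] /= a0 e].
  by apply: (@primitive_dvd a S (g *: q) H) => //; rewrite e eH -scalerAr scalerAl.
have [P' eP] := dvH P (dvdp_gcdl _ _); have [Q' eQ] := dvH Q (dvdp_gcdr _ _).
have [c ec] := ncf H P' Q' eP eQ.
have : (size H <= 1)%N by rewrite ec size_polyC_leq1.
by rewrite leqNgt; case/negP; move: sg; rewrite eH size_scale.
Qed.

Lemma resultant_root P Q (X Y : int) : no_common_factor P Q ->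
  P.[Y%:P].[X] = 0 -> Q.[Y%:P].[X] = 0 -> root (resultant P Q) X.
Proof.
move=> ncf hP hQ.
(* If both degrees in the outer variable are zero, the Sylvester matrix is empty and the resultant
   is 1. But then ['X - X%:P] divides both polynomials, against [ncf]. *)
have [/andP[sP sQ]|] := boolP ((size P <= 1)%N && (size Q <= 1)%N).
  have fac (S : {poly {poly int}}) : (size S <= 1)%N -> S.[Y%:P].[X] = 0 ->
      exists S' : {poly {poly int}}, S = S' * ('X - X%:P)%:P.
    move=> /size1_polyC ->; rewrite hornerC => /rootP /factor_theorem[q ->].
    by exists q%:P; rewrite polyCM.
  have [P' eP] := fac P sP hP; have [Q' eQ] := fac Q sQ hQ.
  have [c /polyC_inj ec] := ncf _ _ _ eP eQ.
  by have := size_XsubC X; rewrite ec size_polyC; case: (c != 0).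
rewrite negb_and -!ltnNge => hsz.
pose d := ((size Q).-1 + (size P).-1)%N.
have d0 : (0 < d)%N by rewrite /d; case/orP: hsz; lia.
rewrite rootE /resultant -/(horner_eval X _) -det_map_mx -det_tr.
(* The Sylvester matrix specialized at [X] kills the vector of powers of [Y], even where leading
   coefficients vanish at [X]. *)
apply/det0P; exists (\row_(i < d) Y ^+ i).
  apply/eqP => /rowP /(_ (Ordinal d0)); rewrite !mxE expr0 => /eqP.
  by rewrite oner_eq0.
have key (S : {poly {poly int}}) (k m : nat) : S.[Y%:P].[X] = 0 -> (k + (size S).-1 < m)%N ->
    \sum_(j < m) Y ^+ j * (S`_(j - k) *+ (k <= j)%N).[X] = 0.
  move=> hS hm.
  transitivity ((('X^k * S)%R : {poly {poly int}}).[Y%:P].[X]); last first.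
    by rewrite hornerM hornerM hS mulr0.
  have sz : (size (('X^k * S)%R : {poly {poly int}}) <= m)%N.
    by rewrite (leq_trans (size_polyMleq _ _)) // size_polyXn; lia.
  rewrite (horner_coef_wide _ sz) horner_sum; apply: eq_bigr => j _.
  rewrite coefXnM ltnNge -polyC_exp hornerM hornerC mulrC.
  by case: leqP => _ /=; rewrite ?mulr1n ?mulr0n ?horner0.
apply/rowP => i; rewrite !mxE.
transitivity (\sum_(j < d) Y ^+ j * (Sylvester_mx P Q i j).[X]).
  by apply: eq_bigr => j _; rewrite !mxE.
under eq_bigr do rewrite Sylvester_mxE.
case: (fintype.split i) => k; apply: key => //.
  by rewrite /d ltn_add2r.
by rewrite /d addnC ltn_add2l.
Qed.

End GaussInt2.

(** * Exponents, weights and the numerical inequality *)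

Lemma numNE d : (2 * numN d = d.+1 * d.+2)%N.
Proof.
rewrite /numN mulnC divnK // dvdn2 oddM /=.
by case: (odd d).
Qed.

Lemma numNS d : (numN d.+1 = numN d + d.+2)%N.
Proof. have := numNE d; have := numNE d.+1; lia. Qed.

Lemma exponentsS d : exponents d.+1 =
  exponents d ++ [seq ((d.+1 - l)%N, l) | l <- iota 0 d.+2].
Proof.
have e : iota 0 d.+2 = iota 0 d.+1 ++ [:: d.+1] by rewrite -addn1 iotaD.
rewrite /exponents [in LHS]e map_cat flatten_cat; congr (_ ++ _); exact: cats0.
Qed.

Lemma size_exponents d : size (exponents d) = numN d.
Proof.
elim: d => [//|d IH]; by rewrite exponentsS size_cat IH size_map size_iota numNS.
Qed.

Lemma mem_exponents d p : (p \in exponents d) = (p.1 + p.2 <= d)%N.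
Proof.
elim: d => [|d IH].
  by case: p => -[|a] [|b].
rewrite exponentsS mem_cat IH; apply/idP/idP.
  case/orP => [|/mapP[l]]; first by lia.
  by rewrite mem_iota => hl -> /=; lia.
rewrite leq_eqVlt => /predU1P[e|]; last by rewrite ltnS => ->.
apply/orP; right; apply/mapP; exists p.2; first by rewrite mem_iota; lia.
by rewrite -e addnK; case: (p).
Qed.

Lemma uniq_exponents d : uniq (exponents d).
Proof.
elim: d => [//|d IH]; rewrite exponentsS cat_uniq IH andTb.
apply/andP; split; last by rewrite map_inj_uniq ?iota_uniq // => a b [].
apply/hasPn => p /mapP[l]; rewrite mem_iota => hl ->.
by rewrite mem_exponents /=; lia.
Qed.

Lemma expo_le d i : (i < numN d)%N -> ((expo d i).1 + (expo d i).2 <= d)%N.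
Proof. by move=> h; rewrite -mem_exponents mem_nth ?size_exponents. Qed.

Lemma expo_inj d (i j : 'I_(numN d)) : expo d i = expo d j -> i = j.
Proof.
move=> /eqP; rewrite nth_uniq ?size_exponents // ?uniq_exponents // => /eqP e.
exact: val_inj.
Qed.

Lemma sum_exponents d (F : nat * nat -> nat) :
  (\sum_(i < numN d) F (expo d i) = \sum_(p <- exponents d) F p)%N.
Proof. by rewrite (big_nth (0, 0)%N) size_exponents big_mkord. Qed.

(** The exponent averages [d / 3]; this is the source of the [d / 3] in the theorem. *)
Lemma sum_expo1 d : (3 * \sum_(i < numN d) (expo d i).1 = numN d * d)%N.
Proof.
rewrite (sum_exponents d (fun p => p.1)); elim: d => [|d IH].
  by rewrite muln0 /exponents /= big_seq1.
rewrite exponentsS big_cat big_map mulnDr IH /= numNS.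
have -> : (\sum_(l <- iota 0 d.+2) (d.+1 - l) = numN d.+1 - d.+2)%N.
  rewrite -[iota 0 d.+2]/(index_iota 0 d.+2) big_nat_rev /=.
  rewrite (eq_big_nat _ _ (F2 := fun l => l)); last by move=> l; lia.
  by have := numNE d.+1; have := bin2_sum d.+2; rewrite bin2; lia.
by have := numNE d; have := numNE d.+1; nia.
Qed.

Lemma sum_expo2 d : (3 * \sum_(i < numN d) (expo d i).2 = numN d * d)%N.
Proof.
rewrite (sum_exponents d (fun p => p.2)); elim: d => [|d IH].
  by rewrite muln0 /exponents /= big_seq1.
rewrite exponentsS big_cat big_map mulnDr IH /= numNS.
have -> : (\sum_(l <- iota 0 d.+2) l = numN d.+1 - d.+2)%N.
  rewrite -[iota 0 d.+2]/(index_iota 0 d.+2).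
  by have := numNE d.+1; have := bin2_sum d.+2; rewrite bin2; lia.
by have := numNE d; have := numNE d.+1; nia.
Qed.

Lemma numN_gt0 d : (0 < numN d)%N.
Proof. by have := numNE d; lia. Qed.

Lemma leq_numN d : (d.+1 <= numN d)%N.
Proof. by have := numNE d; nia. Qed.

Lemma numN_ge6 d : (1 < d)%N -> (6 <= numN d)%N.
Proof. by have := numNE d; nia. Qed.

Lemma sum_mxvec (V : nmodType) m n (F : 'I_(m * n) -> V) :
  \sum_j F j = \sum_(i < m) \sum_(k < n) F (mxvec_index i k).
Proof.
rewrite pair_bigA (reindex _ (curry_mxvec_bij m n)) /=.
by apply: eq_bigr => -[i k].
Qed.

Lemma sqrn_le_numN d : (d ^ 2 <= 3 * numN d)%N.
Proof. by have := numNE d; rewrite -mulnn; nia. Qed.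

Lemma double_le_numN d : (2 * d <= numN d)%N.
Proof. by have := numNE d; nia. Qed.

Section Weights.
Variable R : realType.

(* Up to factors exponential in [N], column [j] of the matrix of Algorithm 2 is
   of order [K ^ - col_weight j].  The last [N] columns really have weight [N],
   but only the smaller weight [g * phi_inv l] makes them harmless in the sum
   of the positive parts of [g * phi_inv l - col_weight j]. *)
Definition col_weight (N : nat) (g l : R) : 'rV[R]_(N * N + N) :=
  row_mx (mxvec (\matrix_(k1 < N, k2 < N) (k1%:R + g * k2%:R)))
         (const_mx (g * phi_inv l)).

(** In the left block, [g * phi_inv l] is the threshold below which lie about [N] weights. Over
    distinct columns, the differences between threshold and weight add up to at most the sum of all
    positive parts, which [sum_posp2] bounds. *)
Lemma sum_col_weight_ge (N : nat) (g l : R) (J : 'I_N -> 'I_(N * N + N)) :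
  1 <= l -> 0 < g -> N%:R = g * l -> injective J ->
  N%:R * (g * psi l) - N%:R <= \sum_i col_weight N g l 0 (J i).
Proof.
move=> l1 g0 Nl Ji; set e := col_weight N g l 0; set x := phi_inv l.
have h1 : \sum_i (g * x - e (J i)) <= N%:R * (g * (x - psi l) + 1).
  apply: (@le_trans _ _ (\sum_i posp (g * x - e (J i)))).
    by apply: ler_sum => i _; exact: posp_ge.
  apply: le_trans (sum_inj_le (h := fun c => posp (g * x - e c)) Ji _) _.
    by move=> c; exact: posp_ge0.
  rewrite big_split_ord /= [X in _ + X]big1 ?addr0 => [|i _]; last first.
    by rewrite /e /col_weight row_mxEr mxE subrr /posp lexx.
  rewrite sum_mxvec Nl; apply: le_trans (sum_posp2 N N l1 g0).
  apply: ler_sum => k1 _; apply: ler_sum => k2 _.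
  rewrite /e /col_weight row_mxEl mxvecE mxE -/x le_eqVlt; apply/orP; left.
  by apply/eqP; congr posp; ring.
move: h1; rewrite sumrB sumr_const card_ord -[X in X - _ <= _]mulr_natl.
move: (\sum_i _) => E; lra.
Qed.

Lemma leq_fact_exp n : (n`! <= n ^ n)%N.
Proof.
elim: n => // -[//|n] IH; rewrite factS expnS leq_mul2l (leq_trans IH) //.
by rewrite leq_exp2r.
Qed.

Lemma ln_nat_le n : ln (n%:R : R) <= n%:R.
Proof.
case: n => [|n]; first by rewrite ln0.
by rewrite ltW // ln_sublinear // ltr0n.
Qed.

Lemma ln2_le1 : ln (2 : R) <= 1.
Proof.
have -> : (2 : R) = 1 + 1 by ring.
by apply: le_ln1Dx; lra.
Qed.

Lemma lnX_nat n (x : R) : 0 < x -> ln (x ^+ n) = n%:R * ln x.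
Proof. by move=> x0; rewrite lnXn // mulr_natl. Qed.

Lemma ln_combine (n r t a64 ep a8 an y : R) :
  t + (a64 + ep + n * r) <= a8 + an -> a8 <= a64 -> an <= n -> n * - r <= y ->
  t <= n - ep + y.
Proof. by lra. Qed.

Lemma lnMpos (x y : R) : 0 < x -> 0 < y -> ln (x * y) = ln x + ln y.
Proof. by move=> x0 y0; rewrite lnM ?posrE. Qed.

(* Comparison of logarithms: the hypothesis [key] absorbs all the factors that
   are exponential in [N ^ 2]. *)
Lemma LLL_numeric (N d : nat) (tp Bm Lam kap P k gp L : R) :
  (6 <= N)%N -> (d <= N)%N -> 1 <= Bm -> 1 <= Lam -> 0 < kap -> kap <= 1 ->
  0 < tp -> 0 < P ->
  ln tp <= N%:R - d%:R * ln kap + N%:R * (ln Lam + k) ->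
  3 * ln P = N%:R * d%:R * L ->
  N%:R * (10 - ln kap + ln Bm + 2 * ln Lam) + d%:R / 3 * L <= (gp - 2) * k ->
  2 ^+ (N.+1 * N.-1) * (N`!%:R * (N * N + N)%:R ^+ N * P ^+ 2 *
    ((tp * (128 * Bm ^+ d * Lam ^+ N)) ^+ N *
       expR (- (k * (N%:R * gp - N%:R)))) ^+ 2) <=
  (tp / (N + N * N)%:R) ^+ 2 ^+ N.-1.
Proof.
move=> N6 dN Bm1 Lam1 kap0 kap1 tp0 P0 tple lnP key.
have Bm0 : 0 < Bm by lra.
have Lam0 : 0 < Lam by lra.
have N0 : (0 < N)%N by apply: leq_trans N6.
have NN0 : 0 < (N * N + N)%:R :> R by rewrite ltr0n addn_gt0 N0 orbT.
have f0 : 0 < N`!%:R :> R by rewrite ltr0n fact_gt0.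
rewrite (addnC N (N * N)%N).
have Z0 : 0 < tp * (128 * Bm ^+ d * Lam ^+ N).
  by rewrite mulr_gt0 // mulr_gt0 ?exprn_gt0 // mulr_gt0 ?exprn_gt0.
set Z := _ * (_ * Lam ^+ N) in Z0 *.
set E := expR _; have E0 : 0 < E by apply: expR_gt0.
rewrite -ler_ln ?posrE; last 2 first.
- by rewrite !mulr_gt0 ?exprn_gt0 // mulr_gt0 ?exprn_gt0.
- by rewrite !exprn_gt0 // divr_gt0.
have lnZ : ln Z = ln tp + (ln 128 + d%:R * ln Bm + N%:R * ln Lam).
  rewrite /Z !lnMpos ?lnX_nat ?mulr_gt0 ?exprn_gt0 //; ring.
have -> : ln (2 ^+ (N.+1 * N.-1) * (N`!%:R * (N * N + N)%:R ^+ N * P ^+ 2 *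
    (Z ^+ N * E) ^+ 2)) = (N.+1 * N.-1)%:R * ln 2 + (ln N`!%:R +
    N%:R * ln (N * N + N)%:R + 2 * ln P + 2 * (N%:R * ln Z - k * (N%:R * gp - N%:R))).
  have ZE : 0 < Z ^+ N * E by rewrite mulr_gt0 ?exprn_gt0.
  have fN : 0 < N`!%:R * (N * N + N)%:R ^+ N :> R by rewrite mulr_gt0 ?exprn_gt0.
  have fP : 0 < N`!%:R * (N * N + N)%:R ^+ N * P ^+ 2 by rewrite mulr_gt0 ?exprn_gt0.
  have two0 : 0 < (2 : R) by [].
  rewrite (lnMpos (exprn_gt0 _ two0)); last by rewrite mulr_gt0 ?exprn_gt0.
  rewrite (lnMpos fP); last by rewrite exprn_gt0.
  rewrite (lnMpos fN); last by rewrite exprn_gt0.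
  rewrite (lnMpos f0); last by rewrite exprn_gt0.
  rewrite !lnX_nat // (lnMpos (exprn_gt0 _ Z0) E0) lnX_nat //.
  by rewrite /E expRK; ring.
have -> : ln ((tp / (N * N + N)%:R) ^+ 2 ^+ N.-1) =
    N.-1%:R * (2 * (ln tp - ln (N * N + N)%:R)).
  by rewrite !lnX_nat ?ln_div ?posrE ?exprn_gt0 ?divr_gt0.
have nE : N.-1%:R = N%:R - 1 :> R by rewrite -[N in RHS](ltn_predK N0) -natr1; ring.
have nnE : (N.+1 * N.-1)%:R = (N%:R + 1) * (N%:R - 1) :> R by rewrite natrM nE natr1.
have hq : ln ((N * N + N)%:R : R) <= 2 * N%:R.
  have -> : (N * N + N)%:R = N%:R * (1 + N%:R) :> R by rewrite natrD natrM; ring.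
  have NR0 : 0 < N%:R :> R by rewrite ltr0n.
  rewrite lnMpos //.
  have := ln_nat_le N; have : ln (1 + N%:R : R) <= N%:R by apply: le_ln1Dx; lra.
  lra.
have hf : ln (N`!%:R : R) <= N%:R * N%:R.
  apply: (@le_trans _ _ (ln (N%:R ^+ N))).
    have h : N`!%:R <= N%:R ^+ N :> R by rewrite -natrX ler_nat leq_fact_exp.
    by rewrite ler_ln // posrE exprn_gt0 // ltr0n.
  by rewrite lnX_nat ?ltr0n // ler_wpM2l // ln_nat_le.
have h128 : ln (128 : R) <= 7.
  have -> : (128 : R) = 2 ^+ 7 by ring.
  by rewrite lnX_nat //; have := ln2_le1; lra.
have h2 := ln2_le1.
have hp : ln kap <= 0 by apply: ln_le0.
have hb : 0 <= ln Bm by apply: ln_ge0.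
have hl : 0 <= ln Lam by apply: ln_ge0.
have n6 : 6 <= N%:R :> R by rewrite ler_nat.
have dn : d%:R <= N%:R :> R by rewrite ler_nat.
have d0 : 0 <= d%:R :> R by [].
rewrite nE nnE lnZ.
move: (ln (N * N + N)%:R) (ln N`!%:R) hq hf => q ft hq hf.
move: (ln 128) (ln 2) h128 h2 => l128 l2 h128 h2.
move: tple lnP key; move: (ln tp) (ln P) => t lp tple lnP key.
move: tple lnP key.
move: (ln kap) (ln Bm) (ln Lam) hp hb hl => p b l hp hb hl.
move: (N%:R) (d%:R) n6 dn d0 hq hf => n e n6 dn d0 hq hf tple lnP key.
clear -n6 dn d0 hq hf tple lnP key hp hb hl h128 h2.
(* In [gp - 2], one [k] is the loss in the sum of weights. The other comes from [tp], of order
   [expR (n * k)], which has exponent [2 * n] on the left and only [2 * (n - 1)] on the right. *)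
have k1 : n * (2 * n) * (10 - p + b + 2 * l) + 2 * n * (e / 3 * L) <= 2 * n * ((gp - 2) * k).
  have n0 : 0 <= 2 * n by lra.
  have := ler_wpM2l n0 key; lra.
have k2 : 2 * lp = 2 * n * (e / 3 * L) by lra.
have g1 : (n + 1) * (n - 1) * l2 <= n * n.
  have : (n + 1) * (n - 1) * l2 <= (n + 1) * (n - 1) * 1.
    by rewrite ler_wpM2l // mulr_ge0 //; lra.
  lra.
have g2 : (3 * n - 2) * q <= (3 * n - 2) * (2 * n) by rewrite ler_wpM2l //; lra.
have g3 : 2 * n * l128 <= 2 * n * 7 by rewrite ler_wpM2l //; lra.
have g4 : 2 * n * (e * b) <= 2 * n * (n * b).
  by rewrite ler_wpM2l // ?ler_wpM2r //; lra.
have g5 : - (e * p) <= - (n * p).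
  by rewrite -!mulrN ler_wpM2r //; lra.
have g6 : - (n * p) <= - (n * n * p).
  rewrite -!mulrN ler_wpM2r //; [lra | nra].
have g7 : n * l <= n * n * l by rewrite ler_wpM2r //; nra.
have g8 : 2 * n + 14 * n <= 4 * (n * n) by nra.
nra.
Qed.

End Weights.

(** * Ellipses *)

Section ApxMore.
Variables (R : realType) (s1 s2 : R).
Hypotheses (s1_ge1 : 1 <= s1) (s2_ge1 : 1 <= s2).
Implicit Types (h g : R -> R -> R).

Lemma apx_lim B h : (forall e, 0 < e -> exists2 g, apx s1 s2 B g &
    forall y t, -1 <= y <= 1 -> -1 <= t <= 1 -> `|h y t - g y t| <= e) ->
  apx s1 s2 B h.
Proof.
move=> H e e0; have e20 : 0 < e / 2 by rewrite divr_gt0.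
have [g Hg hg] := H _ e20; have [s [ns hs]] := Hg _ e20.
exists s; split=> // y t hy ht.
rewrite -[h y t](subrK (g y t)) -addrA (le_trans (ler_normD _ _)) // [e]splitr.
by rewrite lerD ?hg ?hs.
Qed.

Lemma apx_sum n (B : nat -> R) (g : nat -> R -> R -> R) :
  (forall j, apx s1 s2 (B j) (g j)) ->
  apx s1 s2 (\sum_(j < n) B j) (fun y t => \sum_(j < n) g j y t).
Proof.
move=> H; elim: n => [|n IH].
  rewrite big_ord0; have := @apx_cst R s1 s2 0; rewrite normr0.
  by apply: eq_apx => y t _ _; rewrite big_ord0.
rewrite big_ord_recr /=; have := apx_add IH (H n); apply: eq_apx => y t _ _.
by rewrite big_ord_recr.
Qed.

Lemma apx_expansion (f : R[i] -> R[i]) m0 r B h :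
  expansion f m0 r B -> 0 <= r ->
  apx s1 s2 r (fun y t => h y t - m0) ->
  apx s1 s2 B (fun y t => real_part f (h y t)).
Proof.
move=> [_ H] r0 Hh; apply: apx_lim => e /H[n [c [hc he]]].
exists (fun y t => \sum_(j < n) c j * (h y t - m0) ^+ j); last first.
  by move=> y t hy ht; apply/he/(apx_sup s1_ge1 s2_ge1 Hh).
apply: apx_le hc _.
apply: (@apx_sum n (fun j => `|c j| * r ^+ j) (fun j y t => c j * (h y t - m0) ^+ j)).
move=> j; apply: apx_mul => //; first exact: apx_cst.
exact: apx_exp.
Qed.

End ApxMore.

Section Ellipse.
Variable R : realType.
Local Notation nc := (@Normc.normc R).

Lemma nc_expi (t : R) : nc (expi t) = 1.
Proof. by rewrite /expi /Normc.normc cos2Dsin2 sqrtr1. Qed.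

Lemma nc_realM (x : R) z : nc (x%:C * z) = `|x| * nc z.
Proof. by rewrite Normc.normcM nc_real. Qed.

Lemma ellipse_region_dist (rho a b : R) z : a <= b -> 1 <= rho ->
  ellipse_region rho a b z -> nc (z - ((a + b) / 2)%:C) <= (b - a) / 2 * rho.
Proof.
move=> ab r1 [th [r [_ /andP[r0 r1'] ->]]].
have rho0 : 0 < rho by lra.
rewrite addrAC subrr add0r nc_realM ger0_norm // /ellipse_pt addrK nc_realM.
rewrite ger0_norm; last by lra.
set E := nc _; have hE : E <= rho.
  rewrite /E Normc.normcM Normc.normcV.
  have -> : nc (2 : R[i]) = 2.
    have -> : (2 : R[i]) = (2 : R)%:C by rewrite rmorph_nat.
    by rewrite nc_real ger0_norm.
  rewrite ler_pdivrMr // (le_trans (le_normcD _ _)) // !nc_realM !nc_expi !mulr1.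
  rewrite !ger0_norm ?invr_ge0 ?(ltW rho0) //.
  have : rho^-1 <= 1 by rewrite invf_le1.
  lra.
have E0 : 0 <= E by apply: nc_ge0.
have ba : 0 <= (b - a) / 2 by lra.
apply: (@le_trans _ _ (1 * ((b - a) / 2 * E))).
  by rewrite ler_wpM2r // mulr_ge0.
by rewrite mul1r ler_wpM2l.
Qed.

(** The two real vertices are [2 * A] apart, so one of them is at least [A] away from [- c]. This
    bounds the maxima in [alg2_R] from below, hence the precision from above. *)
Lemma ellipse_region_far (rho a b : R) (c : R[i]) : a <= b -> 1 <= rho ->
  exists2 z, ellipse_region rho a b z & (b - a) / 4 * rho <= nc (z + c).
Proof.
move=> ab r1; have rho0 : 0 < rho by lra.
pose A : R := (b - a) / 2 * ((rho + rho^-1) / 2).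
have hA : (b - a) / 4 * rho <= A.
  have ri : 0 < rho^-1 by rewrite invr_gt0.
  have : 0 <= (b - a) / 4 * rho^-1 by rewrite mulr_ge0 ?(ltW ri) //; lra.
  by rewrite /A; lra.
pose M := (a + b) / 2.
have mem (th : R) (e : R) : 0 <= th <= 2 * pi -> expi th = e%:C -> expi (- th) = e%:C ->
    ellipse_region rho a b (M + e * A)%:C.
  move=> hth e1 e2; exists th, 1; split=> //; first by rewrite ler01 lexx.
  rewrite mul1r /ellipse_pt e1 e2 -/M addrK rmorphD /=; congr (_ + _).
  have -> : (2 : R[i]) = (2 : R)%:C by rewrite rmorph_nat.
  rewrite -!rmorphM -rmorphD -fmorphV -!rmorphM; congr (_%:C).
  by rewrite /A; field; rewrite lt0r_neq0.
have p0 := pi_gt0 R.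
have z1 : ellipse_region rho a b (M + 1 * A)%:C.
  apply: (mem 0); first by apply/andP; split; lra.
    by rewrite /expi cos0 sin0.
  by rewrite /expi oppr0 cos0 sin0.
have z2 : ellipse_region rho a b (M + (-1) * A)%:C.
  apply: (mem pi); first by apply/andP; split; lra.
    by rewrite /expi cospi sinpi.
  by rewrite /expi cosN sinN cospi sinpi oppr0.
have h2 : 2 * A <= nc ((M + 1 * A)%:C + c) + nc ((M + (-1) * A)%:C + c).
  have A0 : 0 <= A by apply: le_trans hA; rewrite mulr_ge0 //; lra.
  have -> : 2 * A = nc (2 * A)%:C by rewrite nc_real ger0_norm // mulr_ge0.
  have -> : (2 * A)%:C = ((M + 1 * A)%:C + c) - ((M + (-1) * A)%:C + c).
    by rewrite opprD addrACA subrr addr0 -rmorphB; congr (_%:C); ring.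
  by rewrite (le_trans (le_normcD _ _)) // normcN.
have [h|h] := leP A (nc ((M + 1 * A)%:C + c)).
  by exists (M + 1 * A)%:C => //; exact: le_trans hA h.
exists (M + (-1) * A)%:C => //; apply: le_trans hA _; lra.
Qed.

End Ellipse.

(** * One call of Algorithm 2 *)

Lemma expr2_ceil (R : realType) (x : R) :
  2 `^ x <= (2 : R) ^ Num.ceil x <= 2 * 2 `^ x.
Proof.
rewrite -powR_intmul //; have /andP[h1 h2] := Num.Theory.ceil_itv x.
rewrite ler_powR ?h2 ?ler1n //=.
have -> : 2 * 2 `^ x = 2 `^ (1 + x) :> R.
  by rewrite powRD ?pnatr_eq0 ?implybT // powRr1.
rewrite ler_powR ?ler1n //; move: h1; rewrite intrB; lra.
Qed.

Lemma eval2_alg2_P (R : realType) (I : input R) (U : 'M[int]_(numN (in_d I))) r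
    (x y : R) :
  eval2 (alg2_P U r) x y =
  \sum_(i < numN (in_d I)) (nth_row U r 0 i)%:~R *
    (x ^+ (expo (in_d I) i).1 * y ^+ (expo (in_d I) i).2).
Proof.
rewrite /eval2 -[fun q : {poly int} => _]/(horner_eval x \o map_poly intr) /alg2_P.
rewrite rmorph_sum horner_sum; apply: eq_bigr => i _.
rewrite rmorphM /= map_polyC map_polyXn hornerM hornerC hornerXn /= mulrA.
congr (_ * _); rewrite /horner_eval linearZ_LR /=.
by rewrite map_polyXn hornerZ hornerXn.
Qed.

Section Round.
Variable R : realType.
Implicit Types x : R.

Lemma round0_0 : round0 (0 : R) = 0.
Proof. by rewrite /round0 lexx floor0. Qed.

Lemma round0_dist x : `|x - (round0 x)%:~R| <= 1.
Proof.
rewrite /round0; case: ifP => _.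
  have := Num.Theory.floor_le x; have := floorD1_gt x; rewrite intrD => h1 h2.
  by rewrite ler_norml; lra.
have /andP[] := Num.Theory.ceil_itv x; rewrite intrB => h1 h2.
by rewrite ler_norml; lra.
Qed.

Lemma round0_le x : `|(round0 x)%:~R : R| <= `|x|.
Proof.
rewrite /round0; case: ifPn => [x0|]; last rewrite -ltNge => x0.
  rewrite (ger0_norm x0) ger0_norm ?Num.Theory.floor_le //.
  by rewrite ler0z floor_ge0.
rewrite (ltr0_norm x0) ler0_norm; last by rewrite lerz0 ceil_le0 ltW.
by rewrite lerN2 Num.Theory.ceil_ge.
Qed.

End Round.

Section OneCall.
Variables (R : realType) (f : R[i] -> R[i]) (a1 b1 w theta s B Qz m0 r0 : R).
Variables (d u v : nat).
Local Notation nc := (@Normc.normc R).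
Local Notation N := (numN d).
(** When [[a1, b1]] is scaled to [[-1, 1]], the radius [s] becomes [sg]; for [t] the radius 1
    becomes [w]. The ellipses use these radii divided by [theta], which puts a factor [theta ^+ N]
    between the entries of [alg2_A2] and the interpolation error. *)
Local Notation sg := (2 * s / (b1 - a1)).
Local Notation I := (Input f a1 b1 (- w^-1) w^-1 (sg / theta) (w / theta) d N N u v).
Local Notation nu := ((sg / theta) ^- N + (w / theta) ^- N).
Local Notation Bm := (Qz * (B + 1)).
Local Notation kap := (Num.min s 1 / (2 * theta)).
Local Notation monuv i := (u%:R ^+ (expo d i).1 * v%:R ^+ (expo d i).2 : R).

Hypotheses (ab : a1 < b1) (s0 : 0 < s) (B1 : 1 <= B) (Q1 : 1 <= Qz)
  (theta2 : 2 <= theta) (sg_ge : 2 * theta <= sg) (w_ge : 2 * theta <= w)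
  (d2 : (1 < d)%N) (u0 : (0 < u)%N) (v0 : (0 < v)%N).
Hypothesis center : `|(a1 + b1) / 2 - m0| + s <= r0.
Hypothesis f_exp : expansion f m0 r0 B.
Hypothesis Qz_ge : `|(a1 + b1) / 2| + s <= Qz.
Hypothesis theta_large : (1 + 4 * (N * N)%:R) * Bm ^+ d <= 64 * kap ^+ d * theta ^+ N.

Let d0 : (0 < d)%N. Proof. exact: ltnW. Qed.
Let ba0 : 0 < b1 - a1. Proof. by rewrite subr_gt0. Qed.
Let th0 : 0 < theta. Proof. exact: lt_le_trans theta2. Qed.
Let w0 : 0 < w. Proof. by apply: lt_le_trans w_ge; rewrite mulr_gt0. Qed.
Let sg0 : 0 < sg. Proof. by rewrite divr_gt0 ?mulr_gt0. Qed.
Let w1 : 1 <= w.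
Proof. by apply: le_trans w_ge; move: theta2; lra. Qed.
Let sg1 : 1 <= sg.
Proof. by apply: le_trans sg_ge; move: theta2; lra. Qed.
Let rho1_ge : 2 <= sg / theta. Proof. by rewrite ler_pdivlMr. Qed.
Let rho2_ge : 2 <= w / theta. Proof. by rewrite ler_pdivlMr. Qed.
Let N0 : (0 < N)%N. Proof. exact: numN_gt0. Qed.
Let dN : (d <= N)%N. Proof. exact: ltnW (leq_numN d). Qed.
Let winv : - w^-1 < w^-1. Proof. by have : 0 < w^-1; [rewrite invr_gt0 | lra]. Qed.
Let s_half : (b1 - a1) / 2 * sg = s.
Proof. by field; rewrite lt0r_neq0. Qed.
Let rho1_radius : (b1 - a1) / 2 * (sg / theta) = s / theta.
Proof. by rewrite mulrA s_half. Qed.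
Let s_theta : s / theta <= s / 2.
Proof. by rewrite ler_pM2l // lef_pV2 ?posrE. Qed.

Let E1_dist z : ellipse_region (sg / theta) a1 b1 z ->
  nc (z - ((a1 + b1) / 2)%:C) <= s / 2.
Proof.
move=> /ellipse_region_dist h; apply: le_trans (h (ltW ab) _) _.
  by move: rho1_ge; lra.
by rewrite rho1_radius.
Qed.

Let E1_r0 z : ellipse_region (sg / theta) a1 b1 z -> nc (z - m0%:C) < r0.
Proof.
move=> /E1_dist h; apply: lt_le_trans center.
have -> : z - m0%:C = ((a1 + b1) / 2 - m0)%:C + (z - ((a1 + b1) / 2)%:C).
  by rewrite rmorphB; ring.
apply: le_lt_trans (le_normcD _ _) _; rewrite nc_real ltrD2l.
apply: le_lt_trans h _; move: s0; lra.
Qed.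

Let E2_dist z : ellipse_region (w / theta) (- w^-1) w^-1 z -> nc z <= 1.
Proof.
move=> /ellipse_region_dist h.
have -> : z = z - ((- w^-1 + w^-1) / 2)%:C by rewrite addNr mul0r subr0.
apply: le_trans (h (ltW winv) _) _; first by move: rho2_ge; lra.
have -> : (w^-1 - - w^-1) / 2 * (w / theta) = theta^-1.
  by field; rewrite !lt0r_neq0.
by rewrite invf_le1 //; move: theta2; lra.
Qed.

Let fz_le z1 z2 : ellipse_region (sg / theta) a1 b1 z1 ->
  ellipse_region (w / theta) (- w^-1) w^-1 z2 -> nc (f z1 + z2) <= B + 1.
Proof.
move=> /E1_r0 h1 /E2_dist h2; apply: le_trans (le_normcD _ _) _; rewrite lerD //.
by have [_] := f_exp.1 z1 (ltW h1).
Qed.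

Let z_le z : ellipse_region (sg / theta) a1 b1 z -> nc z <= Qz.
Proof.
move=> /E1_dist h; apply: le_trans Qz_ge.
rewrite -[z](subrK ((a1 + b1) / 2)%:C) addrC (le_trans (le_normcD _ _)) // nc_real.
rewrite lerD2l (le_trans h) //; move: s0; lra.
Qed.

Lemma max_z_bounds : kap <= max_z I <= Qz.
Proof.
rewrite /max_z /=.
have [z hz far] := @ellipse_region_far R (sg / theta) a1 b1 0 (ltW ab)
   (le_trans (ler1n _ 2) rho1_ge).
have ubs : ubound [set nc z | z in ellipse_region (sg / theta) a1 b1] Qz.
  by move=> _ [z' hz' <-]; exact: z_le.
apply/andP; split; last by apply: ge_sup => //; exists (nc z), z.
apply: le_trans (ub_le_sup _ (_ : _ (nc z))); last 2 first.
- by exists Qz.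
- by exists z.
rewrite addr0 in far; apply: le_trans far.
have -> : (b1 - a1) / 4 * (sg / theta) = s / (2 * theta).
  by rewrite (_ : (b1 - a1) / 4 * (sg / theta) = (b1 - a1) / 2 * (sg / theta) / 2);
    [rewrite rho1_radius; field; rewrite lt0r_neq0 | field; rewrite !lt0r_neq0].
by rewrite ler_pM2r ?invr_gt0 ?mulr_gt0 // ge_min lexx.
Qed.

Lemma max_fz_bounds : kap <= max_fz I <= B + 1.
Proof.
rewrite /max_fz /=.
have [z1 hz1 _] := @ellipse_region_far R (sg / theta) a1 b1 0 (ltW ab)
   (le_trans (ler1n _ 2) rho1_ge).
have [z2 hz2 far] := @ellipse_region_far R (w / theta) (- w^-1) w^-1 (f z1) (ltW winv)
   (le_trans (ler1n _ 2) rho2_ge).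
set E := (X in sup X).
have ubs : ubound E (B + 1).
  by move=> _ [[z1' z2'] [/= h1 h2] <-]; exact: fz_le.
have mem : E (nc (f z1 + z2)) by exists (z1, z2).
apply/andP; split; last by apply: ge_sup => //; exists (nc (f z1 + z2)).
apply: le_trans (ub_le_sup _ mem); last by exists (B + 1).
rewrite [f z1 + _]addrC; apply: le_trans far.
have -> : (w^-1 - - w^-1) / 4 * (w / theta) = 1 / (2 * theta).
  by field; rewrite !lt0r_neq0.
by rewrite ler_pM2r ?invr_gt0 ?mulr_gt0 // ge_min lexx orbT.
Qed.

Let kap0 : 0 < kap.
Proof. by rewrite divr_gt0 ?mulr_gt0 // lt_min s0 ltr01. Qed.
Let kap_le1 : kap <= 1.
Proof.
rewrite ler_pdivrMr ?mulr_gt0 // mul1r ge_min; apply/orP; right.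
by move: theta2; lra.
Qed.
Let nu0 : 0 < nu.
Proof. by rewrite addr_gt0 // invr_gt0 exprn_gt0 // divr_gt0. Qed.
Let monuv_ge1 i : 1 <= monuv i.
Proof. by rewrite mulr_ege1 // exprn_ege1 // ler1n. Qed.
Let Bm1 : 1 <= Bm.
Proof. by rewrite mulr_ege1 //; move: B1; lra. Qed.

Let pow_le (x y z : R) (k l : nat) : 0 <= x -> x <= z -> 0 <= y -> y <= z -> 1 <= z ->
  (k + l <= d)%N -> x ^+ k * y ^+ l <= z ^+ d.
Proof.
move=> x0 xz y0 yz z1 kl; apply: le_trans (ler_weXn2l z1 kl).
by rewrite exprD ler_pM ?exprn_ge0 // lerXn2r // nnegrE // (le_trans ler01).
Qed.

Lemma alg2_R_bounds (i : 'I_N) :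
  64 * monuv i * kap ^+ d * nu <= alg2_R I i <= 64 * monuv i * Bm ^+ d * nu.
Proof.
have /andP[z1 z2] := max_z_bounds; have /andP[f1 f2] := max_fz_bounds.
have kl := expo_le (ltn_ord i).
rewrite /alg2_R /= -/N; set k := (expo d i).1 in kl *; set l := (expo d i).2 in kl *.
have -> : 64 * u%:R ^+ k * v%:R ^+ l * max_z I ^+ k * max_fz I ^+ l * nu =
  64 * (u%:R ^+ k * v%:R ^+ l) * (max_z I ^+ k * max_fz I ^+ l) * nu by ring.
have c0 : 0 < 64 * (u%:R ^+ k * v%:R ^+ l) :> R.
  by rewrite mulr_gt0 // mulr_gt0 // exprn_gt0 // ltr0n.
rewrite !ler_pM2r // !ler_pM2l //; apply/andP; split.
  apply: (@le_trans _ _ (kap ^+ (k + l))).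
    by rewrite ler_wiXn2l // ltW.
  by rewrite exprD ler_pM ?exprn_ge0 ?(ltW kap0) // lerXn2r // nnegrE
     ?(ltW kap0) // (le_trans (ltW kap0)).
apply: pow_le => //; try exact: le_trans (ltW kap0) _.
- by apply: le_trans z2 _; rewrite ler_peMr ?(le_trans ler01) //; move: B1; lra.
- by apply: le_trans f2 _; rewrite ler_peMl //; move: B1; lra.
Qed.

Lemma valid_call : 64 * nu * v%:R * (B + 1) < 1 -> valid_input I.
Proof.
move=> nu_small; split=> /=.
- by split.
- exists [set z : R[i]^o | ball (m0%:C : R[i]^o) r0%:C z]; split.
  + exact: ball_open.
  + move=> z /E1_r0 hz /=; rewrite -ball_normE /= distrC ncE ltcR.
    exact: hz.
  + move=> z /=; rewrite -ball_normE /= distrC ncE ltcR => /ltW hz.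
    by have [] := f_exp.1 z hz.
- by rewrite d0 u0 v0.
- have N1 : (1 < N)%N := leq_ltn_trans d0 (leq_numN d).
  by split=> //; rewrite N1 leq_pmulr.
- have /andP[f1 f2] := max_fz_bounds; apply: le_lt_trans nu_small.
  by rewrite ler_pM2l // mulr_gt0 ?ltr0n // mulr_gt0.
Qed.

Let r0_ge0 : 0 <= r0.
Proof. by apply: le_trans center; rewrite addr_ge0 // ltW. Qed.

Lemma basis_apx (i : 'I_N) : apx sg w (monuv i * Bm ^+ d)
  (fun y t => basis_fun I (expo d i).1 (expo d i).2 (aff a1 b1 y) (aff (- w^-1) w^-1 t)).
Proof.
have kl := expo_le (ltn_ord i).
set k := (expo d i).1 in kl *; set l := (expo d i).2 in kl *.
have hlin c : apx sg w (s + `|c|) (fun y _ => (b1 - a1) / 2 * y + c).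
  have := apx_add (@apx_term R sg w ((b1 - a1) / 2) 1%N 0%N) (apx_cst sg w c).
  rewrite expr1 expr0 mulr1 ger0_norm ?s_half; last by rewrite divr_ge0 // ltW.
  by apply: eq_apx => y t _ _; rewrite expr1 mulr1.
have hx : apx sg w Qz (fun y _ => aff a1 b1 y).
  by apply: apx_le (hlin _); rewrite addrC.
have hx0 : apx sg w r0 (fun y _ => aff a1 b1 y - m0).
  apply: (@apx_le R sg w (s + `|(a1 + b1) / 2 - m0|)); first by rewrite addrC.
  by apply: eq_apx (hlin _) => y t _ _; rewrite /aff addrA.
have hf : apx sg w B (fun y _ => real_part f (aff a1 b1 y)).
  exact: (apx_expansion sg1 w1 f_exp r0_ge0 hx0).
have ht : apx sg w 1 (fun _ t => aff (- w^-1) w^-1 t).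
  have := @apx_term R sg w w^-1 0%N 1%N.
  rewrite expr1 expr0 mul1r ger0_norm ?invr_ge0 ?(ltW w0) // mulVf ?lt0r_neq0 //.
  apply: eq_apx => y t _ _; rewrite /aff expr1 mul1r addNr mul0r addr0.
  by congr (_ * _); field; rewrite lt0r_neq0.
have := apx_mul sg1 w1 (apx_cst sg w (monuv i))
  (apx_mul sg1 w1 (apx_exp sg1 w1 k hx) (apx_exp sg1 w1 l (apx_add hf ht))).
move=> H; apply: (@apx_le R sg w _ (monuv i * Bm ^+ d)) (eq_apx _ H).
  rewrite ger0_norm ?(le_trans ler01) // ler_wpM2l ?(le_trans ler01) //.
  apply: pow_le => //; rewrite ?(le_trans ler01) //.
  - by rewrite ler_peMr ?(le_trans ler01) //; move: B1; lra.
  - by move: B1; lra.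
  - by rewrite ler_peMl //; move: B1; lra.
by move=> y t _ _; rewrite /basis_fun /= -/k -/l !exprMn; ring.
Qed.

Lemma alg2_A1E (i : 'I_N) (k1 k2 : 'I_N) : alg2_A1 I i (mxvec_index k1 k2) =
  cheb_coef2 N N (fun y t => basis_fun I (expo d i).1 (expo d i).2
    (aff a1 b1 y) (aff (- w^-1) w^-1 t)) k1 k2.
Proof. by rewrite mxE mxvecE interp_coefsE // mxE. Qed.

Lemma alg2_A1_le (i : 'I_N) (k1 k2 : 'I_N) :
  `|alg2_A1 I i (mxvec_index k1 k2)| <= 4 * (monuv i * Bm ^+ d / (sg ^+ k1 * w ^+ k2)).
Proof. by rewrite alg2_A1E; apply: apx_coef (basis_apx i). Qed.

(** [T] lists the values at the point of the products of two Chebyshev polynomials. *)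
Lemma alg2_A1_err x t : a1 <= x <= b1 -> - w^-1 <= t <= w^-1 ->
  exists T : 'I_(N * N) -> R, (forall j, `|T j| <= 1) /\
    forall i : 'I_N, `|basis_fun I (expo d i).1 (expo d i).2 x t -
      \sum_j alg2_A1 I i j * T j| <= alg2_R I i.
Proof.
move=> hx ht; have [y hy ->] := aff_itv ab hx; have [q hq ->] := aff_itv winv ht.
exists (fun j => mxvec (\matrix_(k1 < N, k2 < N) ((cheb R k1).[y] * (cheb R k2).[q])) 0 j).
split=> [j|i].
  case/mxvec_indexP: j => k1 k2; rewrite mxvecE mxE normrM.
  by rewrite mulr_ile1 ?cheb_le1.
rewrite sum_mxvec.
have -> : \sum_(k1 < N) \sum_(k2 < N) alg2_A1 I i (mxvec_index k1 k2) *
    mxvec (\matrix_(k1 < N, k2 < N) ((cheb R k1).[y] * (cheb R k2).[q])) 0 (mxvec_index k1 k2) =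
    cheb_interp N N (fun y t => basis_fun I (expo d i).1 (expo d i).2
    (aff a1 b1 y) (aff (- w^-1) w^-1 t)) y q.
  apply: eq_bigr => k1 _; apply: eq_bigr => k2 _.
  by rewrite alg2_A1E mxvecE mxE mulrA.
apply: le_trans (apx_interp sg1 w1 N N (basis_apx i) hy hq) _.
have /andP[h _] := alg2_R_bounds i; apply: le_trans h.
(* By [theta_large], the factor [theta ^+ N] pays for the norm of the interpolation operator and for
   the gap between [Bm ^+ d] and [kap ^+ d]. *)
have -> : nu = theta ^+ N * (sg ^- N + w ^- N).
  by rewrite !expr_div_n !invf_div mulrDr.
have q0 : 0 < sg ^- N + w ^- N by rewrite addr_gt0 // invr_gt0 exprn_gt0.
have m0' : 0 < monuv i by apply: lt_le_trans (monuv_ge1 i).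
have -> : (1 + 4 * (N * N)%:R) * (monuv i * Bm ^+ d * (sg ^- N + w ^- N)) =
  monuv i * (sg ^- N + w ^- N) * ((1 + 4 * (N * N)%:R) * Bm ^+ d) by ring.
have -> : 64 * monuv i * kap ^+ d * (theta ^+ N * (sg ^- N + w ^- N)) =
  monuv i * (sg ^- N + w ^- N) * (64 * kap ^+ d * theta ^+ N) by ring.
by rewrite (ler_pM2l (mulr_gt0 m0' q0)).
Qed.

Local Notation minR := (\big[Num.min/alg2_R I 0]_(i < N) alg2_R I i).

Let R_gt0 (i : 'I_N) : 0 < alg2_R I i.
Proof.
have /andP[h _] := alg2_R_bounds i; apply: lt_le_trans h.
have m0' : 0 < monuv i by apply: lt_le_trans (monuv_ge1 i).
by rewrite mulr_gt0 // mulr_gt0 ?exprn_gt0 // mulr_gt0.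
Qed.

Lemma minR_bounds : 64 * kap ^+ d * nu <= minR.
Proof.
have h (i : 'I_N) : 64 * kap ^+ d * nu <= alg2_R I i.
  have /andP[h _] := alg2_R_bounds i; apply: le_trans h.
  rewrite ler_pM2r // ler_pM2r ?exprn_gt0 // ler_peMr // monuv_ge1.
by apply: le_bigmin => [|i _]; [exact: (h (Ordinal N0)) | exact: h].
Qed.

(** Before rounding up, the power of 2 is [N / minR]; the ceiling costs a factor at most 2, and the
    final [+ 2] in [tprec] contributes a factor 4. *)
Lemma tprec_bounds :
  [/\ 0 < minR, 4 * N%:R <= (2 : R) ^ tprec I * minR
    & (2 : R) ^ tprec I * minR <= 8 * N%:R].
Proof.
have fin (p q n : R) : 0 < q -> n <= p * q -> p * q <= 2 * n ->
    [/\ 0 < q, 4 * n <= p * 4 * q & p * 4 * q <= 8 * n].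
  by move=> ? ? ?; split=> //; lra.
have m0' : 0 < minR.
  by apply: lt_le_trans minR_bounds; rewrite !mulr_gt0 // exprn_gt0.
have NR : 0 < N%:R :> R by rewrite ltr0n.
rewrite /tprec /= expfzDr ?pnatr_eq0 //.
set y : R := - log2 _ + log2 _.
have ey : 2 `^ y = N%:R / minR.
  rewrite /powR pnatr_eq0 /= /y /log2 mulrDl mulNr !divfK; last 2 first.
  - by rewrite lt0r_neq0 // ln_gt0 // ltr1n.
  - by rewrite lt0r_neq0 // ln_gt0 // ltr1n.
  by rewrite expRD expRN !lnK ?posrE // mulrC.
have /andP[h1 h2] := expr2_ceil y; rewrite ey in h1 h2.
have e4 : (2 : R) ^ (2 : int) = 4 by rewrite -[LHS]/(2 ^+ 2); ring.
have h3 : N%:R <= (2 : R) ^ Num.ceil y * minR by rewrite -ler_pdivrMr.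
have h4 : (2 : R) ^ Num.ceil y * minR <= 2 * N%:R.
  apply: le_trans (ler_wpM2r (ltW m0') h2) _.
  have -> : 2 * (N%:R / minR) * minR = 2 * (N%:R / minR * minR) by ring.
  by rewrite divfK // lt0r_neq0.
rewrite e4; exact: fin.
Qed.

Local Notation tp := ((2 : R) ^ tprec I).
Local Notation Mr := (map_mx intr (alg2_M I) : 'M[R]_(N, N * N + N)).

Let tp0 : 0 < tp. Proof. by rewrite exprz_gt0. Qed.

Let NR0 : 0 < N%:R :> R. Proof. by rewrite ltr0n. Qed.

Let M_l (i : 'I_N) (j : 'I_(N * N)) :
  alg2_M I i (lshift N j) = round0 (tp * alg2_A1 I i j).
Proof. by rewrite 2!mxE row_mxEl. Qed.

Let M_r (i j : 'I_N) :
  alg2_M I i (rshift (N * N) j) = if i == j then round0 (tp * alg2_R I i) else 0.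
Proof.
rewrite 2!mxE row_mxEr !mxE; case: eqP => _.
  by rewrite mulr1n.
by rewrite mulr0n mulr0 round0_0.
Qed.

Let tpR (i : 'I_N) : 4 * N%:R <= tp * alg2_R I i.
Proof.
have [_ h _] := tprec_bounds; apply: le_trans h _; rewrite ler_pM2l //.
exact: (bigmin_le (alg2_R I 0) i).
Qed.

Let Dg i : R := (round0 (tp * alg2_R I i))%:~R.

Let Dg_bounds (i : 'I_N) : 3 * N%:R <= Dg i /\ tp * alg2_R I i <= Dg i + 1.
Proof.
have := round0_dist (tp * alg2_R I i); rewrite -/(Dg i) ler_norml => /andP[h1 h2].
have N1 : 1 <= N%:R :> R by rewrite ler1n.
have := tpR i; move: h1 h2; move: (tp * _) (Dg i) => p q h1 h2 h3; split; lra.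
Qed.

(** The right block stays diagonal after rounding, with entries at least [3 * N]. *)
Lemma alg2_M_row_free : row_free Mr.
Proof.
apply: inj_row_free => x /rowP hx; apply/rowP => i.
have [D3 _] := Dg_bounds i; have D0 : Dg i != 0.
  by apply: lt0r_neq0; apply: lt_le_trans D3; rewrite mulr_gt0.
have := hx (rshift (N * N) i); rewrite !mxE (bigD1 i) //= big1 => [|k ki].
  rewrite [X in _ * X + _]mxE M_r eqxx addr0 => /eqP; rewrite mulf_eq0 (negbTE D0) orbF.
  by move=> /eqP.
by rewrite [X in _ * X]mxE M_r (negbTE ki) mulr0.
Qed.

Lemma LLL_output_exists : exists U, LLL_output (I := I) U.
Proof. exact: (LLL_exists alg2_M_row_free). Qed.

Section Output.
Variables (U : 'M[int]_N) (r : nat).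
Hypotheses (r2 : (r < 2)%N).
Local Notation Ur i := ((nth_row U r 0 i)%:~R : R).
Local Notation yr j := ((nth_row (U *m alg2_M I) r 0 j)%:~R : R).
Local Notation eta := (tp / (N + N * N)%:R).

Let rN : (r < N)%N.
Proof. by apply: leq_trans r2 _; apply: leq_trans (numN_ge6 d2). Qed.

Let yrE j : yr j = \sum_i Ur i * (alg2_M I i j)%:~R.
Proof.
rewrite -[r]/(val (Ordinal rN)) !nth_row_ord mxE mxE rmorph_sum.
by apply: eq_bigr => i _; rewrite rmorphM !mxE.
Qed.

Let yr_r i : `|yr (rshift (N * N) i)| = `|Ur i| * Dg i.
Proof.
have [D3 _] := Dg_bounds i.
rewrite yrE (bigD1 i) //= big1 ?addr0 => [|k ki].
  rewrite M_r eqxx normrM [X in _ * X]ger0_norm //.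
  by apply: le_trans D3; rewrite mulr_ge0 // ltW.
by rewrite M_r (negbTE ki) mulr0.
Qed.

(* [tp * P_r] is the sum of the interpolation error, which the right block of
   the lattice vector dominates, of the rounding error, and of the Chebyshev
   expansion given by the left block of the lattice vector. *)
Lemma poly_small x t : passes (I := I) U -> a1 <= x <= b1 -> - w^-1 <= t <= w^-1 ->
  `|eval2 (alg2_P (I := I) U r) (u%:R * x) (v%:R * (real_part f x + t))| < 1.
Proof.
(* AM-GM, used instead of Cauchy-Schwarz to bound an l1-norm by an l2-norm. *)
have aux1 (p e : R) : 12 * e * `|p| <= 36 * p ^+ 2 + e ^+ 2.
  rewrite -(real_normK (num_real p)).
  by have := sqr_ge0 (6 * `|p| - e); nra.
have aux5 (q a m t' p : R) : t' * (a * (p * q - m) + a * m) = a * (p * (q * t')).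
  by ring.
have aux6 (p a z S : R) : p * (a * z) = a * (p * (z - S)) + a * (p * S) by ring.
have aux2 (p e n : R) : p <= e ^+ 2 ->
    36 * p + n * e ^+ 2 <= 12 * e * (3 * e + n * e / 12) by move=> ?; nra.
have aux3 (p1 p2 p3 z v' q1 q2 : R) : p1 <= z + v' -> p2 <= q2 -> p3 <= q1 ->
    p1 + p2 + p3 <= q1 + z + v' + q2 by move=> ? ? ?; lra.
have aux4 (n V e S : R) : 6 <= n -> 0 <= V -> 3 * V <= e -> 0 < e ->
    S <= 3 * e + (n + n * n) * e / 12 -> S + V + n * n * V < (n + n * n) * e.
  move=> n6 V0 Ve e0 Sle.
  have h1 : (1 + n * n) * (3 * V) <= (1 + n * n) * e.
    by rewrite ler_wpM2l // addr_ge0 // mulr_ge0 //; lra.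
  have h2 : 36 * e <= (n + n * n) * e by rewrite ler_pM2r //; nra.
  have h3 : (1 + n * n) * e <= (n + n * n) * e by rewrite ler_pM2r //; lra.
  lra.
move=> /forallP/(_ (Ordinal r2)) /= hp hx ht.
have N6 : 6 <= N%:R :> R by rewrite ler_nat numN_ge6.
have NN : (N + N * N)%:R = N%:R + N%:R * N%:R :> R by rewrite natrD natrM.
have NN' : (N * N + N)%:R = N%:R + N%:R * N%:R :> R by rewrite natrD natrM addrC.
have NN0 : 0 < (N + N * N)%:R :> R by rewrite ltr0n addn_gt0 N0.
have eta0 : 0 < eta by rewrite divr_gt0.
have sq_le : \sum_j yr j ^+ 2 <= eta ^+ 2.
  have -> : \sum_j yr j ^+ 2 =
      sqnorm (map_mx intr (nth_row (U *m alg2_M I) r) : 'rV[R]_(N * N + N)).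
    by apply: eq_bigr => j _; rewrite mxE.
  rewrite -ler_sqrt ?sqr_ge0 // sqrtr_sqr (ger0_norm (ltW eta0)).
  exact: hp.
have y_le j : `|yr j| <= eta.
  have n2 : (0 < 2)%N by [].
  rewrite -(ler_pXn2r n2) ?nnegrE ?(ltW eta0) // real_normK ?num_real //.
  apply: le_trans sq_le; rewrite (bigD1 j) //= lerDl sumr_ge0 // => k _.
  exact: sqr_ge0.
pose S := \sum_j `|yr j|.
have S_le : S <= 3 * eta + (N * N + N)%:R * eta / 12.
  have e12 : 0 < 12 * eta by rewrite mulr_gt0.
  rewrite -(ler_pM2l e12) /S mulr_sumr.
  apply: (@le_trans _ _ (\sum_(j < N * N + N) (36 * yr j ^+ 2 + eta ^+ 2))).
    apply: ler_sum => j _; exact: aux1.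
  rewrite big_split /= -mulr_sumr sumr_const card_ord -[X in _ + X]mulr_natl.
  exact: aux2.
have [T [T1 Terr]] := alg2_A1_err hx ht.
(* As the diagonal entries are at least [3 * N], [V] is at most a third of [eta]; this keeps the
   accumulated rounding errors small. *)
pose V := \sum_i `|Ur i|; pose Z := \sum_i `|yr (rshift (N * N) i)|.
have ZV : 3 * N%:R * V <= Z.
  rewrite /V mulr_sumr; apply: ler_sum => i _; rewrite yr_r mulrC ler_wpM2l //.
  by have [] := Dg_bounds i.
have Z_le : Z <= N%:R * eta.
  apply: (@le_trans _ _ (\sum_(i < N) eta)); first by apply: ler_sum.
  by rewrite sumr_const card_ord -[leLHS]mulr_natl.
have SE : S = \sum_j `|yr (lshift N j)| + Z by rewrite /S big_split_ord.
rewrite eval2_alg2_P /=.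
set P := \sum_(i < _) _.
have PE : tp * P = \sum_i Ur i * (tp * (basis_fun I (expo d i).1 (expo d i).2 x t -
        \sum_j alg2_A1 I i j * T j)) +
    \sum_j T j * \sum_i Ur i * (tp * alg2_A1 I i j - (alg2_M I i (lshift N j))%:~R) +
    \sum_j T j * yr (lshift N j).
  rewrite -addrA -big_split /=.
  have -> : \sum_j (T j * (\sum_i Ur i * (tp * alg2_A1 I i j -
      (alg2_M I i (lshift N j))%:~R)) + T j * yr (lshift N j)) =
      \sum_i Ur i * (tp * \sum_j alg2_A1 I i j * T j).
    under [RHS]eq_bigr do rewrite !mulr_sumr.
    rewrite [RHS]exchange_big /=; apply: eq_bigr => j _.
    rewrite yrE -mulrDr -big_split mulr_sumr; apply: eq_bigr => i _; exact: aux5.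
  rewrite -big_split /P mulr_sumr; apply: eq_bigr => i _.
  exact: aux6.
have b1' : `|\sum_i Ur i * (tp * (basis_fun I (expo d i).1 (expo d i).2 x t -
        \sum_j alg2_A1 I i j * T j))| <= Z + V.
  apply: le_trans (ler_norm_sum _ _ _) _; rewrite /Z /V -big_split /=.
  apply: ler_sum => i _; rewrite !normrM (ger0_norm (ltW tp0)) yr_r.
  have [_ D1] := Dg_bounds i.
  rewrite -[X in _ <= _ + X]mulr1 -mulrDr ler_wpM2l // (le_trans _ D1) //.
  by rewrite ler_pM2l.
have b2' : `|\sum_j T j * \sum_i Ur i * (tp * alg2_A1 I i j -
     (alg2_M I i (lshift N j))%:~R)| <= N%:R * N%:R * V.
  apply: le_trans (ler_norm_sum _ _ _) _.
  apply: (@le_trans _ _ (\sum_(j < N * N) V)); last first.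
    by rewrite sumr_const card_ord -[leLHS]mulr_natl natrM.
  apply: ler_sum => j _; rewrite normrM -[V]mul1r ler_pM //.
  apply: le_trans (ler_norm_sum _ _ _) _; apply: ler_sum => i _.
  rewrite normrM -[leRHS]mulr1 ler_wpM2l // M_l; exact: round0_dist.
have b3' : `|\sum_j T j * yr (lshift N j)| <= \sum_j `|yr (lshift N j)|.
  apply: le_trans (ler_norm_sum _ _ _) _; apply: ler_sum => j _.
  by rewrite normrM ler_piMl.
have tpE : tp = (N%:R + N%:R * N%:R) * eta.
  by rewrite -NN [RHS]mulrCA divff ?mulr1 // lt0r_neq0.
(* The part [Z] of the interpolation error and the left block together make up the l1-norm [S]. *)
have tot : `|tp * P| <= S + V + N%:R * N%:R * V.
  rewrite PE (le_trans (ler_normD _ _)) // (le_trans (lerD (ler_normD _ _) (lexx _))) //.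
  by rewrite SE; exact: aux3.
have V0 : 0 <= V by apply: sumr_ge0.
have Veta : 3 * V <= eta.
  rewrite -(ler_pM2l NR0); apply: le_trans Z_le; apply: le_trans ZV.
  by rewrite mulrA (mulrC _ 3).
rewrite normrM (ger0_norm (ltW tp0)) in tot.
rewrite -(ltr_pM2l tp0) mulr1; apply: le_lt_trans tot _.
rewrite [ltRHS]tpE; rewrite NN' in S_le; exact: aux4.
Qed.

End Output.

Lemma alg2_M_abs (c : 'I_(N * N + N) -> R) :
  (forall j, 0 <= c j) ->
  (forall k1 k2 : 'I_N, tp * (4 * (Bm ^+ d / (sg ^+ k1 * w ^+ k2))) <=
     c (lshift N (mxvec_index k1 k2))) ->
  (forall i : 'I_N, tp * (64 * Bm ^+ d * nu) <= c (rshift (N * N) i)) ->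
  forall (i : 'I_N) j, `|Mr i j| <= monuv i * c j.
Proof.
move=> c0 cl cr i j; rewrite mxE.
have m0' : 0 <= monuv i by apply: le_trans (monuv_ge1 i).
have tp0' := ltW tp0.
case: (split_ordP j) => [j' ->|i' ->].
  case/mxvec_indexP: j' => k1 k2; rewrite M_l; apply: le_trans (round0_le _) _.
  rewrite normrM (ger0_norm tp0').
  apply: le_trans (ler_wpM2l tp0' (alg2_A1_le i k1 k2)) _.
  apply: le_trans (ler_wpM2l m0' (cl k1 k2)).
  rewrite le_eqVlt; apply/orP; left; apply/eqP.
  have aux (p m b q : R) : p * (4 * (m * b / q)) = m * (p * (4 * (b / q))) by ring.
  exact: aux.
rewrite M_r; case: eqP => [->|_]; last by rewrite normr0 mulr_ge0.
apply: le_trans (round0_le _) _; rewrite normrM (ger0_norm tp0').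
rewrite (ger0_norm (ltW (R_gt0 i'))); have /andP[_ h] := alg2_R_bounds i'.
apply: le_trans (ler_wpM2l tp0' h) _.
have m0'' : 0 <= monuv i' by apply: le_trans (monuv_ge1 i').
apply: le_trans (ler_wpM2l m0'' (cr i')).
rewrite le_eqVlt; apply/orP; left; apply/eqP.
have aux (p m b q : R) : p * (64 * m * b * q) = m * (p * (64 * b * q)) by ring.
exact: aux.
Qed.

Lemma det_alg2_M_le (c : 'I_(N * N + N) -> R) (X : R) :
  (forall j, 0 <= c j) ->
  (forall k1 k2 : 'I_N, tp * (4 * (Bm ^+ d / (sg ^+ k1 * w ^+ k2))) <=
     c (lshift N (mxvec_index k1 k2))) ->
  (forall i : 'I_N, tp * (64 * Bm ^+ d * nu) <= c (rshift (N * N) i)) ->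
  0 <= X ->
  (forall J : 'I_N -> 'I_(N * N + N), injective J -> \prod_i c (J i) <= X) ->
  \det (Mr *m Mr^T) <=
    N`!%:R * (N * N + N)%:R ^+ N * (\prod_(i < N) monuv i) ^+ 2 * X ^+ 2.
Proof.
move=> c0 cl cr X0 hX.
apply: det_gram_le c0 (alg2_M_abs c0 cl cr) X0 hX => i.
exact: le_trans (monuv_ge1 i).
Qed.

(** A unimodular [U] preserves the Gram determinant, so [LLL_bound] can be fed with the determinant
    of the original rows. *)
Lemma LLL_output_passes (U : 'M[int]_N) (D : R) :
  LLL_output (I := I) U -> \det (Mr *m Mr^T) <= D ->
  2 ^+ (N.+1 * N.-1) * D <= (tp / (N + N * N)%:R) ^+ 2 ^+ N.-1 ->
  passes (I := I) U.
Proof.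
move=> [Uu hU] hD hD2; apply/forallP => -[r r2] /=.
have N6 := numN_ge6 d2.
have eta0 : 0 <= tp / (N + N * N)%:R by rewrite divr_ge0 // ltW.
have Umu : (map_mx intr U : 'M[R]_N) \in unitmx.
  by rewrite unitmxE det_map_mx rmorph_unit // -unitmxE.
have UMf : row_free (map_mx intr (U *m alg2_M I) : 'M[R]_(N, N * N + N)).
  by rewrite /row_free map_mxM eqmxMfull ?row_full_unit //; exact: alg2_M_row_free.
have N1 : (1 < N)%N by exact: leq_trans N6.
have := LLL_bound N1 UMf hU r2.
set y := sqnorm _; rewrite map_mxM trmx_mul => h.
have dE : \det (map_mx intr U *m Mr *m (Mr^T *m (map_mx intr U)^T)) = \det (Mr *m Mr^T).
  rewrite -mulmxA (mulmxA Mr) mulmxA !det_mulmx det_tr det_map_mx.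
  have : \det U \is a GRing.unit by rewrite -unitmxE.
  rewrite int_unitE => /eqP hd.
  have -> : (\det U)%:~R * (\det (Mr *m Mr^T)) * (\det U)%:~R =
     ((\det U) ^+ 2)%:~R * \det (Mr *m Mr^T) by rewrite rmorphXn /=; ring.
  suff -> : \det U ^+ 2 = 1 by rewrite mul1r.
  by have [->|->] : \det U = 1 \/ \det U = -1 by move: (\det U) hd; clear=> z ?; lia.
have y0 : 0 <= y by apply: sumr_ge0 => j _; exact: sqr_ge0.
have yle : y <= (tp / (N + N * N)%:R) ^+ 2.
  have n1 : (0 < N.-1)%N by rewrite -ltnS (ltn_predK N1).
  rewrite -(ler_pXn2r n1) ?nnegrE ?sqr_ge0 //; apply: le_trans hD2; apply: le_trans h _.
  by rewrite dE ler_wpM2l // exprn_ge0.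
by rewrite -[leRHS](ger0_norm eta0) -sqrtr_sqr ler_sqrt ?sqr_ge0.
Qed.

(** Only the first summand of [nu] is kept; [tp] is then at most of order [sg ^+ N], up to factors
    exponential in [N]. *)
Lemma tprec_le : tp * (64 * kap ^+ d * (theta / sg) ^+ N) <= 8 * N%:R.
Proof.
have [_ _ h] := tprec_bounds; apply: le_trans h; rewrite ler_pM2l //.
apply: le_trans minR_bounds; rewrite ler_pM2l ?mulr_gt0 ?exprn_gt0 //.
by rewrite -[theta / sg]invf_div exprVn lerDl invr_ge0 exprn_ge0 // divr_ge0 // ltW.
Qed.

(** * A call expressed through the number of subintervals *)

Section Final.
(** [expR k] will be the number of calls. [Lam] absorbs [theta] and the bounded ratio of [sg] to
    [expR k], so powers of [sg] become powers of [expR k] at the cost of [Lam ^+ N]. *)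
Variables (k g l Lam : R).
Hypotheses (l1 : 1 <= l) (g1 : 1 <= g) (gl : N%:R = g * l) (k0 : 0 <= k)
  (Lam1 : 1 <= Lam) (thLam : theta <= Lam) (Lam_sg : theta * expR k <= Lam * sg)
  (sg_Lam : sg <= Lam * expR k) (wE : w = expR (k * g))
  (key : N%:R * (10 - ln kap + ln Bm + 2 * ln Lam) + d%:R / 3 * (ln u%:R + ln v%:R)
     <= (g * psi l - 2) * k).

Let Lam0 : 0 < Lam. Proof. exact: lt_le_trans Lam1. Qed.

Let inv_rho1 : (sg / theta)^-1 <= Lam * expR (- k).
Proof.
rewrite invf_div ler_pdivrMr // expRN mulrAC ler_pdivlMr ?expR_gt0 //.
Qed.

Let inv_rho2 : (w / theta)^-1 <= Lam * expR (- k).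
Proof.
rewrite invf_div wE -expRN.
apply: ler_pM => //; rewrite ?expR_ge0 ?(ltW th0) // ler_expR lerN2.
by rewrite ler_peMr.
Qed.

Let nu_le : nu <= 2 * (Lam ^+ N * expR (- (k * N%:R))).
Proof.
have e : expR (- (k * N%:R)) = expR (- k) ^+ N by rewrite -expRM_natr mulNr.
rewrite e -exprMn [leRHS]mulr_natl mulr2n lerD // -exprVn lerXn2r ?nnegrE //.
- by rewrite invr_ge0 divr_ge0 // ltW.
- by rewrite mulr_ge0 ?expR_ge0 // ltW.
- by rewrite invr_ge0 divr_ge0 // ltW.
- by rewrite mulr_ge0 ?expR_ge0 // ltW.
Qed.

Let W : R := tp * (128 * Bm ^+ d * Lam ^+ N).
Let c (j : 'I_(N * N + N)) : R := W * expR (- (k * col_weight N g l 0 j)).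

Let W0 : 0 < W.
Proof.
by rewrite /W mulr_gt0 // mulr_gt0 ?exprn_gt0 // mulr_gt0 ?exprn_gt0 // (lt_le_trans ltr01).
Qed.

Let c_l (k1 k2 : 'I_N) : tp * (4 * (Bm ^+ d / (sg ^+ k1 * w ^+ k2))) <=
  c (lshift N (mxvec_index k1 k2)).
Proof.
rewrite /c /col_weight row_mxEl mxvecE mxE /W.
have Bd0 : 0 < Bm ^+ d by rewrite exprn_gt0 // (lt_le_trans ltr01).
have h1 : (sg ^+ k1)^-1 <= Lam ^+ N * expR (- (k * k1%:R)).
  have -> : expR (- (k * k1%:R)) = expR (- k) ^+ k1 by rewrite -expRM_natr mulNr.
  apply: (@le_trans _ _ (Lam ^+ k1 * expR (- k) ^+ k1)).
    rewrite -exprMn -exprVn lerXn2r ?nnegrE ?invr_ge0 ?(ltW sg0) //.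
      by rewrite mulr_ge0 ?expR_ge0 // ltW.
    rewrite -[leLHS]mul1r ler_pdivrMr // mulrAC expRN ler_pdivlMr ?expR_gt0 //.
    rewrite mul1r; apply: le_trans Lam_sg; rewrite ler_peMl ?expR_ge0 //.
    by apply: le_trans theta2; rewrite ler1n.
  by rewrite ler_wpM2r ?exprn_ge0 ?expR_ge0 // ler_weXn2l // ltnW.
have h2 : (w ^+ k2)^-1 = expR (- (k * (g * k2%:R))).
  by rewrite wE -expRM_natr -expRN mulrA.
have aux (t b L s1 s2 e1 : R) : 0 < t -> 0 < b -> 0 <= L -> 0 <= s2 -> 0 <= e1 ->
    s1 <= L * e1 -> t * (4 * (b * (s1 * s2))) <= t * (128 * b * L) * (e1 * s2).
  move=> t0 b0 L0 s20 e10 h.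
  have -> : t * (128 * b * L) * (e1 * s2) = t * (128 * (b * ((L * e1) * s2))) by ring.
  rewrite ler_pM2l //; have b0' := ltW b0.
  have p1 : b * (s1 * s2) <= b * (L * e1 * s2) by rewrite ler_wpM2l // ler_wpM2r.
  have p2 : 0 <= b * (L * e1 * s2) by rewrite !mulr_ge0.
  by move: (b * (s1 * s2)) (b * _) p1 p2 => *; lra.
rewrite invfM h2 (mulrDr k) opprD expRD.
by apply: aux => //; rewrite ?expR_ge0 // exprn_ge0 // ltW.
Qed.

Let c_r (i : 'I_N) : tp * (64 * Bm ^+ d * nu) <= c (rshift (N * N) i).
Proof.
rewrite /c /col_weight row_mxEr mxE /W.
have Bd0 : 0 < Bm ^+ d by rewrite exprn_gt0 // (lt_le_trans ltr01).
have h : expR (- (k * N%:R)) <= expR (- (k * (g * phi_inv l))).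
  rewrite ler_expR lerN2 ler_wpM2l // gl ler_pM2l ?phi_inv_le //.
  exact: lt_le_trans g1.
have h2 : nu <= 2 * (Lam ^+ N * expR (- (k * (g * phi_inv l)))).
  apply: le_trans nu_le _; rewrite ler_pM2l // ler_pM2l // exprn_gt0 //.
have aux (t b n L e : R) : 0 < t -> 0 < b -> n <= 2 * (L * e) ->
    t * (64 * b * n) <= t * (128 * b * L) * e.
  move=> t0 b0 hn.
  have -> : t * (128 * b * L) * e = t * (64 * b * (2 * (L * e))) by ring.
  by rewrite ler_pM2l // ler_pM2l // mulr_gt0.
exact: aux.
Qed.

Let prod_c (J : 'I_N -> 'I_(N * N + N)) : injective J ->
  \prod_i c (J i) <= W ^+ N * expR (- (k * (N%:R * (g * psi l) - N%:R))).
Proof.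
move=> Ji; rewrite /c big_split /= prodr_const card_ord ler_pM2l ?exprn_gt0 //.
rewrite -(big_morph expR (@expRD R) (@expR0 R)) ler_expR.
rewrite sumrN lerN2 -mulr_sumr ler_wpM2l //.
by apply: sum_col_weight_ge => //; exact: lt_le_trans g1.
Qed.

Let ln_monuv : 3 * ln (\prod_(i < N) monuv i) = N%:R * d%:R * (ln u%:R + ln v%:R).
Proof.
have uR : 0 < u%:R :> R by rewrite ltr0n.
have vR : 0 < v%:R :> R by rewrite ltr0n.
rewrite big_split /=.
rewrite -(big_morph (fun n => u%:R ^+ n : R) (exprD _) (expr0 _)).
rewrite -(big_morph (fun n => v%:R ^+ n : R) (exprD _) (expr0 _)).
rewrite lnMpos ?exprn_gt0 // !lnX_nat // mulrDr !mulrA -natrM.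
by rewrite -[in RHS](natrM R N d) mulrDr -{1}sum_expo1 -sum_expo2 !natrM.
Qed.

Lemma call_passes (U : 'M[int]_N) : LLL_output (I := I) U -> passes (I := I) U.
Proof.
move=> hU; apply: LLL_output_passes hU (det_alg2_M_le _ c_l c_r _ prod_c) _.
- by move=> j; rewrite /c mulr_ge0 ?expR_ge0 // ltW.
- by rewrite mulr_ge0 ?expR_ge0 // exprn_ge0 // ltW.
have tple : ln tp <= N%:R - d%:R * ln kap + N%:R * (ln Lam + k).
  have h := tprec_le.
  have q0 : 0 < 64 * kap ^+ d * (theta / sg) ^+ N.
    by rewrite mulr_gt0 ?exprn_gt0 // ?divr_gt0 // mulr_gt0 ?exprn_gt0.
  have : ln (tp * (64 * kap ^+ d * (theta / sg) ^+ N)) <= ln (8 * N%:R).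
    by rewrite ler_ln // posrE mulr_gt0.
  have ts0 : 0 < theta / sg := divr_gt0 th0 sg0.
  have k64 : 0 < 64 * kap ^+ d by rewrite mulr_gt0 ?exprn_gt0.
  rewrite (lnMpos tp0 q0) (lnMpos k64 (exprn_gt0 N ts0)).
  rewrite (lnMpos (ltr0n R 64) (exprn_gt0 d kap0)) (lnX_nat N ts0) (lnX_nat d kap0).
  rewrite (lnMpos (ltr0n R 8) NR0) => h1.
  have h8 : ln (8 : R) <= ln 64 by rewrite ler_ln ?posrE // ler_nat.
  have hN := ln_nat_le R N.
  have hr : - ln (theta / sg) <= ln Lam + k.
    have -> : - ln (theta / sg) = ln (sg / theta).
      by rewrite (ln_div th0 sg0) (ln_div sg0 th0) opprB.
    rewrite -[X in _ <= _ + X]expRK -lnMpos ?expR_gt0 //.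
    rewrite ler_ln ?posrE ?divr_gt0 ?mulr_gt0 ?expR_gt0 //.
    rewrite ler_pdivrMr //; apply: le_trans sg_Lam _.
    rewrite ler_peMr ?mulr_ge0 ?expR_ge0 ?(ltW Lam0) //.
    by apply: le_trans theta2; rewrite ler1n.
  exact: (ln_combine h1 h8 hN (ler_wpM2l (ltW NR0) hr)).
apply: LLL_numeric tple ln_monuv key => //.
- exact: numN_ge6.
- by apply: prodr_gt0 => i _; exact: lt_le_trans (monuv_ge1 i).
Qed.

Hypothesis v_small : 128 * (B + 1) * Lam ^+ N * v%:R < expR (k * N%:R).

Lemma call_spec :
  [/\ valid_input I, exists U, LLL_output (I := I) U &
      forall U, LLL_output (I := I) U -> passes (I := I) U /\
        forall (r : 'I_2) x t, a1 <= x <= b1 -> - w^-1 <= t <= w^-1 ->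
        `|eval2 (alg2_P (I := I) U r) (u%:R * x) (v%:R * (real_part f x + t))| < 1].
Proof.
split.
- apply: valid_call.
  have B0 : 0 < B + 1 by rewrite addr_gt0 // (lt_le_trans ltr01).
  have vB : 0 < 64 * (v%:R * (B + 1)) by rewrite mulr_gt0 // mulr_gt0 // ltr0n.
  have -> : 64 * nu * v%:R * (B + 1) = 64 * (v%:R * (B + 1)) * nu by ring.
  apply: le_lt_trans (ler_wpM2l (ltW vB) nu_le) _.
  have -> : 64 * (v%:R * (B + 1)) * (2 * (Lam ^+ N * expR (- (k * N%:R)))) =
    (128 * (B + 1) * Lam ^+ N * v%:R) * expR (- (k * N%:R)) by ring.
  by rewrite expRN ltr_pdivrMr ?expR_gt0 // mul1r.
- exact: LLL_output_exists.
- move=> U hU; have pU := call_passes hU; split=> // r x t hx ht.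
  exact: poly_small.
Qed.

End Final.

End OneCall.

(** * From the calls to the solutions *)

Lemma eval2_int (R : realType) (P : {poly {poly int}}) (X Y : int) :
  eval2 P (X%:~R : R) Y%:~R = (P.[Y%:P].[X])%:~R.
Proof.
pose g : {rmorphism {poly int} -> R} := horner_eval (X%:~R : R) \o map_poly intr.
rewrite /eval2 -[fun q : {poly int} => _]/(g : {poly int} -> R).
have gE (q : {poly int}) : g q = (q.[X])%:~R by rewrite /g /= /horner_eval horner_map.
have -> : Y%:~R = g Y%:P by rewrite gE hornerC.
by rewrite horner_map gE.
Qed.

(** A row of a unimodular matrix is nonzero, and distinct indices give distinct monomials, so
    nothing cancels. *)
Lemma alg2_P_neq0 (R : realType) (I : input R) (U : 'M[int]_(numN (in_d I))) r :
  U \in unitmx -> (r < numN (in_d I))%N -> alg2_P U r != 0.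
Proof.
move=> Uu rN; apply/eqP => P0.
have row0 : nth_row U r = 0.
  apply/rowP => i; rewrite mxE.
  have := congr1 (fun P : {poly {poly int}} =>
    P`_(expo (in_d I) i).2`_(expo (in_d I) i).1) P0.
  rewrite !coef0 /alg2_P coef_sum coef_sum (bigD1 i) //= big1 ?addr0 => [|k ki].
    by rewrite coefCM coefXn eqxx mulr1 coefZ coefXn eqxx mulr1.
  rewrite coefCM coefXn; case: eqP => e2; last by rewrite mulr0 coef0.
  rewrite mulr1 coefZ coefXn; case: eqP => e1; last by rewrite mulr0.
  case/eqP: ki; apply: expo_inj.
  by move: e1 e2; case: (expo _ i) => ? ? /=; case: (expo _ k) => ? ? /= -> ->.
have : row (Ordinal rN) U *m invmx U = 0 by rewrite -nth_row_ord row0 mul0mx.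
rewrite -row_mul mulmxV // => /rowP /(_ (Ordinal rN)).
by rewrite !mxE eqxx.
Qed.

Lemma subinterval_cover (R : realType) (alpha beta x : R) (K : nat) :
  alpha < beta -> (0 < K)%N -> alpha <= x <= beta ->
  exists j : 'I_K, alpha + (beta - alpha) * (j%:R / K%:R) <= x <=
    alpha + (beta - alpha) * (j.+1%:R / K%:R).
Proof.
move=> ab K0 /andP[ax xb]; have KR : 0 < K%:R :> R by rewrite ltr0n.
have ba : 0 < beta - alpha by rewrite subr_gt0.
have Km : (K.-1 < K)%N by rewrite (ltn_predK K0).
pose y := (x - alpha) * K%:R / (beta - alpha).
have xE : x = alpha + (beta - alpha) * (y / K%:R).
  by rewrite /y; field; rewrite !lt0r_neq0.
have y0 : 0 <= y by rewrite divr_ge0 ?mulr_ge0 ?subr_ge0 // ltW.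
have yK : y <= K%:R.
  by rewrite /y ler_pdivrMr // mulrC ler_pM2l // lerD2r.
have mono z1 z2 : z1 <= z2 ->
    alpha + (beta - alpha) * (z1 / K%:R) <= alpha + (beta - alpha) * (z2 / K%:R).
  by move=> h; rewrite lerD2l ler_pM2l // ler_pM2r // invr_gt0.
have [h|h] := ltnP (Num.trunc y) K.
  exists (Ordinal h); rewrite xE; apply/andP; split; apply: mono => /=.
    by rewrite truncn_le.
  by rewrite ltW // truncnS_gt.
(* Only [x = beta] is left; it lies in the last subinterval. *)
have yE : y = K%:R.
  apply/eqP; rewrite eq_le yK /=.
  by rewrite -(truncn_le y) in y0; apply: le_trans y0; rewrite ler_nat.
exists (Ordinal Km); rewrite xE yE; apply/andP; split; apply: mono => /=.
  by rewrite ler_nat leq_pred.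
by rewrite (ltn_predK K0).
Qed.

Section Solve.
Variables (R : realType) (alpha beta w rho1 rho2 : R) (f : R[i] -> R[i]).
Variables (u v d K : nat).
Hypotheses (ab : alpha < beta) (K0 : (0 < K)%N) (u0 : (0 < u)%N) (v0 : (0 < v)%N)
  (d1 : (0 < d)%N).
Local Notation inp a b :=
  (call_input f w d u v (Call a b rho1 rho2 (numN d) (numN d))).
Hypothesis calls : forall a b, a < b -> alpha <= a -> b <= beta ->
  b - a = (beta - alpha) / K%:R ->
  [/\ valid_input (inp a b), exists U, LLL_output (I := inp a b) U &
      forall U, LLL_output (I := inp a b) U -> passes (I := inp a b) U /\
        forall (r : 'I_2) x t, a <= x <= b -> - w^-1 <= t <= w^-1 ->
        `|eval2 (alg2_P (I := inp a b) U r) (u%:R * x) (v%:R * (real_part f x + t))| < 1].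

Lemma solved_of_calls : heuristically_solved alpha beta f u v d w K.
Proof.
have KR : 0 < K%:R :> R by rewrite ltr0n.
have ba : 0 < beta - alpha by rewrite subr_gt0.
pose a (j : 'I_K) : R := alpha + (beta - alpha) * (j%:R / K%:R).
pose b (j : 'I_K) : R := alpha + (beta - alpha) * (j.+1%:R / K%:R).
have hab j : [/\ a j < b j, alpha <= a j, b j <= beta & b j - a j = (beta - alpha) / K%:R].
  split.
  - by rewrite ltrD2l ltr_pM2l // ltr_pM2r ?invr_gt0 // ltr_nat.
  - by rewrite lerDl mulr_ge0 ?divr_ge0 // ltW.
  - rewrite /b -lerBrDl -[leRHS]mulr1 ler_pM2l // ler_pdivrMr // mul1r ler_nat.
    exact: ltn_ord.
  - by rewrite /b /a -natr1; field; rewrite lt0r_neq0.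
have spec j := let: And4 h1 h2 h3 h4 := hab j in calls h1 h2 h3 h4.
exists (fun j => Call (a j) (b j) rho1 rho2 (numN d) (numN d)) => I.
split=> /=.
- by move=> j; have [_ ? ? _] := hab j.
- by move=> x hx; exact: subinterval_cover.
- by move=> j; have [] := spec j.
- by move=> j U; have [_ _] := spec j; exact.
move=> U hU ncf.
exists (fun j => [set t : int | root (alg2_res (I := I j) (U j)) t]); split=> [j|X].
  have [_ _ hs] := spec j; have [pU _] := hs (U j) (hU j).
  rewrite /alg2_result pU /= /alg2_res resultant_neq0 //.
  - by apply: alg2_P_neq0; [have [] := hU j | exact: numN_gt0].
  - apply: alg2_P_neq0; first by have [] := hU j.
    exact: leq_ltn_trans d1 (leq_numN d).
move=> [hX [Y hY]]; have [j hj] := subinterval_cover ab K0 hX.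
exists j => /=; have [_ _ hs] := spec j; have [_ hP] := hs (U j) (hU j).
set x := X%:~R / u%:R in hX hY hj.
(* This admissible [t] makes the two arguments of the polynomials the integers [X] and [Y]. *)
pose t : R := Y%:~R / v%:R - real_part f x.
have ht : - w^-1 <= t <= w^-1.
  by rewrite -ler_norml /t distrC ltW // -[w^-1]mul1r.
have uX : u%:R * x = X%:~R by rewrite /x mulrC divfK // pnatr_eq0 -lt0n.
have vY : v%:R * (real_part f x + t) = Y%:~R.
  by rewrite /t addrC subrK mulrC divfK // pnatr_eq0 -lt0n.
have ev (r : 'I_2) : (alg2_P (I := I j) (U j) r).[Y%:P].[X] = 0.
  have := hP r x t hj ht; rewrite uX vY eval2_int.
  rewrite -intr_norm -[1]/(1%:~R) ltr_int; move: (horner _ X) => z.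
  clear; lia.
apply: resultant_root; first exact: ncf.
- exact: (ev 0).
- exact: (ev 1).
Qed.

End Solve.

(** * Numerical inequalities behind the constants *)

Lemma sqrn_le_exp2 n : (n * n <= 4 * 2 ^ n)%N.
Proof.
elim: n => // n IH; have h : (n < 2 ^ n)%N by rewrite ltn_expl.
by rewrite expnS; move: (2 ^ n)%N h IH => p; nia.
Qed.

(** With [theta = 4 * q] the powers of [ms] cancel. There remain [q ^ d <= q ^ (N - d)] and
    [1 + 4 * N ^ 2 <= 64 * 4 ^ (N - d)], both consequences of [2 * d <= N]. *)
Lemma theta_large_num (R : realType) (N d : nat) (q ms : R) :
  1 <= q -> 0 < ms -> (2 * d <= N)%N ->
  (1 + 4 * (N * N)%:R) * (q * ms / 2) ^+ d <=
    64 * (ms / (2 * (4 * q))) ^+ d * (4 * q) ^+ N.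
Proof.
move=> q1 ms0 dN; have q0 : 0 < q by lra.
have dN' : (d <= N)%N by lia.
have -> : 64 * (ms / (2 * (4 * q))) ^+ d * (4 * q) ^+ N =
    (ms / 2) ^+ d * (64 * (4 * q) ^+ (N - d)).
  rewrite -{1}(subnKC dN') exprD.
  have -> : ms / (2 * (4 * q)) = (ms / 2) * (4 * q)^-1.
    by field; rewrite lt0r_neq0.
  rewrite exprMn exprVn; field.
  by rewrite expf_neq0 // mulf_neq0 // lt0r_neq0.
have -> : (q * ms / 2) ^+ d = (ms / 2) ^+ d * q ^+ d by rewrite -exprMn; congr (_ ^+ _); ring.
rewrite mulrCA ler_pM2l ?exprn_gt0 ?divr_gt0 // exprMn mulrA.
apply: ler_pM; rewrite ?exprn_ge0 ?(ltW q0) ?addr_ge0 ?mulr_ge0 //; last first.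
  by rewrite ler_weXn2l //; lia.
apply: (@le_trans _ _ (64 * 2 ^+ N)).
  rewrite -natrX -!natrM -[1]/(1%:R) -natrD ler_nat.
  by have := sqrn_le_exp2 N; have := expn_gt0 2 N; move: (2 ^ N)%N => p; nia.
rewrite ler_pM2l //; have -> : (4 : R) = 2 ^+ 2 by ring.
by rewrite -exprM ler_weXn2l ?ler1n //; lia.
Qed.

(** Used with [n = N], [e = d], [p = psi l], [r = sqrt l]. From [e ^ 2 <= g * n = (g * r) ^ 2]
    follows [g * p >= g * r / 12 >= e / 12]. So [g * p - 2 >= g * r / 24], and the first summand of
    [k] covers [a * n = a * g * r ^ 2]. The second uses [(g * p - 2) * (1 + 48 / e) >= g * p], which
    at [g * p = e / 12] is exactly [48 <= e]. *)
Lemma key_ineq (R : realType) (n e g l p a r k L : R) :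
  48 <= e -> 3 <= g -> n = g * l -> 0 <= r -> r ^+ 2 = l -> r / 12 <= p ->
  e ^+ 2 <= g * n -> 0 <= L -> 0 < a ->
  24 * a * r + e / (3 * p * g) * (1 + 48 / e) * L <= k ->
  0 < p /\ a * n + e / 3 * L <= (g * p - 2) * k.
Proof.
move=> e48 g3 nE r0 rl rp egn L0 a0 hk.
have g0 : 0 < g by lra.
have gr : e <= g * r.
  have : e ^+ 2 <= (g * r) ^+ 2 by rewrite exprMn rl; move: egn; rewrite nE; lra.
  by rewrite ler_pXn2r ?nnegrE ?(mulr_ge0 (ltW g0)) //; lra.
have rpos : 0 < r by rewrite -(pmulr_rgt0 _ g0); lra.
have p0 : 0 < p by lra.
split=> //.
have gp : g * r / 12 <= g * p by rewrite -mulrA ler_pM2l.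
have gp2 : 0 <= g * p - 2 by lra.
apply: le_trans (ler_wpM2l gp2 hk); rewrite mulrDr lerD //.
  have -> : a * n = 24 * a * r * (g * r / 24) by rewrite nE -rl; field.
  rewrite mulrC ler_pM2r; last by rewrite mulr_gt0 // mulr_gt0.
  lra.
rewrite mulrA ler_wpM2r //.
have -> : (g * p - 2) * (e / (3 * p * g) * (1 + 48 / e)) =
    ((g * p - 2) * (e + 48)) / (3 * (g * p)).
  by field; rewrite !lt0r_neq0 //; lra.
rewrite ler_pdivlMr; last by rewrite mulr_gt0 // mulr_gt0.
move: gp gr gp2; move: (g * p) (g * r) => G H h1 h2 h3; nra.
Qed.

Lemma powR_expR (R : realType) (x y : R) : 0 < x -> x `^ y = expR (y * ln x).
Proof. by move=> x0; rewrite /powR gt_eqF. Qed.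

Theorem theorem4p13 (R : realType) (alpha beta : R) (f : R[i] -> R[i])
    (alpha_lt_beta : alpha < beta)
    (f_analytic : analytic_near f (real_segment alpha beta))
    (f_real : forall x : R, alpha <= x <= beta -> complex.Im (f x%:C) = 0)
    (f_transcendental : transcendental_on alpha beta (real_part f)) :
  exists (C : R) (n0 : nat),
    forall (u v d : nat) (gamma : R),
      (n0 <= u)%N -> (n0 <= v)%N -> (n0 <= d)%N ->
      3 <= gamma <= (numN d)%:R ->
      let N : R := (numN d)%:R in
      let uv : R := u%:R * v%:R in
      exists (w : R) (K : nat) (e1 e2 e3 e4 : R),
        [/\ `|e1| <= C * Num.sqrt (gamma * N),
            `|e2| <= C / d%:R,
            `|e3| <= C * Num.sqrt (N / gamma) &
            `|e4| <= C / d%:R] /\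
        [/\ w = 2 `^ e1 *
                uv `^ (d%:R / (3 * psi (N / gamma)) * (1 + e2)),
            K%:R = (beta - alpha) * 2 `^ e3 *
                   uv `^ (d%:R / (3 * psi (N / gamma) * gamma) * (1 + e4)) &
            heuristically_solved alpha beta f u v d w K].
Proof.
have [s [B [s0 B1 hunif]]] := uniform_expansion f_analytic.
have ba : 0 < beta - alpha by rewrite subr_gt0.
pose Qz := s + `|alpha| + `|beta| + 1.
have Q1 : 1 <= Qz by rewrite /Qz lerDr addr_ge0 // addr_ge0 // ltW.
pose Bm := Qz * (B + 1).
have Bp : 1 <= B + 1 by lra.
have Bm1 : 1 <= Bm by rewrite mulr_ege1.
pose ms := Num.min s 1.
have ms0 : 0 < ms by rewrite lt_min s0 ltr01.
have ms1 : ms <= 1 by rewrite ge_min lexx orbT.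
(* Chosen so that [Bm = q * ms / 2], the form used by [theta_large_num]. *)
pose q := 2 * Bm / ms.
have q2 : 2 <= q by rewrite ler_pdivlMr //; lra.
pose theta := 4 * q.
have theta0 : 0 < theta by rewrite /theta; lra.
pose kap := ms / (2 * theta).
have kap0 : 0 < kap by rewrite divr_gt0 // mulr_gt0.
have kap1 : kap <= 1.
  have th2 : 0 < 2 * theta := mulr_gt0 (ltr0n R 2) theta0.
  by rewrite ler_pdivrMr //; apply: le_trans ms1 _; rewrite /theta; lra.
have kapE : kap = ms / (2 * (4 * q)) by [].
have thE : theta = 4 * q by [].
have theta2 : 2 <= theta by rewrite thE; clear - q2; lra.
have kapE' : kap = Num.min s 1 / (2 * theta) by [].
have BmE : Bm = q * ms / 2 by rewrite /q divfK ?lt0r_neq0 //; field.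
have BmE' : Bm = Qz * (B + 1) by [].
clearbody kap theta q Bm.
(* On a subinterval of length [(beta - alpha) / K] the scaled radius is [kb * K]. *)
pose kb := 2 * s / (beta - alpha).
have kb0 : 0 < kb by rewrite divr_gt0 // mulr_gt0.
have kbE : kb = 2 * s / (beta - alpha) by [].
clearbody kb.
have kbV0 : 0 < kb^-1 by rewrite invr_gt0.
(* The three summands serve for [theta <= Lam], [kb <= Lam] and [theta <= Lam * kb]. *)
pose Lam := theta * (1 + kb + kb^-1).
have thLam : theta <= Lam by rewrite /Lam ler_peMr ?ltW //; lra.
have Lam1 : 1 <= Lam by apply: le_trans thLam; rewrite thE; lra.
have Lam0 : 0 < Lam by lra.
have kbLam : theta <= Lam * kb.
  have h : (1 + kb + kb^-1) * kb = kb + kb * kb + 1.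
    by field; rewrite lt0r_neq0.
  rewrite /Lam -mulrA h ler_peMr ?(ltW theta0) // lerDr.
  by rewrite addr_ge0 ?mulr_ge0 // ltW.
have kbLam' : kb <= Lam.
  apply: (@le_trans _ _ (1 + kb + kb^-1)); first by lra.
  by rewrite /Lam ler_peMl ?addr_ge0 ?(ltW kb0) ?(ltW kbV0) // thE; lra.
(* Its [N]-th power bounds the constant in the validity condition [v_small]. *)
pose Z := 128 * (B + 1) * Lam.
have ZE : Z = 128 * (B + 1) * Lam by [].
have Z1 : 128 <= Z.
  rewrite /Z -mulrA ler_peMr //; by rewrite mulr_ege1.
clearbody Z Lam.
have lnZ0 : 0 < ln Z by rewrite ln_gt0 //; lra.
(* [a] is the constant of [LLL_numeric], plus [ln Z] to make the calls valid. *)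
pose a := 10 - ln kap + ln Bm + 2 * ln Lam + ln Z.
have lk : ln kap <= 0 by apply: ln_le0.
have lb : 0 <= ln Bm by apply: ln_ge0.
have lL : 0 <= ln Lam by apply: ln_ge0.
have aE : a = 10 - ln kap + ln Bm + 2 * ln Lam + ln Z by [].
have a10 : 10 <= a by rewrite /a; lra.
have aZ : ln Z < a by rewrite /a; lra.
clearbody a.
have a0 : 0 < a := lt_le_trans (ltr0n R 10) a10.
have ln20 : 0 < ln (2 : R) by rewrite ln_gt0 // ltr1n.
(* Makes [2 ^ (A * r)] supply the term [24 * a * r] of [key_ineq]. *)
pose A := 24 * a / ln 2.
have A0 : 0 <= A by rewrite divr_ge0 ?mulr_ge0 ?(ltW ln20) // (le_trans _ a10).
have A2 : A * ln 2 = 24 * a by rewrite divfK // lt0r_neq0.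
pose c1 := `|ln (beta - alpha)| / ln 2.
have c10 : 0 <= c1 by rewrite divr_ge0 // ltW.
exists (A + 1 + c1 + 48), 48%N => u v d g hu hv hd /andP[g3 gN] N uv.
have u0 : (0 < u)%N by apply: leq_trans hu.
have v0 : (0 < v)%N by apply: leq_trans hv.
have d2 : (1 < d)%N by apply: leq_trans hd.
have d48 : 48 <= d%:R :> R by rewrite ler_nat.
have g0 : 0 < g := lt_le_trans (ltr0n R 3) g3.
have uR : 0 < u%:R :> R by rewrite ltr0n.
have vR : 0 < v%:R :> R by rewrite ltr0n.
have uv0 : 0 < uv by rewrite mulr_gt0.
pose l := N / g.
have l0 : 0 <= l by rewrite divr_ge0 // ltW.
have l1 : 1 <= l by rewrite ler_pdivlMr // mul1r.
have Nl : N = g * l by rewrite /l mulrC divfK // lt0r_neq0.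
pose r := Num.sqrt l.
have r1 : 1 <= r by rewrite -[leLHS]sqrtr1 ler_sqrt.
have r0 : 0 <= r := le_trans ler01 r1.
have r2 : r ^+ 2 = l by rewrite sqr_sqrtr.
have psi_r : r / 12 <= psi l by exact: psi_ge.
have sgN : Num.sqrt (g * N) = g * r.
  have -> : g * N = (g * r) ^+ 2 by rewrite exprMn r2 Nl; ring.
  by rewrite sqrtr_sqr ger0_norm // mulr_ge0 // ltW.
(* Here [3 <= gamma] meets [d ^ 2 <= 3 * N]. *)
have dN : d%:R ^+ 2 <= g * N.
  apply: (@le_trans _ _ (3 * N)); last by rewrite ler_pM2r // ltr0n numN_gt0.
  by rewrite /N -natrM -natrX ler_nat sqrn_le_numN.
have L1 : 0 <= ln v%:R :> R by rewrite ln_ge0 // ler1n.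
have L2 : 0 <= ln u%:R :> R by rewrite ln_ge0 // ler1n.
have lnuv : ln uv = ln u%:R + ln v%:R by rewrite /uv lnMpos.
have L0 : 0 <= ln uv by rewrite lnuv addr_ge0.
pose E := d%:R / (3 * psi l * g) * (1 + 48 / d%:R).
have EE : E = d%:R / (3 * psi l * g) * (1 + 48 / d%:R) by [].
have p0 : 0 < psi l.
  by apply: lt_le_trans psi_r; rewrite divr_gt0 // (lt_le_trans ltr01).
have E0 : 0 <= E.
  have h1 : 0 <= 3 * psi l * g := ltW (mulr_gt0 (mulr_gt0 (ltr0n R 3) p0) g0).
  have h2 : 0 <= 48 / d%:R :> R := (divr_ge0 (ler0n R 48) (ler0n R d)).
  exact: (mulr_ge0 (divr_ge0 (ler0n _ _) h1) (addr_ge0 ler01 h2)).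
clearbody E.
have EL0 : 0 <= E * ln uv := mulr_ge0 E0 L0.
(* The term [A * r * ln 2] makes [K] absorb the factors exponential in [N ^ 2]. *)
pose K0 := expR (A * r * ln 2 + E * ln uv).
have Ar0 : 0 <= A * r * ln 2 := mulr_ge0 (mulr_ge0 A0 r0) (ltW ln20).
have K01 : 1 <= K0.
  by rewrite -[leLHS]expR0 ler_expR; exact: addr_ge0 Ar0 EL0.
(* Rounding up costs a factor at most 2, absorbed in [e3] and, raised to the power [g], in [e1]. *)
pose K := (Num.trunc K0).+1.
have KK0 : K0 <= K%:R by rewrite ltW // truncnS_gt.
have K2 : K%:R <= 2 * K0.
  rewrite /K -natr1 mulr_natl mulr2n lerD // truncn_le.
  exact: le_trans ler01 K01.
have KR : 0 < K%:R :> R by rewrite ltr0n.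
pose k := ln (K%:R : R).
have eK : expR k = K%:R by rewrite lnK // posrE.
have k_lo : A * r * ln 2 + E * ln uv <= k.
  by rewrite -[leLHS]expRK /k ler_ln ?posrE ?expR_gt0.
have k_hi : k <= A * r * ln 2 + E * ln uv + ln 2.
  rewrite -[X in _ <= X + _]expRK -/K0 addrC -lnMpos ?expR_gt0 //.
  by rewrite /k ler_ln ?posrE ?mulr_gt0 ?expR_gt0.
have k0 : 0 <= k := le_trans (addr_ge0 Ar0 EL0) k_lo.
have [_ key] : 0 < psi l /\ a * N + d%:R / 3 * ln uv <= (g * psi l - 2) * k.
  apply: (key_ineq d48 g3 Nl r0 r2 psi_r dN L0 a0).
  by apply: le_trans k_lo; rewrite -A2 -EE mulrAC.
(* Since [psi l <= phi_inv l <= l], [g * psi l] is at most [N]; thus [key] also yields the validity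
   condition on [v]. *)
have gk : (g * psi l - 2) * k <= k * N.
  rewrite mulrC ler_wpM2l // Nl.
  apply: (@le_trans _ _ (g * psi l)); first by rewrite gerBl.
  by rewrite ler_pM2l // (le_trans (psi_le l1)) // phi_inv_le.
have N1 : 1 <= N by rewrite /N ler1n numN_gt0.
have N0 : 0 <= N := le_trans ler01 N1.
have third : ln (v%:R : R) <= d%:R / 3 * ln uv.
  rewrite -[leLHS]mul1r; apply: ler_pM => //; last by rewrite lnuv lerDr.
  by rewrite ler_pdivlMr // mul1r (le_trans _ d48) // ler_nat.
have kN : a * N + ln v%:R <= k * N.
  by apply: le_trans gk; apply: le_trans key; rewrite lerD2l.
have ka : a <= k.
  have : a * N <= k * N by apply: le_trans kN; rewrite lerDl.
  by rewrite ler_pM2r // (lt_le_trans ltr01).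
have Zpos : 0 < Z by apply: lt_le_trans Z1.
have ZK : Z <= expR k.
  by rewrite -[leLHS]lnK ?posrE // ler_expR (le_trans (ltW aZ)).
have LamK : 2 * Lam <= expR k.
  apply: le_trans ZK; rewrite ZE ler_pM2r // -[leLHS]mulr1 ler_pM // ler_nat //.
have v_small : 128 * (B + 1) * Lam ^+ numN d * v%:R < expR (k * N).
  apply: (@le_lt_trans _ _ (Z ^+ numN d * v%:R)).
    rewrite ler_wpM2r // ZE exprMn ler_wpM2r ?exprn_ge0 ?(ltW Lam0) //.
    rewrite ler_eXnr ?numN_gt0 //.
    by rewrite -[leLHS]mulr1 ler_pM // ler1n.
  rewrite -[ltLHS]lnK ?posrE ?mulr_gt0 ?exprn_gt0 // ltr_expR.
  rewrite lnMpos ?exprn_gt0 // lnX_nat //; apply: lt_le_trans kN.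
  by rewrite ltrD2r mulrC ltr_pM2r // (lt_le_trans ltr01).
have sg_ge : 2 * theta <= kb * expR k.
  apply: le_trans (_ : 2 * Lam * kb <= _); first by rewrite -mulrA ler_pM2l.
  by rewrite mulrC ler_pM2l.
pose w := expR (k * g).
have g1 : 1 <= g := le_trans (ler1n R 3 : 1 <= 3) g3.
have w_ge : 2 * theta <= w.
  apply: le_trans (_ : expR k <= _); last by rewrite ler_expR ler_peMr.
  by apply: le_trans LamK; rewrite ler_pM2l.
have big : (1 + 4 * (numN d * numN d)%:R) * Bm ^+ d <=
    64 * kap ^+ d * theta ^+ numN d.
  rewrite BmE kapE thE; apply: theta_large_num => //.
    exact: le_trans (ler1n R 2) q2.
  exact: double_le_numN.
(* [e1] and [e3] are what remains of [w] and [K] after splitting off the power of [uv], and for [K]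
   the length [beta - alpha]. As [w = K ^ g], the same [48 / d] fits both exponents. *)
pose e1 := (k * g - g * E * ln uv) / ln 2.
pose e3 := (k - E * ln uv - ln (beta - alpha)) / ln 2.
exists w, K, e1, (48 / d%:R), e3, (48 / d%:R).
have C48 : 48 <= A + 1 + c1 + 48 by rewrite lerDr !addr_ge0.
have dR : 0 < d%:R :> R by apply: lt_le_trans d48.
split; split.
- rewrite sgN.
  have h : `|e1| <= (A + 1) * (g * r).
    have e1E : e1 = g * ((k - E * ln uv) / ln 2) by rewrite /e1; ring.
    rewrite e1E normrM (ger0_norm (ltW g0)) mulrCA ler_pM2l //.
    rewrite ger0_norm; last by rewrite divr_ge0 ?(ltW ln20) // subr_ge0 (le_trans _ k_lo) // lerDr.
    rewrite ler_pdivrMr // mulrDl mul1r mulrDl.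
    rewrite lerBlDr (le_trans k_hi) // [leLHS]addrAC lerD2r lerD2l.
    by rewrite ler_peMl // ltW.
  apply: le_trans h _; rewrite ler_wpM2r ?mulr_ge0 ?(ltW g0) //.
  by rewrite -addrA lerDl addr_ge0.
- by rewrite ger0_norm ?divr_ge0 // ler_pM2r ?invr_gt0.
- rewrite -/l -/r.
  have h0 : 0 <= k - E * ln uv by rewrite subr_ge0 (le_trans _ k_lo) // lerDr.
  have hA : 0 <= A * r := mulr_ge0 A0 r0.
  have hk : (k - E * ln uv) / ln 2 <= A * r + 1.
    by rewrite ler_pdivrMr // mulrDl mul1r lerBlDr addrAC.
  have e3E : e3 = (k - E * ln uv) / ln 2 - ln (beta - alpha) / ln 2.
    by rewrite /e3 mulrBl.
  rewrite e3E; apply: le_trans (ler_normB _ _) _.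
  rewrite normrM [in X in _ + X]normrM (ger0_norm h0) normfV (gtr0_norm ln20) -/c1.
  have hr : (1 + c1 + 48) * 1 <= (1 + c1 + 48) * r.
    have h49 : 0 <= 1 + c1 + 48 := addr_ge0 (addr_ge0 ler01 c10) (ler0n R 48).
    by apply: ler_wpM2l r1.
  by clear - hk hr c10; lra.
- by rewrite ger0_norm ?divr_ge0 // ler_pM2r ?invr_gt0.
- rewrite !powR_expR // /w -expRD; congr expR.
  rewrite /e1 divfK ?lt0r_neq0 // EE -/l; field.
  by rewrite !lt0r_neq0.
- rewrite !powR_expR // -/l -EE -mulrA -expRD /e3 divfK ?lt0r_neq0 //.
  rewrite -[X in X * _]lnK ?posrE // -expRD -eK; congr expR; ring.
(* All subintervals have the same length, so one pair of ellipse parameters serves every call. *)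
- apply: (@solved_of_calls _ _ _ _ (kb * K%:R / theta) (w / theta)) => //.
    exact: ltnW.
  move=> a1 b1 ab1 aa1 bb1 hab.
  have hm : alpha <= (a1 + b1) / 2 <= beta by clear -ab1 aa1 bb1; apply/andP; split; lra.
  have [m0 [r0' [hr0 hexp]]] := hunif _ hm.
  have sgE : kb * K%:R = 2 * s / (b1 - a1).
    by rewrite hab kbE; field; rewrite !lt0r_neq0.
  rewrite sgE; apply: (@call_spec R f a1 b1 w theta s B Qz m0 r0' d u v _ _ _ _ _ _ _ _ _ _ hr0 hexp _ _ k g l Lam) => //; rewrite -?sgE -?BmE' -?kapE' -?eK //.
  + apply: (@le_trans _ _ (s + `|alpha| + `|beta|)); last by rewrite lerDl.
    rewrite addrC -addrA lerD2l; clear - hm; case/andP: hm.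
    move: (_ / 2) => m h1 h2; case: (ger0P m) => m0.
      by rewrite (le_trans h2) // (le_trans (ler_norm _)) // lerDr.
    rewrite (le_trans (_ : _ <= - alpha)) ?lerN2 //.
    by rewrite (le_trans (ler_norm _)) // normrN lerDl.
  + by rewrite mulrA ler_pM2r ?expR_gt0.
  + by rewrite ler_pM2r ?expR_gt0.
  + rewrite -lnuv mulrC; apply: le_trans key.
    by rewrite lerD2r ler_wpM2r // aE lerDl ltW.
Qed.
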